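(* Let $\mathbf{a}$ be one of the $35$ vectors in the list below, with associated constant $N_{\mathbf{a}}$ and (except for $(1,2,4,5)$) associated finite set $E_{\mathbf{a}}$: $(1,1,1,1)$: $711$, $\{9,21,31,43,55,89\}$; $(1,1,1,2)$: $3769$, $\emptyset$; $(1,1,1,3)$: $10473$, $\{19\}$; $(1,1,1,4)$: $5453$, $\{8\}$; $(1,1,2,2)$: $1120$, $\emptyset$; $(1,1,2,3)$: $5453$, $\emptyset$; $(1,1,2,4)$: $6294$, $\emptyset$; $(1,1,2,5)$: $2373728$, $\emptyset$; $(1,1,2,6)$: $73138$, $\emptyset$; $(1,1,2,7)$: $324897$, $\{28\}$; $(1,1,2,8)$: $88555$, $\{39\}$; $(1,1,2,9)$: $1550980$, $\{18\}$; $(1,1,3,3)$: $14295$, $\{14\}$; $(1,1,3,4)$: $65428$, $\{11,18,81\}$; $(1,1,3,5)$: $73138$, $\{19\}$; $(1,1,3,6)$: $324897$, $\emptyset$; $(1,1,3,7)$: $801954$, $\{14,18\}$; $(1,2,2,2)$: $16902$, $\{8,43,67,135\}$; $(1,2,2,3)$: $1529$, $\{33\}$; $(1,2,2,4)$: $1054175$, $\emptyset$; $(1,2,2,5)$: $32354$, $\{23,33\}$; $(1,2,2,6)$: $1302606$, $\emptyset$; $(1,2,3,3)$: $262933$, $\{34,99\}$; $(1,2,3,4)$: $18114$, $\emptyset$; $(1,2,3,5)$: $1302606$, $\emptyset$; $(1,2,3,6)$: $1426798$, $\{63\}$; $(1,2,3,7)$: $23841$, $\emptyset$; $(1,2,3,8)$: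 $103969$, $\{31,63\}$; $(1,2,3,9)$: $7205634$, $\{42\}$; $(1,2,4,4)$: $578265$, $\{17\}$; $(1,2,4,5)$: $N_{\mathbf{a}}=355873$; $(1,2,4,6)$: $1550980$, $\emptyset$; $(1,2,4,7)$: $12687051$, $\emptyset$; $(1,2,4,8)$: $1799322$, $\emptyset$; $(1,2,4,12)$: $2295950$, $\{8,138\}$. (1) If $\mathbf{a}\neq(1,2,4,5)$, then every integer $N\ge N_{\mathbf{a}}$ is represented by $P_{5,\mathbf{a}}$ over $\mathbb{N}_0$; moreover $E(P_{5,\mathbf{a}})=E_{\mathbf{a}}$. (2) If $\mathbf{a}=(1,2,4,5)$, then every integer $N\ge 355873$ with $N \bmod 12\in\{0,3,4,6,7,8,9,11\}$ is represented by $P_{5,\mathbf{a}}$ over $\mathbb{N}_0$.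
   Context: $\mathbb{N}_0=\{0,1,2,\dots\}$. $P_5(x)=\frac{3x^2-x}{2}$. For $\mathbf{a}=(a_1,\dots,a_k)\in\mathbb{N}^k$, $P_{5,\mathbf{a}}(\mathbf{x})=\sum_{i=1}^k a_iP_5(x_i)$. An integer $N$ is represented by $P_{5,\mathbf{a}}$ over $\mathbb{N}_0$ if $P_{5,\mathbf{a}}(\mathbf{x})=N$ for some $\mathbf{x}\in\mathbb{N}_0^k$. $E(P_{5,\mathbf{a}})$ denotes the set of non-negative integers not represented by $P_{5,\mathbf{a}}$ over $\mathbb{N}_0$. *)

(* Defs.v *)
From mathcomp Require Import all_boot.
Set Implicit Arguments. Unset Strict Implicit. Unset Printing Implicit Defensive.

(* Pentagonal numbers P_5(x) = (3x^2 - x)/2, on N_0 (always exact). *)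
Definition P5 (x : nat) : nat := (3 * x ^ 2 - x) %/ 2.

Definition P5a (a : seq nat) (x : nat -> nat) : nat :=
  \sum_(i < size a) nth 0 a i * P5 (x i).

Definition represented (a : seq nat) (N : nat) : Prop :=
  exists x : nat -> nat, P5a a x = N.

(* The table of the 34 vectors a <> (1,2,4,5), with N_a and E_a. *)
Definition table : seq (seq nat * nat * seq nat) :=
  [:: ([:: 1; 1; 1; 1], 711, [:: 9; 21; 31; 43; 55; 89]);
      ([:: 1; 1; 1; 2], 3769, [::]);
      ([:: 1; 1; 1; 3], 10473, [:: 19]);
      ([:: 1; 1; 1; 4], 5453, [:: 8]);
      ([:: 1; 1; 2; 2], 1120, [::]);
      ([:: 1; 1; 2; 3], 5453, [::]);
      ([:: 1; 1; 2; 4], 6294, [::]);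
      ([:: 1; 1; 2; 5], 2373728, [::]);
      ([:: 1; 1; 2; 6], 73138, [::]);
      ([:: 1; 1; 2; 7], 324897, [:: 28]);
      ([:: 1; 1; 2; 8], 88555, [:: 39]);
      ([:: 1; 1; 2; 9], 1550980, [:: 18]);
      ([:: 1; 1; 3; 3], 14295, [:: 14]);
      ([:: 1; 1; 3; 4], 65428, [:: 11; 18; 81]);
      ([:: 1; 1; 3; 5], 73138, [:: 19]);
      ([:: 1; 1; 3; 6], 324897, [::]);
      ([:: 1; 1; 3; 7], 801954, [:: 14; 18]);
      ([:: 1; 2; 2; 2], 16902, [:: 8; 43; 67; 135]);
      ([:: 1; 2; 2; 3], 1529, [:: 33]);
      ([:: 1; 2; 2; 4], 1054175, [::]);
      ([:: 1; 2; 2; 5], 32354, [:: 23; 33]);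
      ([:: 1; 2; 2; 6], 1302606, [::]);
      ([:: 1; 2; 3; 3], 262933, [:: 34; 99]);
      ([:: 1; 2; 3; 4], 18114, [::]);
      ([:: 1; 2; 3; 5], 1302606, [::]);
      ([:: 1; 2; 3; 6], 1426798, [:: 63]);
      ([:: 1; 2; 3; 7], 23841, [::]);
      ([:: 1; 2; 3; 8], 103969, [:: 31; 63]);
      ([:: 1; 2; 3; 9], 7205634, [:: 42]);
      ([:: 1; 2; 4; 4], 578265, [:: 17]);
      ([:: 1; 2; 4; 6], 1550980, [::]);
      ([:: 1; 2; 4; 7], 12687051, [::]);
      ([:: 1; 2; 4; 8], 1799322, [::]);
      ([:: 1; 2; 4; 12], 2295950, [:: 8; 138])].

(* Main.v *)
(** Write [a = (1, a_1, a_2, a_3)] and [A] for the sum of the [a_i].  If [sum a_i x_i = b] and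
    [3 sum a_i x_i^2 = 2 N + b], then [sum a_i P5(x_i) = N]; by the Cauchy-Schwarz inequality the
    [x_i] are nonnegative once [b] is at least about [sqrt (2 (A - 1) N / 3)].  Setting
    [k A x_i = k b + w_i], the vector [w] must lie in the ternary lattice orthogonal to [a] and have
    the norm [k^2 A F / 3], where [F = A (2 N + b) - 3 b^2].  Similitudes map every class of a genus
    of ternary forms of determinant [P] in [{1, 3, 5, 7, 11, 13}] into that lattice, so [w] comes from a
    representation of one number [n] by that genus, and the [x_i] are integers when the
    representation satisfies some congruences.  A finite computation finds, for all residues of [N],
    enough residues of [b] for which every solution of the local conditions is made integral by one
    of the similitudes.

    That a form of the genus represents [n] is proved as in Ankeny's treatment of three squares, but
    without primes in arithmetic progressions: one only needs a modulus [k^2 m] in a given class such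
    that [- n P] is a square modulo [m], and the hyperbola method applied to the sums of a real
    character over divisors yields it.  Reduction theory then leaves the classes of the genus.

    The finitely many remaining [N] are treated with bit sets of values of a ternary sum. *)

From Stdlib Require Import ZArith NArith Lia List Bool Znumtheory.
Set Implicit Arguments. Unset Strict Implicit. Unset Printing Implicit Defensive.

(** * Reduction of ternary forms *)

Section TernaryForms.
Import ListNotations.
Local Open Scope Z_scope.

(** A modulus [m] can stand in for a prime because all that matters of it is that [- N] is a square
    modulo [m] and in which class [k^2 m] lies. If [X] is the character of [- N] and the sum of
    [X d] over the divisors [d] of an integer is positive, then [X q = 1] for each of its primes [q]
    of odd exponent; the remaining prime powers go into [k^2]. To find such an integer in a class
    [a] with [X a = 1], suppose there is none and take the difference between the classes of [a] and
    [1], each divisor sum being weighted by [1 / sqrt m]. Since [X] does not separate the two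
    classes, the partial sums stay bounded; but in the class of [1] the squares [k^2] alone
    contribute at least [1 / k] each.

    On the computational side the difficulty is that one and the same similitude has to give
    integers at all primes at once, whereas the local conditions at different primes are
    independent. The local searches therefore return sets of successful similitudes, coded as bit
    masks, and any choice of one set per prime must have a common element. *)

Record tform := TF { f11 : Z; f22 : Z; f33 : Z; f12 : Z; f13 : Z; f23 : Z }.

Definition form_val (f : tform) (x y z : Z) : Z :=
  f11 f * x * x + f22 f * y * y + f33 f * z * z
  + 2 * (f12 f * x * y + f13 f * x * z + f23 f * y * z).

Definition tdet (f : tform) : Z :=
  f11 f * (f22 f * f33 f - f23 f * f23 f)
  - f12 f * (f12 f * f33 f - f23 f * f13 f)
  + f13 f * (f12 f * f23 f - f22 f * f13 f).

Definition tadj (f : tform) (x y z : Z) : Z :=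
  (f22 f * f33 f - f23 f * f23 f) * x * x + (f11 f * f33 f - f13 f * f13 f) * y * y
  + (f11 f * f22 f - f12 f * f12 f) * z * z
  + 2 * ((f13 f * f23 f - f12 f * f33 f) * x * y + (f12 f * f23 f - f13 f * f22 f) * x * z
         + (f12 f * f13 f - f11 f * f23 f) * y * z).

Definition represents (f : tform) (n : Z) : Prop := exists x y z, form_val f x y z = n.

(* The last clause says that [f] is anisotropic over the [P]-adic numbers:
   modulo [P] the adjoint is a multiple of a square of a linear form, and
   minus that multiple is a non-residue. *)
Definition in_genus (P : Z) (f : tform) : Prop :=
  0 < f11 f /\ 0 < f11 f * f22 f - f12 f * f12 f /\ tdet f = P
  /\ forall x y z s, (P | tadj f x y z + s * s) -> (P | s).

(** Bundled because a reduction step replaces the form, while the genus and the represented number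
    [n] must both survive. *)
Definition good (P n : Z) (f : tform) : Prop := in_genus P f /\ represents f n.

Definition shear_x (f : tform) (t u : Z) : tform :=
  TF (f11 f)
     (f22 f + 2 * t * f12 f + t * t * f11 f)
     (f33 f + 2 * u * f13 f + u * u * f11 f)
     (f12 f + t * f11 f) (f13 f + u * f11 f)
     (f23 f + t * f13 f + u * f12 f + t * u * f11 f).

Definition shear_y (f : tform) (t : Z) : tform :=
  TF (f11 f) (f22 f) (f33 f + 2 * t * f23 f + t * t * f22 f)
     (f12 f) (f13 f + t * f12 f) (f23 f + t * f22 f).

Definition swap_yz (f : tform) : tform :=
  TF (f11 f) (f33 f) (f22 f) (f13 f) (f12 f) (f23 f).

Definition swap_xy (f : tform) : tform :=
  TF (f22 f) (f11 f) (f33 f) (f12 f) (f23 f) (f13 f).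

Lemma good_shear_x P n f t u : good P n f -> good P n (shear_x f t u).
Proof.
intros [(h1 & h2 & h3 & h4) (x & y & z & h5)]; destruct f as [a b c d e g].
unfold good, in_genus, represents, tdet, tadj, form_val, shear_x in *; cbn [f11 f22 f33 f12 f13 f23] in *.
split; [split; [|split; [|split]]|].
- exact h1.
- match goal with |- 0 < ?v => replace v with (a * b - d * d) by ring end; exact h2.
- rewrite <- h3; ring.
(* The adjoint undergoes the contragredient substitution. *)
- intros x' y' z' s [q hq]; apply (h4 x' (y' - t * x') (z' - u * x') s); exists q; rewrite <- hq; ring.
- exists (x - t * y - u * z), y, z; rewrite <- h5; ring.
Qed.

Lemma good_shear_y P n f t : good P n f -> good P n (shear_y f t).
Proof.
intros [(h1 & h2 & h3 & h4) (x & y & z & h5)]; destruct f as [a b c d e g].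
unfold good, in_genus, represents, tdet, tadj, form_val, shear_y in *; cbn [f11 f22 f33 f12 f13 f23] in *.
split; [split; [|split; [|split]]|].
- exact h1.
- exact h2.
- rewrite <- h3; ring.
- intros x' y' z' s [q hq]; apply (h4 x' y' (z' - t * y') s); exists q; rewrite <- hq; ring.
- exists x, (y - t * z), z; rewrite <- h5; ring.
Qed.

Lemma good_swap_yz P n f : 0 < P -> good P n f -> good P n (swap_yz f).
Proof.
intros P0 [(h1 & h2 & h3 & h4) (x & y & z & h5)]; destruct f as [a b c d e g].
unfold good, in_genus, represents, tdet, tadj, form_val, swap_yz in *; cbn [f11 f22 f33 f12 f13 f23] in *.
split; [split; [|split; [|split]]|].
- exact h1.
(* Jacobi's identity for complementary minors; it transfers positivity to the other principal
   minor. *)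
- assert (H : (a * b - d * d) * (a * c - e * e) = a * P + (a * g - d * e) * (a * g - d * e))
    by (rewrite <- h3; ring).
  assert (0 < (a * b - d * d) * (a * c - e * e)).
  { rewrite H; assert (0 < a * P) by (apply Z.mul_pos_pos; assumption).
    assert (h6 := Z.square_nonneg (a * g - d * e)); lia. }
  apply (Z.mul_pos_cancel_l (a * b - d * d)); assumption.
- rewrite <- h3; ring.
- intros x' y' z' s [q hq]; apply (h4 x' z' y' s); exists q; rewrite <- hq; ring.
- exists x, z, y; rewrite <- h5; ring.
Qed.

Lemma good_swap_xy P n f : good P n f -> good P n (swap_xy f).
Proof.
intros [(h1 & h2 & h3 & h4) (x & y & z & h5)]; destruct f as [a b c d e g].
unfold good, in_genus, represents, tdet, tadj, form_val, swap_xy in *; cbn [f11 f22 f33 f12 f13 f23] in *.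
split; [split; [|split; [|split]]|].
- nia.
- replace (b * a - d * d) with (a * b - d * d) by ring; exact h2.
- rewrite <- h3; ring.
- intros x' y' z' s [q hq]; apply (h4 y' x' z' s); exists q; rewrite <- hq; ring.
- exists y, x, z; rewrite <- h5; ring.
Qed.

Lemma center (p q : Z) : 0 < p -> exists t, 2 * Z.abs (q + t * p) <= p.
Proof.
intros hp; exists (- ((2 * q + p) / (2 * p))).
assert (h := Z.div_mod (2 * q + p) (2 * p) ltac:(lia)).
assert (h' := Z.mod_pos_bound (2 * q + p) (2 * p) ltac:(lia)).
set (k := (2 * q + p) / (2 * p)) in *; set (r := (2 * q + p) mod (2 * p)) in *.
replace (q + - k * p) with (q - k * p) by ring.
assert (2 * (q - k * p) = r - p) by nia. lia.
Qed.

(** Completing the square, [f11 * f] is [(f11 x + f12 y + f13 z)^2] plus the binary form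
    [p11 y^2 + 2 p12 y z + p22 z^2], of determinant [f11 * tdet f]. *)
Definition p11 (f : tform) := f11 f * f22 f - f12 f * f12 f.
Definition p12 (f : tform) := f11 f * f23 f - f12 f * f13 f.
Definition p22 (f : tform) := f11 f * f33 f - f13 f * f13 f.

(** Gauss reduction of the binary form with [f11] fixed; each swap lowers the positive integer
    [p11]. *)
Lemma reduce_yz P n f : 0 < P -> good P n f ->
  exists f', good P n f' /\ f11 f' = f11 f /\ 2 * Z.abs (p12 f') <= p11 f' /\ p11 f' <= p22 f'.
Proof.
intros P0; remember (Z.to_nat (p11 f)) as k eqn:ek; revert f ek.
induction k as [k IH] using lt_wf_ind; intros f ek hf.
assert (h11 : 0 < p11 f) by (destruct hf as [(_ & h & _) _]; exact h).
destruct (center (p12 f) h11) as [t ht].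
assert (hs := good_shear_y t hf).
assert (e11 : p11 (shear_y f t) = p11 f) by reflexivity.
assert (e12 : p12 (shear_y f t) = p12 f + t * p11 f).
{ unfold p12, p11, shear_y; cbn [f11 f22 f33 f12 f13 f23]; ring. }
destruct (Z_le_gt_dec (p11 f) (p22 (shear_y f t))) as [hle|hgt].
{ exists (shear_y f t); rewrite e11, e12; auto. }
assert (hw := good_swap_yz P0 hs).
assert (ew : p11 (swap_yz (shear_y f t)) = p22 (shear_y f t)) by reflexivity.
assert (hw0 : 0 < p11 (swap_yz (shear_y f t))) by (destruct hw as [(_ & h & _) _]; exact h).
destruct (IH (Z.to_nat (p11 (swap_yz (shear_y f t)))) ltac:(lia) _ eq_refl hw)
  as (f' & h1 & h2 & h3 & h4).
exists f'; auto.
Qed.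

Definition hermite_reduced (f : tform) : Prop :=
  f11 f <= f22 f /\ 2 * Z.abs (f12 f) <= f11 f /\ 2 * Z.abs (f13 f) <= f11 f
  /\ 2 * Z.abs (p12 f) <= p11 f /\ p11 f <= p22 f.

(** Hermite reduction: [shear_x] does not affect the binary form, so once that is reduced either
    everything is, or exchanging [x] and [y] lowers [f11]. *)
Lemma reduce P n f : 0 < P -> good P n f -> exists f', good P n f' /\ hermite_reduced f'.
Proof.
intros P0; remember (Z.to_nat (f11 f)) as k eqn:ek; revert f ek.
induction k as [k IH] using lt_wf_ind; intros f ek hf.
destruct (reduce_yz P0 hf) as (h & hh & eh & r1 & r2).
assert (a0 : 0 < f11 h) by (destruct hh as [(q & _) _]; exact q).
destruct (center (f12 h) a0) as [t ht]; destruct (center (f13 h) a0) as [u hu].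
assert (hs := good_shear_x t u hh); set (h' := shear_x h t u) in *.
assert (e11 : p11 h' = p11 h) by (unfold p11, h', shear_x; cbn [f11 f22 f33 f12 f13 f23]; ring).
assert (e12 : p12 h' = p12 h) by (unfold p12, h', shear_x; cbn [f11 f22 f33 f12 f13 f23]; ring).
assert (e22 : p22 h' = p22 h) by (unfold p22, h', shear_x; cbn [f11 f22 f33 f12 f13 f23]; ring).
destruct (Z_le_gt_dec (f11 h') (f22 h')) as [hle|hgt].
{ exists h'; split; [exact hs|]; unfold hermite_reduced; rewrite e11, e12, e22.
  cbn [f11 f22 f33 f12 f13 f23] in *; repeat split; auto. }
assert (hw := good_swap_xy hs).
assert (b0 : 0 < f11 (swap_xy h')) by (destruct hw as [(q & _) _]; exact q).
assert (hlt : f11 (swap_xy h') < f11 f) by (rewrite <- eh; change (f22 h' < f11 h); change (f11 h' > f22 h') with (f11 h > f22 h') in hgt; lia).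
apply (IH (Z.to_nat (f11 (swap_xy h'))) ltac:(lia) _ eq_refl hw).
Qed.

(** With [u = p11], reduction of the binary form gives [3 u^2 <= 4 a P], and [a <= b], [2 |d| <= a]
    give [3 a^2 <= 4 u]. Together [27 a^3 <= 64 P], so [P <= 13] leaves [a <= 3]. *)
Lemma reduced_bounds P n f : 0 < P <= 13 -> good P n f -> hermite_reduced f ->
  1 <= f11 f <= 2 /\ 1 <= f22 f <= 4 /\ 1 <= f33 f <= 14 /\ -1 <= f12 f <= 1
  /\ -1 <= f13 f <= 1 /\ -3 <= f23 f <= 3.
Proof.
intros hP [(h1 & h2 & h3 & _) _] (r1 & r2 & r3 & r4 & r5); destruct f as [a b c d e g].
unfold p11, p12, p22, tdet in *; cbn [f11 f22 f33 f12 f13 f23] in *.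
assert (H : (a * b - d * d) * (a * c - e * e) = a * P + (a * g - d * e) * (a * g - d * e))
    by (rewrite <- h3; ring).
set (u := a * b - d * d) in *; set (v := a * g - d * e) in *; set (w := a * c - e * e) in *.
assert (Hv : 4 * (v * v) <= u * u).
{ replace (4 * (v * v)) with ((2 * Z.abs v) * (2 * Z.abs v)) by (destruct (Z.abs_spec v) as [[_ ->]|[_ ->]]; ring).
  apply Z.mul_le_mono_nonneg; lia. }
assert (Hu : u * u <= u * w) by (apply Z.mul_le_mono_nonneg_l; lia).
assert (dd : 4 * (d * d) <= a * a).
{ replace (4 * (d * d)) with ((2 * Z.abs d) * (2 * Z.abs d)) by (destruct (Z.abs_spec d) as [[_ ->]|[_ ->]]; ring).
  apply Z.mul_le_mono_nonneg; lia. }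
assert (ab : a * a <= a * b) by (apply Z.mul_le_mono_nonneg_l; lia).
assert (ub : 3 * (a * a) <= 4 * u) by (unfold u; lia).
assert (u3 : 3 * (u * u) <= 4 * (a * P)) by lia.
assert (a2 : a <= 2).
{ destruct (Z_le_gt_dec a 2) as [h|h]; [exact h|exfalso].
  assert (h9 : (3 * (a * a)) * (3 * (a * a)) <= (4 * u) * (4 * u)) by (apply Z.mul_le_mono_nonneg; lia).
  assert (h27 : a * (27 * (a * a * a)) <= a * (64 * P)) by lia.
  apply Z.mul_le_mono_pos_l in h27; [|lia].
  assert (a3 : a = 3).
  { destruct (Z_le_gt_dec a 3) as [h3'|h3']; [lia|].
    assert (4 * 4 <= a * a) by (apply Z.mul_le_mono_nonneg; lia).
    assert (16 * 4 <= a * a * a) by (apply Z.mul_le_mono_nonneg; lia). lia. }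
  (* The case [a = 3] is excluded by hand: [3 u^2 <= 156] gives [u <= 7], but [b >= 3] and
     [|d| <= 1] give [u >= 8]. *)
  subst a.
  assert (u <= 7).
  { destruct (Z_le_gt_dec u 7) as [h7|h7]; [lia|].
    assert (8 * 8 <= u * u) by (apply Z.mul_le_mono_nonneg; lia). lia. }
  assert (d = -1 \/ d = 0 \/ d = 1) as [-> | [-> | ->]] by lia; unfold u in *; lia. }
assert (aP : a * P <= 2 * 13) by (apply Z.mul_le_mono_nonneg; lia).
assert (uP : u <= 5).
{ destruct (Z_le_gt_dec u 5) as [h|h]; [lia|].
  assert (6 * 6 <= u * u) by (apply Z.mul_le_mono_nonneg; lia). lia. }
assert (hv : -2 <= v <= 2) by lia.
assert (v * v <= 4) by nia.
assert (aa : a = 1 \/ a = 2) by lia; destruct aa; subst a.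
- assert (d = 0) by lia; assert (e = 0) by lia; subst d e.
  assert (u = b) by (unfold u; ring). assert (w = c) by (unfold w; ring).
  assert (v = g) by (unfold v; ring).
  assert (b <= 4) by (destruct (Z_le_gt_dec b 4) as [h|h]; [lia|];
    assert (5 * 5 <= u * u) by (apply Z.mul_le_mono_nonneg; lia); lia).
  assert (b = 1 \/ b = 2 \/ b = 3 \/ b = 4) as [hb | [hb | [hb | hb]]] by lia;
    rewrite ?hb in *; lia.
- assert (3 <= u) by lia.
  assert (hu : u = 3 \/ u = 4 \/ u = 5) by lia.
  assert (w <= 12) by (destruct hu as [hu | [hu | hu]]; rewrite hu in *; lia).
  assert (d = -1 \/ d = 0 \/ d = 1) as [-> | [-> | ->]] by lia;
    assert (e = -1 \/ e = 0 \/ e = 1) as [-> | [-> | ->]] by lia;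
    unfold u, v, w in *; lia.
Qed.

(** Reduced representatives up to changes of sign of the variables; [enumeration] checks that these
    lists are complete. *)
Definition classes (P : Z) : list tform :=
  match P with
  | 1 => [TF 1 1 1 0 0 0]
  | 3 => [TF 1 1 3 0 0 0]
  | 5 => [TF 1 2 3 0 0 1]
  | 7 => [TF 1 1 7 0 0 0; TF 1 2 4 0 0 1]
  | 11 => [TF 1 1 11 0 0 0; TF 1 3 4 0 0 1]
  | 13 => [TF 1 2 7 0 0 1; TF 2 3 3 1 0 1]
  | _ => []
  end.

Definition ramified : list Z := [1; 3; 5; 7; 11; 13].

Definition zrange (lo : Z) (n : nat) : list Z := map (fun i => lo + Z.of_nat i) (seq 0 n).

Lemma in_zrange lo n x : lo <= x < lo + Z.of_nat n -> In x (zrange lo n).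
Proof.
intros h; apply in_map_iff; exists (Z.to_nat (x - lo)); split; [lia|].
apply in_seq; lia.
Qed.

(** A positive [s < P] found here contradicts the last clause of [in_genus]. On the reduced forms
    the three coordinate vectors turn out to be enough tests. *)
Definition isotropy_witness (P : Z) (f : tform) : bool :=
  existsb (fun s => existsb (fun v => (v + s * s) mod P =? 0)
             [tadj f 1 0 0; tadj f 0 1 0; tadj f 0 0 1])
          (zrange 1 (Z.to_nat (P - 1))).

Definition flip (f : tform) (s t u : Z) : tform :=
  TF (f11 f) (f22 f) (f33 f) (s * t * f12 f) (s * u * f13 f) (t * u * f23 f).

Definition tform_eqb (f g : tform) : bool :=
  (f11 f =? f11 g) && (f22 f =? f22 g) && (f33 f =? f33 g)
  && (f12 f =? f12 g) && (f13 f =? f13 g) && (f23 f =? f23 g).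

Lemma tform_eqb_eq f g : tform_eqb f g = true -> f = g.
Proof.
destruct f, g; unfold tform_eqb; cbn; rewrite !andb_true_iff, !Z.eqb_eq.
intros [[[[[-> ->] ->] ->] ->] ->]; reflexivity.
Qed.

(** Changing all three signs leaves a form unchanged, so the middle sign can be fixed to [1]. *)
Definition known_class (P : Z) (f : tform) : bool :=
  existsb (fun f0 => existsb (fun s => existsb (fun u => tform_eqb (flip f0 s 1 u) f) [1; -1]) [1; -1])
          (classes P).

Definition reducedb (P : Z) (f : tform) : bool :=
  (tdet f =? P) && (f11 f <=? f22 f) && (2 * Z.abs (f12 f) <=? f11 f)
  && (2 * Z.abs (f13 f) <=? f11 f) && (2 * Z.abs (p12 f) <=? p11 f) && (p11 f <=? p22 f).

Definition enumeration_ok (P : Z) : bool :=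
  forallb (fun a => forallb (fun b => forallb (fun c => forallb (fun d => forallb (fun e =>
    forallb (fun g => let f := TF a b c d e g in
      if reducedb P f then isotropy_witness P f || known_class P f else true)
  (zrange (-3) 7)) (zrange (-1) 3)) (zrange (-1) 3)) (zrange 1 14)) (zrange 1 4)) (zrange 1 2).

Lemma enumeration : forallb enumeration_ok ramified = true.
Proof. vm_compute. reflexivity. Qed.

Lemma isotropy_witness_sound P f : 0 < P -> in_genus P f -> isotropy_witness P f = false.
Proof.
intros P0 (_ & _ & _ & h); apply not_true_is_false; intros hw.
apply existsb_exists in hw as (s & hs & hw); apply existsb_exists in hw as (v & hv & hw).
apply in_map_iff in hs as (i & <- & hi); apply in_seq in hi.
apply Z.eqb_eq, Z.mod_divide in hw; [|lia].
assert (hd : (P | 1 + Z.of_nat i)).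
{ destruct hv as [<-|[<-|[<-|[]]]]; eapply h; exact hw. }
apply Z.divide_pos_le in hd; lia.
Qed.

Lemma represents_flip f s t u n : s * s = 1 -> t * t = 1 -> u * u = 1 ->
  represents (flip f s t u) n -> represents f n.
Proof.
intros hs ht hu (x & y & z & <-); exists (s * x), (t * y), (u * z).
unfold form_val, flip; cbn [f11 f22 f33 f12 f13 f23].
replace (f11 f * x * x) with (f11 f * (s * s) * x * x) by (rewrite hs; ring).
replace (f22 f * y * y) with (f22 f * (t * t) * y * y) by (rewrite ht; ring).
replace (f33 f * z * z) with (f33 f * (u * u) * z * z) by (rewrite hu; ring).
ring.
Qed.

Theorem genus_classes P n f : In P ramified -> good P n f ->
  exists f0, In f0 (classes P) /\ represents f0 n.
Proof.
intros hP hf.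
assert (P13 : 0 < P <= 13) by (repeat destruct hP as [<-|hP]; try lia; destruct hP).
destruct (reduce (proj1 P13) hf) as (h & hh & hr).
destruct (reduced_bounds P13 hh hr) as (ba & bb & bc & bd & be & bg).
assert (E := enumeration); rewrite forallb_forall in E; specialize (E P hP).
unfold enumeration_ok in E.
rewrite forallb_forall in E; specialize (E (f11 h) (@in_zrange 1 2 (f11 h) ltac:(lia))).
rewrite forallb_forall in E; specialize (E (f22 h) (@in_zrange 1 4 (f22 h) ltac:(lia))).
rewrite forallb_forall in E; specialize (E (f33 h) (@in_zrange 1 14 (f33 h) ltac:(lia))).
rewrite forallb_forall in E; specialize (E (f12 h) (@in_zrange (-1) 3 (f12 h) ltac:(lia))).
rewrite forallb_forall in E; specialize (E (f13 h) (@in_zrange (-1) 3 (f13 h) ltac:(lia))).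
rewrite forallb_forall in E; specialize (E (f23 h) (@in_zrange (-3) 7 (f23 h) ltac:(lia))).
cbv zeta in E; replace (TF _ _ _ _ _ _) with h in E by (destruct h; reflexivity).
destruct hh as [hg hrep].
replace (reducedb P h) with true in E; cycle 1.
{ symmetry; destruct hg as (_ & _ & hd & _); destruct hr as (r1 & r2 & r3 & r4 & r5).
  unfold reducedb; rewrite !andb_true_iff, !Z.leb_le, Z.eqb_eq; repeat split; assumption. }
rewrite (isotropy_witness_sound (proj1 P13) hg) in E; cbn [orb] in E.
apply existsb_exists in E as (f0 & h0 & E); apply existsb_exists in E as (s & hs & E).
apply existsb_exists in E as (u & hu & E); apply tform_eqb_eq in E.
exists f0; split; [exact h0|].
apply (@represents_flip f0 s 1 u); [| |  | rewrite E; exact hrep].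
- destruct hs as [<-|[<-|[]]]; reflexivity.
- reflexivity.
- destruct hu as [<-|[<-|[]]]; reflexivity.
Qed.

(** For a prime [P]: [- n] is a non-residue modulo [P]. *)
Definition anisotropic_mod (P n : Z) : Prop :=
  forall x s, (P | x * x + n * s * s) -> (P | s).

Definition anisotropic_modb (P n : Z) : bool :=
  forallb (fun x => forallb (fun s =>
    if (x * x + n * s * s) mod P =? 0 then s =? 0 else true)
    (zrange 0 (Z.to_nat P))) (zrange 0 (Z.to_nat P)).

Definition odd_ramified : list Z := [3; 5; 7; 11; 13].

End TernaryForms.

(** * Representations from congruence certificates *)

Section Certificates.
Import ListNotations.
Local Open Scope Z_scope.

Record coeffs := Coeffs { co1 : Z; co2 : Z; co3 : Z }.

Definition total (a : coeffs) : Z := 1 + co1 a + co2 a + co3 a.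

Record emb := Emb { e11 : Z; e12 : Z; e13 : Z; e21 : Z; e22 : Z; e23 : Z; e31 : Z; e32 : Z; e33 : Z }.

Definition lin1 t x y z := e11 t * x + e12 t * y + e13 t * z.
Definition lin2 t x y z := e21 t * x + e22 t * y + e23 t * z.
Definition lin3 t x y z := e31 t * x + e32 t * y + e33 t * z.
(** Forced by the orthogonality of [w] to [(1, co1 a, co2 a, co3 a)]. *)
Definition lin0 a t x y z := - (co1 a * lin1 t x y z + co2 a * lin2 t x y z + co3 a * lin3 t x y z).

Definition similitude (a : coeffs) (M : Z) (f : tform) (t : emb) : bool :=
  let gram x1 x2 x3 y1 y2 y3 :=
    (co1 a * x1 + co2 a * x2 + co3 a * x3) * (co1 a * y1 + co2 a * y2 + co3 a * y3)
    + co1 a * x1 * y1 + co2 a * x2 * y2 + co3 a * x3 * y3 in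
  (gram (e11 t) (e21 t) (e31 t) (e11 t) (e21 t) (e31 t) =? M * f11 f)
  && (gram (e12 t) (e22 t) (e32 t) (e12 t) (e22 t) (e32 t) =? M * f22 f)
  && (gram (e13 t) (e23 t) (e33 t) (e13 t) (e23 t) (e33 t) =? M * f33 f)
  && (gram (e11 t) (e21 t) (e31 t) (e12 t) (e22 t) (e32 t) =? M * f12 f)
  && (gram (e11 t) (e21 t) (e31 t) (e13 t) (e23 t) (e33 t) =? M * f13 f)
  && (gram (e12 t) (e22 t) (e32 t) (e13 t) (e23 t) (e33 t) =? M * f23 f).

Lemma similitude_norm a M f t x y z : similitude a M f t = true ->
  lin0 a t x y z * lin0 a t x y z + co1 a * (lin1 t x y z * lin1 t x y z)
  + co2 a * (lin2 t x y z * lin2 t x y z) + co3 a * (lin3 t x y z * lin3 t x y z)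
  = M * form_val f x y z.
Proof.
unfold similitude; rewrite !andb_true_iff, !Z.eqb_eq; intros [[[[[h1 h2] h3] h4] h5] h6].
unfold form_val, lin0, lin1, lin2, lin3.
transitivity ((M * f11 f) * x * x + (M * f22 f) * y * y + (M * f33 f) * z * z
  + 2 * ((M * f12 f) * x * y + (M * f13 f) * x * z + (M * f23 f) * y * z)); [|ring].
rewrite <- h1, <- h2, <- h3, <- h4, <- h5, <- h6; ring.
Qed.

(* Constraint at one prime [pq]: the vector [y] is enumerated modulo
   [pq ^ pdepth], the coordinates are wanted modulo [pm], and the admissible
   pairs [(n mod pnm, b mod pwin)] are [padm].  Every admissible pair [(n, b)],
   now with [b] modulo [pbeta], is carried by a scaling
   [(n, b, y) -> (l^2 n, l b, l y)] to one of [preps].  The number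
   [prel] divides [M n + A k^2 b^2]. *)
Record part := Part { pq : Z; pdepth : nat; pm : Z; pnm : Z; pwin : Z; pbeta : Z; prel : Z;
  padm : list (Z * Z); preps : list (Z * Z) }.

Definition emb_of (s : Z) (t : Z * Z * Z * Z * Z * Z * Z * Z * Z) : emb :=
  let '(a1, a2, a3, b1, b2, b3, d1, d2, d3) := t in
  Emb (s * a1) (s * a2) (s * a3) (s * b1) (s * b2) (s * b3) (s * d1) (s * d2) (s * d3).

Definition unsigned := map (emb_of 1).
(** The opposite similitude yields [- w], of the same norm but with other residues. *)
Definition signed l := map (emb_of 1) l ++ map (emb_of (-1)) l.

Definition pmem (x : Z * Z) (l : list (Z * Z)) : bool :=
  existsb (fun r => (fst x =? fst r) && (snd x =? snd r)) l.

(** Generates the admissible pairs as orbits under unit scalings. Soundness does not rest on this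
    construction, since [orbits_ok] tests the resulting list. *)
Definition orbit_part (q : Z) (d : nat) (m nm win beta rel : Z) (reps : list (Z * Z)) : part :=
  let units := filter (fun l => Z.gcd l q =? 1) (zrange 1 (Z.to_nat (Z.max m nm))) in
  Part q d m nm win beta rel
    (fold_right (fun x s => if pmem x s then s else x :: s) []
       (flat_map (fun r => map (fun l => ((l * l * fst r) mod nm, (l * snd r) mod win)) units) reps)) reps.

(** The origin of the representation of [n]: three squares, [n] prime to [P = ram], or [n] divisible
    by [P] with [n / P] in one of the residues [l] modulo [P]. *)
Inductive source := Squares | Coprime | Ramified (l : list Z).

(* A plan writes [kk A x_i = kk b + w_i], where [w] is the image of [y] by a
   similitude of multiplier [mul] from a class of the genus [ram]; then [n = f y]
   is [num F / den] with [F = A (2 N + b) - 3 b^2].  It serves the [N] with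
   [N mod cls] in [clsr].  Whether it applies to [(N, b)] depends on [n mod lev],
   hence on [F mod per], hence on [N mod perN] and [b mod perB]. *)
Record plan := Plan { kk : Z; mul : Z; ram : Z; src : source; boxes : list (list part);
  embs : list (list emb); num : Z; den : Z; per : Z; lev : Z; perN : Z; perB : Z;
  cls : Z; clsr : list Z }.

(* Any [gap] consecutive integers contain a [b] to which one of the plans applies;
   for [N >= start] some such window, beyond [base], has [F > 0] and forces
   nonnegative solutions. *)
Record cert := Cert { co : coeffs; gap : Z; base : Z; start : Z; cmod : Z; creq : list Z;
  plans : list plan }.

Definition zmem (x : Z) (l : list Z) : bool := existsb (Z.eqb x) l.

Lemma zmemP x l : zmem x l = true <-> In x l.
Proof.
unfold zmem; rewrite existsb_exists; split.
- intros (y & h & e); apply Z.eqb_eq in e; congruence.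
- intros h; exists x; split; [exact h|apply Z.eqb_refl].
Qed.

Lemma pmemP x l : pmem x l = true -> In x l.
Proof.
unfold pmem; rewrite existsb_exists; intros ([y1 y2] & h & e).
rewrite andb_true_iff, !Z.eqb_eq in e; destruct x as [x1 x2]; simpl in e; destruct e; subst; exact h.
Qed.

Definition orbits_ok (p : part) : bool :=
  forallb (fun r => forallb (fun c => if c mod pwin p =? snd r then existsb (fun l =>
    (Z.gcd l (pm p) =? 1)
    && pmem ((l * l * fst r) mod pnm p, (l * c) mod pbeta p) (preps p))
    (zrange 1 (Z.to_nat (pm p))) else true) (zrange 0 (Z.to_nat (pbeta p)))) (padm p).

Definition emb_mod (m : Z) (t : emb) : emb :=
  Emb (e11 t mod m) (e12 t mod m) (e13 t mod m) (e21 t mod m) (e22 t mod m) (e23 t mod m)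
      (e31 t mod m) (e32 t mod m) (e33 t mod m).

(** Integrality asks that all four [w_i] be [- k b] modulo [m]. That they agree with each other is a
    consequence free of [b], hence usable for pruning before [b] is fixed; the last test is on
    [w1 - w0]. Nested conditionals stop at the first failure under eager evaluation. *)
Definition congruent (a : coeffs) (m x y z : Z) (t : emb) : bool :=
  let w1 := lin1 t x y z in
  let w2 := lin2 t x y z in
  if (w1 - w2) mod m =? 0 then
  let w3 := lin3 t x y z in
  if (w1 - w3) mod m =? 0 then (w1 + (co1 a * w1 + co2 a * w2 + co3 a * w3)) mod m =? 0 else false
  else false.

(** At a leaf the [w_i] already agree, so [lin1] decides for all of them. *)
Definition mask (m kb x y z : Z) (ts : list (N * emb)) : N :=
  fold_right (fun bt acc => if (kb + lin1 (snd bt) x y z) mod m =? 0 then N.lor (fst bt) acc else acc) 0%N ts.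

(** The content of half the gradient: moving by [w] changes the form by a multiple of
    [gcd (w^2, 2 w slopes)]. *)
Definition slopes (f : tform) (x y z : Z) : Z :=
  Z.gcd (f11 f * x + f12 f * y + f13 f * z)
    (Z.gcd (f12 f * x + f22 f * y + f23 f * z) (f13 f * x + f23 f * y + f33 f * z)).

Definition digits (q : Z) : list (Z * Z * Z) :=
  let r := zrange 0 (Z.to_nat q) in list_prod (list_prod r r) r.

Section Leaves.
Variables (a : coeffs) (k M : Z) (f : tform) (p : part).

(** At this stage [n] is known to be [v] modulo [g] only, so each condition on [n] is tested modulo
    its gcd with that information. *)
Definition fits (g v : Z) (r : Z * Z) : bool :=
  if (v - fst r) mod Z.gcd (pnm p) g =? 0 then
  (if prel p =? 1 then true else
  (M * v + total a * (k * k) * (snd r * snd r)) mod Z.gcd (prel p) (M * g) =? 0) else false.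

Definition fits_any (gn gr v : Z) : bool :=
  existsb (fun r => if (v - fst r) mod gn =? 0 then
    (if gr =? 1 then true else (M * v + total a * (k * k) * (snd r * snd r)) mod gr =? 0) else false)
  (preps p).

(** A tree search through the base [pq] digits of [y], where [w] is the modulus reached. Branches
    die when no representative fits [n], and similitudes are discarded along the way; a leaf yields
    one mask for each representative compatible with it. *)
Fixpoint leaves (d : nat) (w x y z : Z) (ts : list (N * emb)) : list N :=
  match d with
  | O => let v := form_val f x y z in
         let g := Z.gcd (w * w) (2 * w * slopes f x y z) in
         flat_map (fun r => if fits g v r then [mask (pm p) (k * snd r) x y z ts] else []) (preps p)
  | S d' =>
      let w' := w * pq p in
      let m' := Z.gcd w' (pm p) in
      let g := Z.gcd (w' * w') (2 * w') in
      let gn := Z.gcd (pnm p) g in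
      let gr := Z.gcd (prel p) (M * g) in
      flat_map (fun t : Z * Z * Z =>
        let '(t1, t2, t3) := t in
        let x' := x + w * t1 in let y' := y + w * t2 in let z' := z + w * t3 in
        if fits_any gn gr (form_val f x' y' z') then
          leaves d' w' x' y' z' (filter (fun bt => congruent a m' x' y' z' (snd bt)) ts)
        else []) (digits (pq p))
  end.

End Leaves.

Definition insert_mask (x : N) (l : list N) : list N := if existsb (N.eqb x) l then l else x :: l.

Definition indexed (ts : list emb) : list (N * emb) :=
  combine (map (fun i => (2 ^ N.of_nat i)%N) (seq 0 (length ts))) ts.

Definition part_masks (a : coeffs) (k M : Z) (f : tform) (ts : list emb) (p : part) : list N :=
  fold_right insert_mask []
    (leaves a k M f p (pdepth p) 1 0 0 0 (map (fun bt => (fst bt, emb_mod (pm p) (snd bt))) (indexed ts))).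

(** Leaves at different primes can occur in any combination, so every choice of one mask per prime
    must leave a common bit. *)
Fixpoint joint (acc : N) (l : list (list N)) : bool :=
  match l with
  | [] => negb (acc =? 0)%N
  | ms :: l' => forallb (fun x => joint (N.land acc x) l') ms
  end.

Fixpoint coprime_product (l : list Z) : bool :=
  match l with
  | [] => true
  | m :: l' => (Z.gcd m (fold_right Z.mul 1 l') =? 1) && coprime_product l'
  end.

(** The divisibilities say that [k b] modulo [pm] and the relation modulo [prel] depend on [b] only
    modulo [pbeta]. The bound on [prel] comes from [M n + A k^2 b^2 = k^2 A^2 m], where [m] is the
    sum of the [a_i x_i^2]. *)
Definition part_ok (a : coeffs) (o : plan) (p : part) : bool :=
  (0 <? pm p) && (0 <? pq p) && (0 <? pnm p) && (0 <? pbeta p) && (0 <? prel p)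
  && (kk o * pbeta p mod pm p =? 0) && (pq p ^ Z.of_nat (pdepth p) mod pm p =? 0)
  && ((kk o * kk o * total a * total a) mod prel p =? 0)
  && ((kk o * kk o * total a * pbeta p) mod prel p =? 0)
  && (lev o mod pnm p =? 0) && (perB o mod pwin p =? 0) && (pbeta p mod pwin p =? 0)
  && orbits_ok p.

Definition box_ok (a : coeffs) (o : plan) (box : list part) : bool :=
  forallb (part_ok a o) box
  && (fold_right Z.mul 1 (map pm box) =? kk o * total a)
  && coprime_product (map pm box)
  && forallb (fun ft : tform * list emb =>
       let masks := map (part_masks a (kk o) (mul o) (fst ft) (snd ft)) box in
       joint (N.ones (N.of_nat (length (snd ft)))) masks)
     (combine (classes (ram o)) (embs o)).

Lemma eqb_mod_divide m x : (x mod m =? 0) = true <-> (m | x).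
Proof.
rewrite Z.eqb_eq; destruct (Z.eq_dec m 0) as [->|h].
- rewrite Zmod_0_r; split; [intros ->; exists 0; ring|intros [c hc]; lia].
- apply Z.mod_divide; exact h.
Qed.

Lemma form_val_shift f w x y z s t u : (Z.gcd (w * w) (2 * w * slopes f x y z) |
  form_val f (x + w * s) (y + w * t) (z + w * u) - form_val f x y z).
Proof.
set (g := Z.gcd _ _).
replace (form_val f (x + w * s) (y + w * t) (z + w * u) - form_val f x y z) with
  (w * w * form_val f s t u + 2 * w * ((f11 f * x + f12 f * y + f13 f * z) * s
   + ((f12 f * x + f22 f * y + f23 f * z) * t + (f13 f * x + f23 f * y + f33 f * z) * u)))
  by (unfold form_val; ring).
apply Z.divide_add_r; [apply Z.divide_mul_l, Z.gcd_divide_l|].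
eapply Z.divide_trans; [apply Z.gcd_divide_r|].
apply Z.mul_divide_mono_l; unfold slopes.
set (l1 := _ * x + _ * y + _ * z); set (l2 := _ * x + _ * y + _ * z); set (l3 := _ * x + _ * y + _ * z).
assert (h := Z.gcd_divide_l l1 (Z.gcd l2 l3)); assert (h' := Z.gcd_divide_r l1 (Z.gcd l2 l3)).
assert (h2 := Z.gcd_divide_l l2 l3); assert (h3 := Z.gcd_divide_r l2 l3).
repeat apply Z.divide_add_r; apply Z.divide_mul_l; eauto using Z.divide_trans.
Qed.

Lemma form_val_shift_coarse f w x y z s t u : (Z.gcd (w * w) (2 * w) |
  form_val f (x + w * s) (y + w * t) (z + w * u) - form_val f x y z).
Proof.
eapply Z.divide_trans; [|apply form_val_shift].
apply Z.gcd_greatest; [apply Z.gcd_divide_l|apply Z.divide_mul_l, Z.gcd_divide_r].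
Qed.

Lemma in_digits q s t u : 0 <= s < q -> 0 <= t < q -> 0 <= u < q -> In (s, t, u) (digits q).
Proof.
intros hs ht hu; unfold digits.
rewrite !in_prod_iff; repeat split; apply in_zrange; lia.
Qed.

Lemma dvd_sub_cancel m x y : (m | x - y) -> (m | x) -> (m | y).
Proof. intros h1 h2; replace y with (x - (x - y)) by ring; apply Z.divide_sub_r; assumption. Qed.

(** * Soundness of the local search *)

Section Leaves.
Variables (a : coeffs) (k M : Z) (f : tform) (p : part) (b n X Y Z0 : Z) (r : Z * Z).
Hypothesis in_reps : In r (preps p).
Hypothesis val_n : form_val f X Y Z0 = n.
Hypothesis n_class : (pnm p | n - fst r).
Hypothesis b_class : (pbeta p | b - snd r).
Hypothesis pq_pos : 0 < pq p.
Hypothesis rel_n : (prel p | M * n + total a * (k * k) * (b * b)).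
Hypothesis rel_beta : (prel p | k * k * total a * pbeta p).
Hypothesis m_beta : (pm p | k * pbeta p).

Lemma relation_rep : (prel p | M * n + total a * (k * k) * (snd r * snd r)).
Proof.
destruct b_class as [c hc].
replace (M * n + total a * (k * k) * (snd r * snd r)) with
  (M * n + total a * (k * k) * (b * b) - k * k * total a * pbeta p * (c * (b + snd r))).
- apply Z.divide_sub_r; [exact rel_n|apply Z.divide_mul_l; exact rel_beta].
- replace (k * k * total a * pbeta p * (c * (b + snd r)))
    with (k * k * total a * (c * pbeta p) * (b + snd r)) by ring.
  rewrite <- hc; ring.
Qed.

Lemma relation_val g v : (g | n - v) ->
  (Z.gcd (prel p) (M * g) | M * v + total a * (k * k) * (snd r * snd r)).
Proof.
intros h.
apply (@dvd_sub_cancel _ (M * n + total a * (k * k) * (snd r * snd r))).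
- replace (M * n + total a * (k * k) * (snd r * snd r) - (M * v + total a * (k * k) * (snd r * snd r)))
    with (M * (n - v)) by ring.
  eapply Z.divide_trans; [apply Z.gcd_divide_r|apply Z.mul_divide_mono_l; exact h].
- eapply Z.divide_trans; [apply Z.gcd_divide_l|apply relation_rep].
Qed.

Lemma class_val g v : (g | n - v) -> (Z.gcd (pnm p) g | v - fst r).
Proof.
intros h; replace (v - fst r) with ((n - fst r) - (n - v)) by ring.
apply Z.divide_sub_r; [eapply Z.divide_trans; [apply Z.gcd_divide_l|exact n_class]|].
eapply Z.divide_trans; [apply Z.gcd_divide_r|exact h].
Qed.

Lemma fits_true g v : (g | n - v) -> fits a k M p g v r = true.
Proof.
intros h; unfold fits.
rewrite (proj2 (eqb_mod_divide _ _) (class_val h)).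
destruct (prel p =? 1); [reflexivity|].
apply eqb_mod_divide, relation_val, h.
Qed.

Lemma fits_any_true g v : (g | n - v) ->
  fits_any a k M p (Z.gcd (pnm p) g) (Z.gcd (prel p) (M * g)) v = true.
Proof.
intros h; unfold fits_any; rewrite existsb_exists; exists r; split; [exact in_reps|].
rewrite (proj2 (eqb_mod_divide _ _) (class_val h)).
destruct (Z.gcd (prel p) (M * g) =? 1); [reflexivity|].
apply eqb_mod_divide, relation_val, h.
Qed.

Definition integral (m x y z : Z) (t : emb) : Prop :=
  (m | k * b + lin1 t x y z) /\ (m | k * b + lin2 t x y z) /\ (m | k * b + lin3 t x y z)
  /\ (m | k * b + lin0 a t x y z).

Lemma integral_shift m t x y z x' y' z' : (m | x - x') -> (m | y - y') -> (m | z - z') ->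
  integral m x y z t -> integral m x' y' z' t.
Proof.
intros [co1' h1] [co2' h2] [co3' h3] (i1 & i2 & i3 & i4); unfold integral.
split; [|split; [|split]];
  [apply (dvd_sub_cancel (x := k * b + lin1 t x y z)); [|exact i1]
  |apply (dvd_sub_cancel (x := k * b + lin2 t x y z)); [|exact i2]
  |apply (dvd_sub_cancel (x := k * b + lin3 t x y z)); [|exact i3]
  |apply (dvd_sub_cancel (x := k * b + lin0 a t x y z)); [|exact i4]]; unfold lin0, lin1, lin2, lin3.
- exists (e11 t * co1' + e12 t * co2' + e13 t * co3').
  transitivity (e11 t * (x - x') + e12 t * (y - y') + e13 t * (z - z')); [ring|rewrite h1, h2, h3; ring].
- exists (e21 t * co1' + e22 t * co2' + e23 t * co3').
  transitivity (e21 t * (x - x') + e22 t * (y - y') + e23 t * (z - z')); [ring|rewrite h1, h2, h3; ring].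
- exists (e31 t * co1' + e32 t * co2' + e33 t * co3').
  transitivity (e31 t * (x - x') + e32 t * (y - y') + e33 t * (z - z')); [ring|rewrite h1, h2, h3; ring].
- exists (- (co1 a * (e11 t * co1' + e12 t * co2' + e13 t * co3') + co2 a * (e21 t * co1' + e22 t * co2' + e23 t * co3')
    + co3 a * (e31 t * co1' + e32 t * co2' + e33 t * co3'))).
  transitivity (- (co1 a * (e11 t * (x - x') + e12 t * (y - y') + e13 t * (z - z'))
    + co2 a * (e21 t * (x - x') + e22 t * (y - y') + e23 t * (z - z'))
    + co3 a * (e31 t * (x - x') + e32 t * (y - y') + e33 t * (z - z')))); [ring|rewrite h1, h2, h3; ring].
Qed.

Lemma mask_sound kb x y z (ts : list (N * emb)) j : N.testbit (mask (pm p) kb x y z ts) j = true ->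
  exists bt, In bt ts /\ N.testbit (fst bt) j = true /\ (pm p | kb + lin1 (snd bt) x y z).
Proof.
induction ts as [|bt ts IH]; simpl; [discriminate|].
destruct ((kb + lin1 (snd bt) x y z) mod pm p =? 0) eqn:E.
- rewrite N.lor_spec, orb_true_iff; intros [h|h].
  + exists bt; split; [left; reflexivity|split; [exact h|apply eqb_mod_divide, E]].
  + destruct (IH h) as (bt' & h1 & h2); exists bt'; split; [right; exact h1|exact h2].
- intros h; destruct (IH h) as (bt' & h1 & h2); exists bt'; split; [right; exact h1|exact h2].
Qed.

Lemma leaves_sound d : forall w x y z ts s t u, (pm p | w * pq p ^ Z.of_nat d) ->
  X = x + w * s -> Y = y + w * t -> Z0 = z + w * u ->
  (forall bt, In bt ts -> congruent a (Z.gcd w (pm p)) x y z (snd bt) = true) ->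
  exists m, In m (leaves a k M f p d w x y z ts)
    /\ forall j, N.testbit m j = true ->
         exists bt, In bt ts /\ N.testbit (fst bt) j = true /\ integral (pm p) X Y Z0 (snd bt).
Proof.
induction d as [|d IH]; intros w x y z ts s t u hw hX hY hZ hts.
- assert (hmw : (pm p | w)) by (rewrite Z.mul_1_r in hw; exact hw).
  exists (mask (pm p) (k * snd r) x y z ts); split.
  + simpl; apply in_flat_map; exists r; split; [exact in_reps|].
    rewrite fits_true; [left; reflexivity|].
    rewrite <- val_n, hX, hY, hZ; apply form_val_shift.
  + intros j hj; destruct (mask_sound hj) as (bt & h1 & h2 & h3).
    exists bt; split; [exact h1|split; [exact h2|]].
    specialize (hts bt h1); unfold congruent in hts.
    destruct (_ =? 0) eqn:E1 in hts; [|discriminate]; destruct (_ =? 0) eqn:E2 in hts; [|discriminate].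
    rewrite eqb_mod_divide in E1, E2, hts.
    assert (hg : (pm p | Z.gcd w (pm p))) by (apply Z.gcd_greatest; [exact hmw|apply Z.divide_refl]).
    assert (i1 := Z.divide_trans _ _ _ hg E1); assert (i2 := Z.divide_trans _ _ _ hg E2).
    assert (i3 := Z.divide_trans _ _ _ hg hts); clear E1 E2 hts hg.
    assert (hb : (pm p | k * b + lin1 (snd bt) x y z)).
    { destruct b_class as [c hc].
      replace (k * b + lin1 (snd bt) x y z) with (k * snd r + lin1 (snd bt) x y z + k * pbeta p * c).
      - apply Z.divide_add_r; [exact h3|apply Z.divide_mul_l; exact m_beta].
      - replace (k * pbeta p * c) with (k * (c * pbeta p)) by ring; rewrite <- hc; ring. }
    apply (@integral_shift _ _ x y z).
    * rewrite hX; apply (Z.divide_trans _ _ _ hmw); exists (- s); ring.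
    * rewrite hY; apply (Z.divide_trans _ _ _ hmw); exists (- t); ring.
    * rewrite hZ; apply (Z.divide_trans _ _ _ hmw); exists (- u); ring.
    * split; [exact hb|split; [|split]].
      -- apply (dvd_sub_cancel (x := k * b + lin1 (snd bt) x y z)); [|exact hb].
         match goal with |- (_ | ?e) => replace e with (lin1 (snd bt) x y z - lin2 (snd bt) x y z) by ring end; exact i1.
      -- apply (dvd_sub_cancel (x := k * b + lin1 (snd bt) x y z)); [|exact hb].
         match goal with |- (_ | ?e) => replace e with (lin1 (snd bt) x y z - lin3 (snd bt) x y z) by ring end; exact i2.
      -- apply (dvd_sub_cancel (x := k * b + lin1 (snd bt) x y z)); [|exact hb].
         unfold lin0.
         match goal with |- (_ | ?e) => replace e with (lin1 (snd bt) x y z + (co1 a * lin1 (snd bt) x y z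
           + co2 a * lin2 (snd bt) x y z + co3 a * lin3 (snd bt) x y z)) by ring end; exact i3.
- assert (q0 : pq p <> 0) by lia.
  pose (w' := w * pq p); pose (x' := x + w * (s mod pq p)); pose (y' := y + w * (t mod pq p)); pose (z' := z + w * (u mod pq p)).
  destruct (IH w' x' y' z' (filter (fun bt => congruent a (Z.gcd w' (pm p)) x' y' z' (snd bt)) ts)
    (s / pq p) (t / pq p) (u / pq p)) as (m & hm & hj).
  + replace (w' * pq p ^ Z.of_nat d) with (w * pq p ^ Z.of_nat (S d)); [exact hw|].
    rewrite Nat2Z.inj_succ, Z.pow_succ_r; [unfold w'; ring|lia].
  + unfold x', w'; rewrite hX; rewrite (Z.div_mod s (pq p) q0) at 1; ring.
  + unfold y', w'; rewrite hY; rewrite (Z.div_mod t (pq p) q0) at 1; ring.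
  + unfold z', w'; rewrite hZ; rewrite (Z.div_mod u (pq p) q0) at 1; ring.
  + intros bt hbt; apply filter_In in hbt; exact (proj2 hbt).
  + exists m; split.
    * simpl; apply in_flat_map; exists (s mod pq p, t mod pq p, u mod pq p); split.
      -- apply in_digits; apply Z.mod_pos_bound, pq_pos.
      -- rewrite fits_any_true; [exact hm|].
         fold w' x' y' z'.
         rewrite <- val_n.
         replace X with (x' + w' * (s / pq p)) by (unfold x', w'; rewrite hX; rewrite (Z.div_mod s (pq p) q0) at 3; ring).
         replace Y with (y' + w' * (t / pq p)) by (unfold y', w'; rewrite hY; rewrite (Z.div_mod t (pq p) q0) at 3; ring).
         replace Z0 with (z' + w' * (u / pq p)) by (unfold z', w'; rewrite hZ; rewrite (Z.div_mod u (pq p) q0) at 3; ring).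
         apply form_val_shift_coarse.
    * intros j h; destruct (hj j h) as (bt & h1 & h2); exists bt; split; [|exact h2].
      apply filter_In in h1; exact (proj1 h1).
Qed.

End Leaves.

Lemma in_indexed bt ts : In bt (indexed ts) ->
  exists i, fst bt = (2 ^ N.of_nat i)%N /\ nth_error ts i = Some (snd bt).
Proof.
unfold indexed.
assert (h : forall s, In bt (combine (map (fun i => (2 ^ N.of_nat i)%N) (seq s (length ts))) ts) ->
  exists i, fst bt = (2 ^ N.of_nat (s + i))%N /\ nth_error ts i = Some (snd bt)).
{ induction ts as [|t ts IH]; intros s; simpl; [contradiction|].
  intros [<-|h].
  - exists 0%nat; rewrite Nat.add_0_r; split; reflexivity.
  - destruct (IH _ h) as (i & h1 & h2); exists (S i); rewrite Nat.add_succ_r; split; assumption. }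
exact (h 0%nat).
Qed.

Lemma integral_emb_mod a k b m t x y z :
  integral a k b m x y z (emb_mod m t) -> integral a k b m x y z t.
Proof.
assert (hr : forall e, exists c, e = e mod m + c * m).
{ intros e; destruct (Z.eq_dec m 0) as [->|h]; [exists 0; rewrite Zmod_0_r; ring|].
  exists (e / m); rewrite (Z.div_mod e m h) at 1; ring. }
destruct (hr (e11 t)) as [d11 h11]; destruct (hr (e12 t)) as [d12 h12]; destruct (hr (e13 t)) as [d13 h13].
destruct (hr (e21 t)) as [d21 h21]; destruct (hr (e22 t)) as [d22 h22]; destruct (hr (e23 t)) as [d23 h23].
destruct (hr (e31 t)) as [d31 h31]; destruct (hr (e32 t)) as [d32 h32]; destruct (hr (e33 t)) as [d33 h33].
assert (k1 : lin1 t x y z = lin1 (emb_mod m t) x y z + m * (d11 * x + d12 * y + d13 * z)).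
{ unfold lin1; simpl; rewrite h11, h12, h13 at 1; ring. }
assert (k2 : lin2 t x y z = lin2 (emb_mod m t) x y z + m * (d21 * x + d22 * y + d23 * z)).
{ unfold lin2; simpl; rewrite h21, h22, h23 at 1; ring. }
assert (k3 : lin3 t x y z = lin3 (emb_mod m t) x y z + m * (d31 * x + d32 * y + d33 * z)).
{ unfold lin3; simpl; rewrite h31, h32, h33 at 1; ring. }
intros (i1 & i2 & i3 & i4); unfold integral, lin0 in *; rewrite k1, k2, k3.
split; [|split; [|split]].
- rewrite Z.add_assoc; apply Z.divide_add_r; [exact i1|apply Z.divide_factor_l].
- rewrite Z.add_assoc; apply Z.divide_add_r; [exact i2|apply Z.divide_factor_l].
- rewrite Z.add_assoc; apply Z.divide_add_r; [exact i3|apply Z.divide_factor_l].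
- match type of i4 with (_ | ?e) => match goal with |- (_ | ?g) => replace g with (e - m *
    (co1 a * (d11 * x + d12 * y + d13 * z) + co2 a * (d21 * x + d22 * y + d23 * z)
     + co3 a * (d31 * x + d32 * y + d33 * z))) by ring end end.
  apply Z.divide_sub_r; [exact i4|apply Z.divide_factor_l].
Qed.

Lemma in_insert_masks m l : In m l -> In m (fold_right insert_mask [] l).
Proof.
induction l as [|x l IH]; simpl; [contradiction|].
unfold insert_mask at 1; destruct (existsb (N.eqb x) _) eqn:E.
- intros [->|h]; [|exact (IH h)].
  apply existsb_exists in E; destruct E as (y & h & e); apply N.eqb_eq in e; congruence.
- intros [->|h]; [left; reflexivity|right; exact (IH h)].
Qed.

Lemma joint_sound l : forall acc, joint acc l = true ->
  forall ms, Forall2 (fun m L => In m L) ms l ->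
  exists j, N.testbit acc j = true /\ Forall (fun m => N.testbit m j = true) ms.
Proof.
induction l as [|L l IH]; simpl; intros acc h ms hms; [inversion hms; subst|inversion hms as [|m' L' ms' l' hm hl]; subst].
- exists (N.log2 acc); split; [|constructor].
  apply N.bit_log2; intros ->; discriminate.
- rewrite forallb_forall in h.
  destruct (IH _ (h _ hm) _ hl) as (j & h1 & h2); exists j.
  rewrite N.land_spec, andb_true_iff in h1; destruct h1 as [h0 h1].
  split; [exact h0|constructor; assumption].
Qed.

Lemma coprime_product_dvd l x : coprime_product l = true ->
  (forall m, In m l -> (m | x)) -> (fold_right Z.mul 1 l | x).
Proof.
induction l as [|m l IH]; simpl; intros h hm; [apply Z.divide_1_l|].
rewrite andb_true_iff, Z.eqb_eq in h; destruct h as [hg hl].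
destruct (IH hl (fun m' h' => hm m' (or_intror h'))) as [c hc].
destruct (hm m (or_introl eq_refl)) as [d hd].
assert (hdiv : (m | c)).
{ apply (Z.gauss m (fold_right Z.mul 1 l)); [|exact hg]; exists d; rewrite <- hd, hc; ring. }
destruct hdiv as [e he]; exists e; rewrite hc, he; ring.
Qed.

Lemma dvd_cancel_l l m x : Z.gcd l m = 1 -> (m | l * x) -> (m | x).
Proof. intros h1 h2; apply (Z.gauss m l); [exact h2|rewrite Z.gcd_comm; exact h1]. Qed.

Lemma mod_sub_divide m x y : 0 < m -> x mod m = y -> (m | x - y).
Proof. intros h <-; exists (x / m); rewrite (Z.div_mod x m) at 1 by lia; ring. Qed.

Definition admissible (p : part) (n b : Z) : bool := pmem (n mod pnm p, b mod pwin p) (padm p).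

Section Box.
Variables (a : coeffs) (o : plan) (f : tform) (ts : list emb) (n b x y z : Z).
Hypothesis val_n : form_val f x y z = n.
Hypothesis rel_n : (kk o * kk o * total a * total a | mul o * n + total a * (kk o * kk o) * (b * b)).

Lemma part_masks_sound p : part_ok a o p = true -> admissible p n b = true ->
  exists m, In m (part_masks a (kk o) (mul o) f ts p) /\
    forall j, N.testbit m j = true ->
      exists t, nth_error ts (N.to_nat j) = Some t /\ integral a (kk o) b (pm p) x y z t.
Proof.
unfold part_ok; rewrite !andb_true_iff, !Z.ltb_lt, !eqb_mod_divide.
intros [[[[[[[[[[[[m0 q0] nm0] be0] rel0] hb] hq] hrel] hrelb] _] _] hwin] horb] hadm.
apply pmemP in hadm; unfold orbits_ok in horb; rewrite forallb_forall in horb.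
specialize (horb _ hadm); cbn [fst snd] in horb; rewrite forallb_forall in horb.
assert (hbe := Z.mod_pos_bound b (pbeta p) be0).
specialize (horb (b mod pbeta p) (@in_zrange 0 (Z.to_nat (pbeta p)) (b mod pbeta p) ltac:(lia))).
rewrite Z.mod_mod_divide, Z.eqb_refl, existsb_exists in horb by exact hwin.
(* The search is applied to the scaled data [(l^2 n, l b, l y)], which belong to a stored
   representative; [l] is prime to [pm], so integrality descends to the original vector. *)
destruct horb as (l & _ & hl); rewrite andb_true_iff, Z.eqb_eq in hl; destruct hl as [hl hr].
apply pmemP in hr; cbn [fst snd] in hr.
set (r := (_, _)) in hr.
pose (T := map (fun bt => (fst bt, emb_mod (pm p) (snd bt))) (indexed ts)).
destruct (@leaves_sound a (kk o) (mul o) f p (l * b) (l * l * n) (l * x) (l * y) (l * z) r) with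
  (d := pdepth p) (w := 1) (x := 0) (y := 0) (z := 0) (ts := T) (s := l * x) (t := l * y) (u := l * z)
  as (m & hm & hj); try assumption; try ring.
- rewrite <- val_n; unfold form_val; ring.
- apply mod_sub_divide; [exact nm0|]; unfold r; cbn [fst].
  rewrite <- (Z.mul_mod_idemp_r (l * l) n) by lia; reflexivity.
- apply mod_sub_divide; [exact be0|]; unfold r; cbn [snd].
  rewrite <- (Z.mul_mod_idemp_r l b) by lia; reflexivity.
- apply (Z.divide_trans _ _ _ hrel).
  replace (mul o * (l * l * n) + total a * (kk o * kk o) * (l * b * (l * b)))
    with ((mul o * n + total a * (kk o * kk o) * (b * b)) * (l * l)) by ring.
  apply Z.divide_mul_l; exact rel_n.
- rewrite Z.mul_1_l; exact hq.
- intros bt _; rewrite Z.gcd_1_l; unfold congruent; rewrite !Zmod_1_r; reflexivity.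
- exists m; split; [apply in_insert_masks; exact hm|].
  intros j h; destruct (hj j h) as (bt & h1 & h2 & h3).
  apply in_map_iff in h1; destruct h1 as (bt0 & <- & h1); cbn [fst snd] in h2, h3.
  destruct (in_indexed h1) as (i & e1 & e2).
  rewrite e1, N.pow2_bits_eqb, N.eqb_eq in h2; subst j; rewrite Nat2N.id.
  exists (snd bt0); split; [exact e2|].
  apply integral_emb_mod in h3; destruct h3 as (i1 & i2 & i3 & i4).
  unfold integral; repeat split; apply (dvd_cancel_l hl).
  + replace (l * (kk o * b + lin1 (snd bt0) x y z)) with
      (kk o * (l * b) + lin1 (snd bt0) (l * x) (l * y) (l * z)) by (unfold lin1; ring); exact i1.
  + replace (l * (kk o * b + lin2 (snd bt0) x y z)) with
      (kk o * (l * b) + lin2 (snd bt0) (l * x) (l * y) (l * z)) by (unfold lin2; ring); exact i2.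
  + replace (l * (kk o * b + lin3 (snd bt0) x y z)) with
      (kk o * (l * b) + lin3 (snd bt0) (l * x) (l * y) (l * z)) by (unfold lin3; ring); exact i3.
  + replace (l * (kk o * b + lin0 a (snd bt0) x y z)) with
      (kk o * (l * b) + lin0 a (snd bt0) (l * x) (l * y) (l * z)) by (unfold lin0, lin1, lin2, lin3; ring); exact i4.
Qed.

Lemma box_sound box : box_ok a o box = true -> In (f, ts) (combine (classes (ram o)) (embs o)) ->
  forallb (fun p => admissible p n b) box = true ->
  exists t, In t ts /\ integral a (kk o) b (kk o * total a) x y z t.
Proof.
unfold box_ok; rewrite !andb_true_iff, Z.eqb_eq, !forallb_forall.
intros [[[hp hprod] hcop] hj] hf hadm.
specialize (hj _ hf); cbn [fst snd] in hj.
assert (hms : exists ms, Forall2 (fun m L => In m L) ms (map (part_masks a (kk o) (mul o) f ts) box)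
  /\ forall j, Forall (fun m => N.testbit m j = true) ms -> forall p, In p box ->
       exists t, nth_error ts (N.to_nat j) = Some t /\ integral a (kk o) b (pm p) x y z t).
{ clear hprod hcop hj; induction box as [|p box IH].
  - exists []; split; [constructor|intros j _ p []].
  - destruct IH as (ms & h1 & h2); [intros; apply hp; right; assumption|intros; apply hadm; right; assumption|].
    destruct (@part_masks_sound p) as (m & h3 & h4); [apply hp; left; reflexivity|apply hadm; left; reflexivity|].
    exists (m :: ms); split; [constructor; assumption|].
    intros j hj p' [<-|hp']; inversion hj; subst; [apply h4; assumption|apply h2; assumption]. }
destruct hms as (ms & h1 & h2).
destruct (joint_sound hj h1) as (j & hj1 & hj2).
assert (ht : exists t, nth_error ts (N.to_nat j) = Some t).
{ destruct (nth_error ts (N.to_nat j)) as [t|] eqn:E; [exists t; reflexivity|].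
  apply nth_error_None in E; rewrite N.ones_spec_high in hj1; [discriminate|lia]. }
destruct ht as [t ht]; exists t; split; [eapply nth_error_In; exact ht|].
assert (hall : forall m, In m (map pm box) -> integral a (kk o) b m x y z t).
{ intros m hm; apply in_map_iff in hm; destruct hm as (p & <- & hp').
  destruct (h2 j hj2 p hp') as (t' & e & h); congruence. }
rewrite <- hprod.
unfold integral; repeat split; apply coprime_product_dvd; try assumption; intros m hm; apply (hall m hm).
Qed.

End Box.

Definition usable (o : plan) (n : Z) : bool :=
  match src o with
  | Squares => (n mod 4 =? 1) || (n mod 4 =? 2) || (n mod 8 =? 3)
  | Coprime => negb (n mod ram o =? 0)
  | Ramified l => (n mod ram o =? 0) && zmem ((n / ram o) mod ram o) l
  end.

Definition suitable (a : coeffs) (o : plan) (N b : Z) : bool :=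
  if (2 * N + b) mod 3 =? 0 then
    let F := total a * (2 * N + b) - 3 * (b * b) in
    if F mod den o =? 0 then
      let n := num o * (F / den o) in
      usable o n && existsb (forallb (fun p => admissible p n b)) (boxes o)
    else false
  else false.

Definition source_ok (o : plan) : bool :=
  match src o with
  | Squares => (ram o =? 1) && (lev o mod 8 =? 0)
  | Coprime => zmem (ram o) odd_ramified && (lev o mod ram o =? 0)
  | Ramified l => zmem (ram o) odd_ramified && (lev o mod (ram o * ram o) =? 0)
      && forallb (anisotropic_modb (ram o)) l
  end.

Fixpoint search (a : coeffs) (o : plan) (N b : Z) (i : nat) : option Z :=
  match i with
  | O => None
  | S i' => if suitable a o N b then Some b else search a o N (b - 3) i'
  end.

(** Greedy covering: the last suitable [b] of the window at [lo] lies in every window starting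
    between [lo] and [b], so the next one to examine starts at [b + 1]. Candidates are met in steps
    of 3 because [3] must divide [2 N + b]. *)
Fixpoint scan (a : coeffs) (o : plan) (g N lo : Z) (i : nat) : bool :=
  if perB o <=? lo then true else
  match i with
  | O => false
  | S i' =>
      let top := lo + g - 1 in
      match search a o N (top - (2 * N + top) mod 3) (Z.to_nat g) with
      | Some b => if lo <=? b then scan a o g N (b + 1) i' else false
      | None => false
      end
  end.

(** The quantities tested against [per] are the coefficients in the expansion of
    [F (N + perN i, b + perB j) - F (N, b)]; a change of [F] by [per] then moves [n] by a multiple
    of [lev]. *)
Definition period_ok (a : coeffs) (o : plan) : bool :=
  (0 <? den o) && (0 <? perN o) && (0 <? perB o) && (0 <? cls o)
  && (per o mod den o =? 0) && (num o * (per o / den o) mod lev o =? 0)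
  && (2 * total a * perN o mod per o =? 0) && (total a * perB o mod per o =? 0)
  && (6 * perB o mod per o =? 0) && (3 * (perB o * perB o) mod per o =? 0)
  && (perN o mod 3 =? 0) && (perB o mod 3 =? 0) && (perN o mod cls o =? 0)
  && (0 <? lev o).

Definition algebra_ok (a : coeffs) (o : plan) : bool :=
  (0 <? kk o) && (0 <? num o) && (kk o * kk o * total a * den o =? 3 * mul o * num o)
  && Nat.eqb (length (embs o)) (length (classes (ram o)))
  && forallb (fun ft : tform * list emb => forallb (similitude a (mul o) (fst ft)) (snd ft))
       (combine (classes (ram o)) (embs o)).

Definition plan_ok (a : coeffs) (g : Z) (o : plan) : bool :=
  source_ok o && period_ok a o && algebra_ok a o && forallb (box_ok a o) (boxes o)
  && forallb (fun N => if zmem (N mod cls o) (clsr o) then scan a o g N 0 (Z.to_nat (perB o)) else true)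
       (zrange 0 (Z.to_nat (perN o))).

(** Put [H b = 3 b^2 + (7 - A) b + 3 A]. Then [(A - 1) F < 3 (A + b)^2], the inequality behind
    [cauchy_nonneg], amounts to [H b > 2 (A - 1) N]. Let [c] be the last point where it fails. That
    [F] is still positive at [c + g] follows from a quadratic inequality in [c] with linear
    coefficient [kappa], which is tested at [beta] and persists since [6 beta + kappa >= 0]. The
    condition on [start] puts [c] beyond [beta]. *)
Definition threshold_ok (a : coeffs) (g beta start : Z) : bool :=
  let A := total a in
  let kappa := 7 - A - (A - 1) * (6 * g - 7) in
  (A <=? beta) && (0 <=? 6 * beta + kappa)
  && (0 <? 3 * (beta * beta) + kappa * beta + 3 * A - (A - 1) * (3 * (g * g) - A * g - 3 * A))
  && (3 * (beta * beta) + (7 - A) * beta + 3 * A <=? 2 * (A - 1) * start).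

Definition cert_ok (c : cert) : bool :=
  (0 <? co1 (co c)) && (0 <? co2 (co c)) && (0 <? co3 (co c)) && (0 <? gap c) && (0 <? cmod c)
  && threshold_ok (co c) (gap c) (base c) (start c)
  && forallb (plan_ok (co c) (gap c)) (plans c)
  && forallb (fun o => cmod c mod cls o =? 0) (plans c)
  && forallb (fun r => existsb (fun o => zmem (r mod cls o) (clsr o)) (plans c)) (creq c).

(** * Windows of values of b *)

Lemma search_sound a o N i : forall b b', search a o N b i = Some b' ->
  suitable a o N b' = true /\ b' <= b.
Proof.
induction i as [|i IH]; simpl; intros b b' h; [discriminate|].
destruct (suitable a o N b) eqn:E; [injection h as <-; split; [exact E|lia]|].
destruct (IH _ _ h); split; [assumption|lia].
Qed.

Lemma scan_sound a o g N i : forall lo, scan a o g N lo i = true ->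
  forall s, lo <= s < perB o -> exists b, s <= b < s + g /\ suitable a o N b = true.
Proof.
induction i as [|i IH]; cbn [scan]; intros lo; destruct (Z.leb_spec (perB o) lo) as [h|h]; intros hs s hls;
  [lia|discriminate|lia|].
destruct (search _ _ _ _ _) as [b|] eqn:E; [|discriminate].
destruct (Z.leb_spec lo b) as [hb|hb]; [|discriminate].
apply search_sound in E; destruct E as [h1 h2].
assert (h3 := Z.mod_pos_bound (2 * N + (lo + g - 1)) 3 ltac:(lia)).
destruct (Z_le_gt_dec s b).
- exists b; split; [lia|exact h1].
- apply (IH _ hs); lia.
Qed.

Lemma mod_shift m x y : (m | x - y) -> x mod m = y mod m.
Proof.
intros [c hc]; replace x with (y + c * m) by lia.
destruct (Z.eq_dec m 0) as [->|h]; [rewrite Z.mul_0_r, Z.add_0_r; reflexivity|apply Z_mod_plus_full].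
Qed.

Lemma usable_shift o n n' : source_ok o = true -> 0 < lev o -> (lev o | n - n') -> usable o n = usable o n'.
Proof.
unfold source_ok, usable; intros hs hl hd.
destruct (src o) as [| |l]; rewrite ?andb_true_iff, ?eqb_mod_divide in hs.
- destruct hs as [_ h8].
  assert (h := Z.divide_trans _ _ _ h8 hd).
  assert (h4 : (4 | n - n')) by (apply (Z.divide_trans _ 8); [exists 2; reflexivity|exact h]).
  rewrite (mod_shift h), (mod_shift h4); reflexivity.
- destruct hs as [_ hp]; rewrite (mod_shift (Z.divide_trans _ _ _ hp hd)); reflexivity.
- destruct hs as [[h1 hp] _].
  assert (hP : ram o <> 0) by (intros e; rewrite e in h1; discriminate).
  destruct (Z.divide_trans _ _ _ hp hd) as [c hc].
  replace n with (n' + (c * ram o) * ram o) by lia.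
  rewrite Z_mod_plus_full, Z.div_add, Z_mod_plus_full by exact hP; reflexivity.
Qed.

Lemma suitable_shift a o N N' b b' : source_ok o = true -> period_ok a o = true ->
  forallb (box_ok a o) (boxes o) = true -> (perN o | N - N') -> (perB o | b - b') ->
  suitable a o N' b' = true -> suitable a o N b = true.
Proof.
intros hs hp hb [i hi] [j hj].
assert (eN : N = N' + perN o * i) by lia.
assert (eb : b = b' + perB o * j) by lia.
clear hi hj.
unfold period_ok in hp; rewrite !andb_true_iff, !Z.ltb_lt, !eqb_mod_divide in hp.
destruct hp as [[[[[[[[[[[[[d0 R0] B0] _] hden] hlev] hR] hB1] hB2] hB3] hR3] hB4] _] l0].
unfold suitable.
set (F := total a * (2 * N + b) - 3 * (b * b)); set (F' := total a * (2 * N' + b') - 3 * (b' * b')).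
destruct ((2 * N' + b') mod 3 =? 0) eqn:E3; [|discriminate].
destruct (F' mod den o =? 0) eqn:EF; [|discriminate].
rewrite eqb_mod_divide in E3, EF; intros h.
assert (h3 : (3 | 2 * N + b)).
{ rewrite eN, eb; replace (2 * (N' + perN o * i) + (b' + perB o * j))
    with (2 * N' + b' + (perN o * (2 * i) + perB o * j)) by ring.
  apply Z.divide_add_r; [exact E3|apply Z.divide_add_r; apply Z.divide_mul_l; assumption]. }
rewrite (proj2 (eqb_mod_divide 3 (2 * N + b)) h3).
assert (hF : (per o | F - F')).
{ replace (F - F') with (2 * total a * perN o * i + total a * perB o * j - (6 * perB o * (b' * j)
    + 3 * (perB o * perB o) * (j * j))) by (unfold F, F'; rewrite eN, eb; ring).
  apply Z.divide_sub_r; [|apply Z.divide_add_r; apply Z.divide_mul_l; assumption].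
  apply Z.divide_add_r; apply Z.divide_mul_l; assumption. }
destruct hF as [t ht]; destruct hden as [e he]; destruct EF as [v hv].
assert (eF : F = (v + t * e) * den o).
{ replace F with (F' + (F - F')) by ring; rewrite ht, hv, he; ring. }
rewrite (proj2 (eqb_mod_divide (den o) F)) by (exists (v + t * e); exact eF).
assert (q1 : F / den o = v + t * e) by (rewrite eF; apply Z.div_mul; lia).
assert (q2 : F' / den o = v) by (rewrite hv; apply Z.div_mul; lia).
assert (q3 : per o / den o = e) by (rewrite he; apply Z.div_mul; lia).
rewrite q3 in hlev.
assert (hn : (lev o | num o * (F / den o) - num o * (F' / den o))).
{ rewrite q1, q2; replace (num o * (v + t * e) - num o * v) with (num o * e * t) by ring.
  apply Z.divide_mul_l; exact hlev. }
rewrite andb_true_iff in h |- *; destruct h as [h1 h2]; split.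
- rewrite (usable_shift hs l0 hn); exact h1.
- rewrite existsb_exists in h2 |- *; destruct h2 as (box & hbox & h2); exists box; split; [exact hbox|].
  rewrite forallb_forall in h2, hb |- *; intros p hp; specialize (h2 p hp).
  specialize (hb _ hbox); unfold box_ok in hb; rewrite !andb_true_iff in hb.
  destruct hb as [[[hb _] _] _]; rewrite forallb_forall in hb; specialize (hb p hp).
  unfold part_ok in hb; rewrite !andb_true_iff, !eqb_mod_divide in hb.
  destruct hb as [[[[_ hnm] hbe] _] _].
  unfold admissible in *.
  rewrite (mod_shift (Z.divide_trans _ _ _ hnm hn)).
  replace (b mod pwin p) with (b' mod pwin p); [exact h2|].
  symmetry; apply mod_shift; rewrite eb.
  replace (b' + perB o * j - b') with (perB o * j) by ring; apply Z.divide_mul_l; exact hbe.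
Qed.

Lemma plan_window a g o N s : plan_ok a g o = true -> zmem (N mod cls o) (clsr o) = true ->
  exists b, s <= b < s + g /\ suitable a o N b = true.
Proof.
unfold plan_ok; rewrite !andb_true_iff, !forallb_forall; intros [[[[hs hp] ha] hb] hscan] hN.
assert (hp' := hp); unfold period_ok in hp'; rewrite !andb_true_iff, !Z.ltb_lt, !eqb_mod_divide in hp'.
destruct hp' as [[[[[[[[[[[[[d0 R0] B0] cl0] _] _] _] _] _] _] _] _] hcls] _].
assert (r1 := Z.mod_pos_bound N (perN o) R0); assert (r2 := Z.mod_pos_bound s (perB o) B0).
assert (h := hscan (N mod perN o) (@in_zrange 0 (Z.to_nat (perN o)) (N mod perN o) ltac:(lia))).
assert (dN : (perN o | N - N mod perN o)) by (exists (N / perN o); rewrite (Z.div_mod N (perN o)) at 1 by lia; ring).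
rewrite <- (mod_shift (Z.divide_trans _ _ _ hcls dN)), hN in h.
destruct (scan_sound h (s := s mod perB o)) as (b & h1 & h2); [lia|].
exists (b + perB o * (s / perB o)); split.
- assert (e := Z.div_mod s (perB o) ltac:(lia)); lia.
- apply (@suitable_shift a o N (N mod perN o) _ b); try assumption.
  + rewrite forallb_forall; exact hb.
  + exists (s / perB o); ring.
Qed.

(** Let [D = A m - b^2]. Cauchy-Schwarz applied to the three other deviations [A x_i - b] gives
    [p (A xp - b)^2 <= (A - p) D]. If [xp <= -1], the left side is at least [(A + b)^2], against the
    last hypothesis. *)
Lemma cauchy_nonneg p q r s xp xq xr xs A b m : 0 < p -> 0 <= q -> 0 <= r -> 0 <= s -> p + q + r + s = A ->
  p * xp + q * xq + r * xr + s * xs = b -> p * (xp * xp) + q * (xq * xq) + r * (xr * xr) + s * (xs * xs) = m ->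
  0 < A + b -> (A - 1) * (A * m - b * b) < (A + b) * (A + b) -> 0 <= xp.
Proof.
intros hp hq hr hs hA hb hm hAb hlt.
destruct (Z_le_gt_dec 0 xp) as [h|h]; [exact h|exfalso].
pose (D := A * m - b * b).
assert (D0 : 0 <= A * D /\ p * ((A * xp - b) * (A * xp - b)) <= (A - p) * D).
{ pose (dp := A * xp - b); pose (dq := A * xq - b); pose (dr := A * xr - b); pose (ds := A * xs - b).
  assert (s1 : p * dp + q * dq + r * dr + s * ds = 0).
  { unfold dp, dq, dr, ds; rewrite <- hb, <- hA; ring. }
  assert (s2 : p * (dp * dp) + q * (dq * dq) + r * (dr * dr) + s * (ds * ds) = A * D).
  { unfold dp, dq, dr, ds, D; rewrite <- hm, <- hb, <- hA; ring. }
  (* Lagrange's identity, the exact form of Cauchy-Schwarz with weights [q], [r], [s]. *)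
  assert (s3 : (q + r + s) * (q * (dq * dq) + r * (dr * dr) + s * (ds * ds)) - (q * dq + r * dr + s * ds) * (q * dq + r * dr + s * ds)
    = q * r * ((dq - dr) * (dq - dr)) + q * s * ((dq - ds) * (dq - ds)) + r * s * ((dr - ds) * (dr - ds))) by ring.
  assert (s4 : 0 <= q * r * ((dq - dr) * (dq - dr)) + q * s * ((dq - ds) * (dq - ds)) + r * s * ((dr - ds) * (dr - ds))).
  { repeat apply Z.add_nonneg_nonneg; apply Z.mul_nonneg_nonneg; try apply Z.square_nonneg; apply Z.mul_nonneg_nonneg; assumption. }
  assert (s5 : q * dq + r * dr + s * ds = - (p * dp)) by lia.
  rewrite s5 in s3; clear s5.
  fold dp.
  assert (hqrs : q + r + s = A - p) by lia; rewrite hqrs in s3.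
  assert (e : q * (dq * dq) + r * (dr * dr) + s * (ds * ds) = A * D - p * (dp * dp)) by lia.
  rewrite e in s3.
  assert (s6 : 0 <= A * ((A - p) * D - p * (dp * dp))).
  { replace (A * ((A - p) * D - p * (dp * dp))) with
      ((A - p) * (A * D - p * (dp * dp)) - - (p * dp) * - (p * dp)) by ring; lia. }
  split.
  - rewrite <- s2; repeat apply Z.add_nonneg_nonneg; apply Z.mul_nonneg_nonneg; try apply Z.square_nonneg; lia.
  - assert (A0 : 0 < A) by lia.
    assert (0 <= (A - p) * D - p * (dp * dp)) by (apply (Z.mul_nonneg_cancel_l A); assumption).
    lia. }
destruct D0 as [D0 hc].
assert (0 <= D) by (apply (Z.mul_nonneg_cancel_l A); [lia|exact D0]).
assert (k1 : (A + b) * (A + b) <= (A * xp - b) * (A * xp - b)).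
{ assert (A * xp <= A * -1) by (apply Z.mul_le_mono_nonneg_l; lia).
  replace ((A * xp - b) * (A * xp - b)) with ((b - A * xp) * (b - A * xp)) by ring.
  apply Z.mul_le_mono_nonneg; lia. }
assert (k2 : 1 * ((A * xp - b) * (A * xp - b)) <= p * ((A * xp - b) * (A * xp - b))).
{ apply Z.mul_le_mono_nonneg_r; [apply Z.square_nonneg|lia]. }
assert (k3 : (A - p) * D <= (A - 1) * D) by (apply Z.mul_le_mono_nonneg_r; lia).
fold D in hlt; lia.
Qed.

Lemma threshold_window a g beta start N : 0 < co1 a -> 0 < co2 a -> 0 < co3 a -> 0 < g ->
  threshold_ok a g beta start = true -> start <= N ->
  exists c, beta <= c /\ forall b, c + 1 <= b < c + 1 + g ->
    0 < total a * (2 * N + b) - 3 * (b * b)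
    /\ (total a - 1) * (total a * (2 * N + b) - 3 * (b * b)) < 3 * ((total a + b) * (total a + b)).
Proof.
unfold threshold_ok; set (A := total a); intros h1 h2 h3 hg; rewrite !andb_true_iff, !Z.leb_le, Z.ltb_lt.
set (kappa := 7 - A - (A - 1) * (6 * g - 7)); intros [[[hA hk] hK] hs] hN.
assert (A4 : 4 <= A) by (unfold A, total; lia).
pose (H := fun b => 3 * (b * b) + (7 - A) * b + 3 * A).
assert (hX : H beta <= 2 * (A - 1) * N).
{ apply (Z.le_trans _ _ _ hs), Z.mul_le_mono_nonneg_l; lia. }
assert (mono : forall x y, beta <= x <= y -> H x <= H y).
{ intros x y hxy; assert (0 <= (y - x) * (3 * (x + y) + (7 - A))) by (apply Z.mul_nonneg_nonneg; lia).
  unfold H; lia. }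
assert (hex : forall m : nat, 2 * (A - 1) * N < H (beta + Z.of_nat m) ->
  exists c, beta <= c /\ H c <= 2 * (A - 1) * N < H (c + 1)).
{ induction m as [|m IH]; intros hm; [rewrite Z.add_0_r in hm; lia|].
  destruct (Z_le_gt_dec (H (beta + Z.of_nat m)) (2 * (A - 1) * N)) as [l|l].
  - exists (beta + Z.of_nat m); split; [lia|split; [exact l|]].
    replace (beta + Z.of_nat m + 1) with (beta + Z.of_nat (S m)) by lia; exact hm.
  - apply IH; lia. }
(* [H] has passed the value [X = 2 (A - 1) N] at the point [beta + X] at the latest. *)
destruct (hex (Z.to_nat (2 * (A - 1) * N))) as (c & hc & hc1 & hc2).
{ set (X := 2 * (A - 1) * N) in *.
  destruct (Z_lt_le_dec X 0) as [hx|hx].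
  { unfold H in hX; assert (0 <= (beta - A) * beta) by (apply Z.mul_nonneg_nonneg; lia).
    assert (0 <= beta * beta) by apply Z.square_nonneg; lia. }
  rewrite Z2Nat.id by exact hx; unfold H.
  assert (0 <= (beta + X) * (beta + X - A)) by (apply Z.mul_nonneg_nonneg; lia).
  assert (0 <= (beta + X) * (beta + X - 1)) by (apply Z.mul_nonneg_nonneg; lia).
  lia. }
exists c; split; [exact hc|intros b hb].
assert (hK' : (A - 1) * ((6 * g - 7) * c + 3 * (g * g) - A * g - 3 * A) < H c).
{ assert (0 <= (c - beta) * (3 * (c + beta) + kappa)) by (apply Z.mul_nonneg_nonneg; lia).
  assert (kappa * c = (7 - A) * c - (A - 1) * ((6 * g - 7) * c)) by (unfold kappa; ring).
  unfold H; lia. }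
assert (hN2 : (6 * g - 7) * c + 3 * (g * g) - A * g - 3 * A < 2 * N).
{ apply (Z.mul_lt_mono_pos_l (A - 1)); lia. }
assert (hb1 := mono (c + 1) b ltac:(lia)).
split.
- assert (0 <= (c + g - b) * (3 * (c + g + b) - A)) by (apply Z.mul_nonneg_nonneg; lia).
  assert (e : 3 * ((c + g) * (c + g)) - A * (c + g) = H c - 7 * c - 3 * A + 6 * g * c + 3 * (g * g) - A * g)
    by (unfold H; ring).
  lia.
- assert (2 * (A - 1) * N < H b) by lia.
  assert (e : 3 * ((A + b) * (A + b)) - (A - 1) * (A * (2 * N + b) - 3 * (b * b)) = A * (H b - 2 * (A - 1) * N))
    by (unfold H; ring).
  assert (0 < A * (H b - 2 * (A - 1) * N)) by (apply Z.mul_pos_pos; lia).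
  lia.
Qed.

Definition weighted (a : coeffs) (w x y z : Z) : Z := w + co1 a * x + co2 a * y + co3 a * z.

(** * From certificates to representations *)

Section Certificate.
(** The arithmetic of the genera enters through these three hypotheses, discharged in
    [cert_is_sum]. *)
Hypothesis squares : forall n, 0 < n -> n mod 4 = 1 \/ n mod 4 = 2 \/ n mod 8 = 3 ->
  represents (TF 1 1 1 0 0 0) n.
Hypothesis unramified : forall P n, In P odd_ramified -> 0 < n -> ~ (P | n) ->
  exists f, In f (classes P) /\ represents f n.
Hypothesis ramified : forall P n, In P odd_ramified -> 0 < n -> anisotropic_modb P (n mod P) = true ->
  exists f, In f (classes P) /\ represents f (P * n).

Lemma usable_represents o n : source_ok o = true -> 0 < n -> usable o n = true ->
  exists f, In f (classes (ram o)) /\ represents f n.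
Proof.
unfold source_ok, usable; intros hs n0 hn; destruct (src o) as [| |l]; rewrite ?andb_true_iff in hs.
- destruct hs as [e _]; apply Z.eqb_eq in e; rewrite e.
  exists (TF 1 1 1 0 0 0); split; [left; reflexivity|apply squares; [exact n0|]].
  rewrite !orb_true_iff, !Z.eqb_eq in hn; tauto.
- destruct hs as [e _]; apply zmemP in e; apply unramified; [exact e|exact n0|].
  intros hd; apply eqb_mod_divide in hd; rewrite hd in hn; discriminate.
- destruct hs as [[e _] hl]; apply zmemP in e; rewrite andb_true_iff, eqb_mod_divide in hn.
  destruct hn as [[c hc] hn]; apply zmemP in hn.
  assert (P0 : 0 < ram o) by (destruct e as [<-|[<-|[<-|[<-|[<-|[]]]]]]; lia).
  rewrite forallb_forall in hl; specialize (hl _ hn).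
  rewrite hc, Z.div_mul in hl by lia; rewrite hc, Z.mul_comm.
  apply ramified; [exact e| |exact hl].
  apply (Z.mul_pos_cancel_r c (ram o)); lia.
Qed.

Lemma in_combine_l (A B : Type) (l : list A) (l' : list B) x : length l' = length l -> In x l ->
  exists y, In (x, y) (combine l l').
Proof.
revert l'; induction l as [|x' l IH]; intros [|y' l'] e h; try discriminate; [destruct h|].
destruct h as [->|h]; [exists y'; left; reflexivity|].
destruct (IH l') as (y & hy); [injection e; auto|exact h|exists y; right; exact hy].
Qed.

Lemma plan_solves a g o N b : 0 < co1 a -> 0 < co2 a -> 0 < co3 a -> plan_ok a g o = true ->
  suitable a o N b = true -> 0 < total a * (2 * N + b) - 3 * (b * b) ->
  exists w x y z, weighted a w x y z = b /\ 3 * weighted a (w * w) (x * x) (y * y) (z * z) = 2 * N + b.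
Proof.
unfold plan_ok; rewrite !andb_true_iff; intros a1 a2 a3 [[[[hs hp] ha] hb] _] hsuit hF.
unfold period_ok in hp; rewrite !andb_true_iff in hp.
assert (d0 : 0 < den o) by (apply Z.ltb_lt; tauto); clear hp.
unfold algebra_ok in ha; rewrite !andb_true_iff, !Z.ltb_lt, Z.eqb_eq, Nat.eqb_eq in ha.
destruct ha as [[[[k0 u0] hrat] hlen] hsim].
unfold suitable in hsuit.
destruct ((2 * N + b) mod 3 =? 0) eqn:E3; [|discriminate].
set (F := total a * (2 * N + b) - 3 * (b * b)) in *.
destruct (F mod den o =? 0) eqn:EF; [|discriminate].
rewrite eqb_mod_divide in E3, EF; destruct E3 as [m hm]; destruct EF as [v hv].
rewrite hv, Z.div_mul in hsuit by lia; set (n := num o * v) in *.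
rewrite andb_true_iff, existsb_exists in hsuit; destruct hsuit as [husable (box & hbox & hadm)].
assert (n0 : 0 < n).
{ apply Z.mul_pos_pos; [exact u0|]; apply (Z.mul_pos_cancel_r v (den o)); lia. }
destruct (usable_represents hs n0 husable) as (f & hf & X & Y & Z0 & hval).
destruct (in_combine_l hlen hf) as (ts & hts).
set (A := total a) in *.
assert (A0 : 0 < A) by (unfold A, total; lia).
(* This is the norm required of [w], with [3 m = 2 N + b]; adding [A k^2 b^2] leaves [k^2 A^2 m],
   the divisibility assumed for boxes. *)
assert (hn : mul o * n = kk o * kk o * A * (A * m - b * b)).
{ apply (Z.mul_reg_l _ _ 3); [lia|].
  replace (3 * (mul o * n)) with (3 * mul o * num o * v) by (unfold n; ring).
  rewrite <- hrat; replace (kk o * kk o * A * den o * v) with (kk o * kk o * A * (v * den o)) by ring.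
  rewrite <- hv; unfold F; rewrite hm; ring. }
destruct (@box_sound a o f ts n b X Y Z0) with (box := box) as (t & ht & i1 & i2 & i3 & i0).
- exact hval.
- fold A; rewrite hn; exists m; ring.
- rewrite forallb_forall in hb; exact (hb _ hbox).
- exact hts.
- exact hadm.
- rewrite forallb_forall in hsim; specialize (hsim _ hts); cbn [fst snd] in hsim.
  rewrite forallb_forall in hsim; specialize (hsim t ht).
  apply similitude_norm with (x := X) (y := Y) (z := Z0) in hsim.
  rewrite hval, hn in hsim.
  fold A in i0, i1, i2, i3.
  destruct i0 as [x0 e0]; destruct i1 as [x1 e1]; destruct i2 as [x2 e2]; destruct i3 as [x3 e3].
  set (w1 := lin1 t X Y Z0) in *; set (w2 := lin2 t X Y Z0) in *; set (w3 := lin3 t X Y Z0) in *.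
  set (w0 := lin0 a t X Y Z0) in *.
  assert (hw0 : w0 = - (co1 a * w1 + co2 a * w2 + co3 a * w3)) by reflexivity; clearbody w0 w1 w2 w3.
  set (q := kk o * A) in *.
  assert (q0 : 0 < q) by (apply Z.mul_pos_pos; assumption).
  assert (hA : A = 1 + co1 a + co2 a + co3 a) by reflexivity.
  exists x0, x1, x2, x3; unfold weighted.
  assert (hb' : x0 + co1 a * x1 + co2 a * x2 + co3 a * x3 = b).
  { apply (Z.mul_reg_r _ _ q); [lia|].
    replace ((x0 + co1 a * x1 + co2 a * x2 + co3 a * x3) * q)
      with (x0 * q + co1 a * (x1 * q) + co2 a * (x2 * q) + co3 a * (x3 * q)) by ring.
    rewrite <- e0, <- e1, <- e2, <- e3, hw0; unfold q; rewrite hA; ring. }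
  split; [exact hb'|].
  assert (hm' : x0 * x0 + co1 a * (x1 * x1) + co2 a * (x2 * x2) + co3 a * (x3 * x3) = m).
  { apply (Z.mul_reg_r _ _ (q * q)); [lia|].
    transitivity ((x0 * q) * (x0 * q) + co1 a * ((x1 * q) * (x1 * q)) + co2 a * ((x2 * q) * (x2 * q))
      + co3 a * ((x3 * q) * (x3 * q))); [ring|].
    rewrite <- e0, <- e1, <- e2, <- e3.
    transitivity (kk o * kk o * b * b * (1 + co1 a + co2 a + co3 a)
      + 2 * kk o * b * (w0 + (co1 a * w1 + co2 a * w2 + co3 a * w3))
      + (w0 * w0 + co1 a * (w1 * w1) + co2 a * (w2 * w2) + co3 a * (w3 * w3))); [ring|].
    rewrite hsim, hw0, <- hA; unfold q; ring. }
  rewrite hm', hm; ring.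
Qed.

Theorem cert_sound c N : cert_ok c = true -> start c <= N -> zmem (N mod cmod c) (creq c) = true ->
  exists w x y z, 0 <= w /\ 0 <= x /\ 0 <= y /\ 0 <= z /\
    weighted (co c) (3 * (w * w) - w) (3 * (x * x) - x) (3 * (y * y) - y) (3 * (z * z) - z) = 2 * N.
Proof.
unfold cert_ok; rewrite !andb_true_iff, !Z.ltb_lt.
intros [[[[[[[[a1 a2] a3] g0] m0] hthr] hpl] hcm] hcov] hN hreq.
destruct (threshold_window a1 a2 a3 g0 hthr hN) as (c' & hc & hwin).
rewrite forallb_forall in hcov; apply zmemP in hreq; specialize (hcov _ hreq).
rewrite existsb_exists in hcov; destruct hcov as (o & ho & hcls).
rewrite forallb_forall in hpl, hcm; specialize (hpl o ho); specialize (hcm o ho).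
rewrite eqb_mod_divide in hcm.
assert (dN : (cmod c | N mod cmod c - N)) by (exists (- (N / cmod c)); rewrite (Z.div_mod N (cmod c)) at 2 by lia; ring).
rewrite (mod_shift (Z.divide_trans _ _ _ hcm dN)) in hcls.
destruct (@plan_window (co c) (gap c) o N (c' + 1) hpl hcls) as (b & hb & hsuit).
destruct (hwin b hb) as [hF hpos].
destruct (@plan_solves (co c) (gap c) o N b) as (w & x & y & z & e1 & e2); try assumption.
set (A := total (co c)) in *; set (m := weighted _ _ _ _ _) in e2.
assert (hA : A = 1 + co1 (co c) + co2 (co c) + co3 (co c)) by reflexivity.
assert (hAb : 0 < A + b).
{ unfold threshold_ok in hthr; rewrite !andb_true_iff, !Z.leb_le in hthr; lia. }
assert (hlt : (A - 1) * (A * m - b * b) < (A + b) * (A + b)).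
{ apply (Z.mul_lt_mono_pos_l 3); [lia|].
  replace (3 * ((A - 1) * (A * m - b * b))) with ((A - 1) * (A * (3 * m) - 3 * (b * b))) by ring.
  rewrite e2; exact hpos. }
exists w, x, y, z; unfold weighted in *.
split; [|split; [|split; [|split]]].
(* Each coordinate in turn takes the distinguished place of the lemma. *)
- apply (@cauchy_nonneg 1 (co1 (co c)) (co2 (co c)) (co3 (co c)) w x y z A b m); try lia; unfold m; lia.
- apply (@cauchy_nonneg (co1 (co c)) 1 (co2 (co c)) (co3 (co c)) x w y z A b m); try lia; unfold m; lia.
- apply (@cauchy_nonneg (co2 (co c)) 1 (co1 (co c)) (co3 (co c)) y w x z A b m); try lia; unfold m; lia.
- apply (@cauchy_nonneg (co3 (co c)) 1 (co1 (co c)) (co2 (co c)) z w x y A b m); try lia; unfold m; lia.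
- transitivity (3 * m - b); [unfold m; rewrite <- e1; ring|lia].
Qed.

End Certificate.

End Certificates.

From mathcomp Require Import all_boot all_order all_algebra all_solvable realalg.
From mathcomp Require Import zify.
From mathcomp Require ring lra.
Require Import Defs.
Set Implicit Arguments. Unset Strict Implicit. Unset Printing Implicit Defensive.
Local Open Scope nat_scope.

(** * The Jacobi symbol *)

Section Jacobi.
Import GRing.Theory.

(** Gauss's lemma in Schering's form: for odd [m] prime to [a] this parity is the Jacobi symbol of
    [a] over [m], with [true] for [-1]. *)
Definition gs (a m : nat) : bool :=
  \big[addb/false]_(1 <= k < (m./2).+1) (m./2 < (a * k) %% m).

Definition absres (m x : nat) : nat := if m./2 < x %% m then m - x %% m else x %% m.

Lemma gs_mod a m : gs (a %% m) m = gs a m.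
Proof. by apply: eq_bigr => k _; rewrite modnMml. Qed.

Lemma gs_eqmod a b m : a = b %[mod m] -> gs a m = gs b m.
Proof. by move=> h; rewrite -gs_mod h gs_mod. Qed.

Lemma coprime_mulmod_neq0 a m k :
  coprime a m -> 0 < k < m -> (a * k) %% m != 0.
Proof.
move=> ca /andP[k0 km]; apply/negP => /dvdnP[q e].
have : m %| k by rewrite -(Gauss_dvdr (n := a)) ?e ?dvdn_mull // coprime_sym.
by move/(dvdn_leq k0); lia.
Qed.

Lemma absres_range m x : odd m -> x %% m != 0 -> 0 < absres m x < (m./2).+1.
Proof.
move=> om x0; have mp : 0 < m by case: m om x0.
have := ltn_pmod x mp; rewrite /absres; case: ifP => h1 h2; lia.
Qed.

Lemma absres_perm a m : odd m -> coprime a m ->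
  perm_eq [seq absres m (a * k) | k <- index_iota 1 (m./2).+1] (index_iota 1 (m./2).+1).
Proof.
move=> om ca.
have mp : 0 < m by case: m om {ca}.
have inj : {in index_iota 1 (m./2).+1 &, injective (fun k => absres m (a * k))}.
  move=> i j; rewrite !mem_index_iota => hi hj e.
  have i0 : (a * i) %% m != 0 by apply: coprime_mulmod_neq0 => //; lia.
  have j0 : (a * j) %% m != 0 by apply: coprime_mulmod_neq0 => //; lia.
  have li := ltn_pmod (a * i) mp; have lj := ltn_pmod (a * j) mp.
  have : (a * i) %% m = (a * j) %% m \/ (a * i) %% m + (a * j) %% m = m.
    by move: e; rewrite /absres; case: ifP; case: ifP => *; lia.
  case=> [e1|e1].
    have : a * i == a * j %[mod m] by apply/eqP.
    wlog ij : i j {hi e i0 li e1} hj {j0 lj} / i <= j => [hw|].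
      case: (leqP i j) => ij h; first exact: hw.
      by apply/esym/hw; [lia | lia | rewrite eq_sym].
    rewrite eq_sym eqn_mod_dvd ?leq_mul // -mulnBr Gauss_dvdr; last by rewrite coprime_sym.
    case: (posnP (j - i)) => [|p]; first lia.
    by move/(dvdn_leq p); lia.
  have : m %| a * (i + j).
    by rewrite mulnDr /dvdn -modnDm e1 modnn.
  rewrite Gauss_dvdr; last by rewrite coprime_sym.
  by move/dvdn_leq; lia.
have un : uniq [seq absres m (a * k) | k <- index_iota 1 (m./2).+1].
  by rewrite map_inj_in_uniq ?iota_uniq.
apply: uniq_perm => //; first exact: iota_uniq.
have sub : {subset [seq absres m (a * k) | k <- index_iota 1 (m./2).+1] <= index_iota 1 (m./2).+1}.
  move=> x /mapP[k]; rewrite mem_index_iota => hk ->; rewrite mem_index_iota.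
  by apply: absres_range => //; apply: coprime_mulmod_neq0 => //; lia.
have [|_ e] := uniq_min_size un sub; first by rewrite size_map.
exact: e.
Qed.

(** The sign attached to [a b k] is that of [b k] times that of [a] times the absolute residue of
    [b k]; by [absres_perm] those residues run once through the half system. *)
Lemma gs_mul a b m : odd m -> coprime a m -> coprime b m ->
  gs (a * b) m = gs a m (+) gs b m.
Proof.
move=> om ca cb; have mp : 0 < m by case: m om {ca cb}.
rewrite /gs addbC -[X in _ = _ (+) X](perm_big _ (absres_perm om cb)) big_map -big_split /=.
rewrite [LHS]big_seq [RHS]big_seq; apply: eq_bigr => k; rewrite mem_index_iota => hk.
have k0 : (b * k) %% m != 0 by apply: coprime_mulmod_neq0 => //; lia.
have hr := absres_range om k0.
have r0 : (a * absres m (b * k)) %% m != 0 by apply: coprime_mulmod_neq0 => //; lia.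
have lr := ltn_pmod (a * absres m (b * k)) mp.
rewrite -mulnA -modnMmr; move: r0 lr; rewrite /absres; case: ifP => h //.
set x := (b * k) %% m in h *; have xm : x < m by rewrite ltn_pmod.
move=> r0 lr; have e : m %| (a * x) %% m + (a * (m - x)) %% m.
  by rewrite /dvdn modnDm -mulnDr subnKC ?modnMl // ltnW.
have lx := ltn_pmod (a * x) mp.
clearbody x; clear hr k0 xm cb ca hk.
move: e r0 lr lx; move: ((a * x) %% m) ((a * (m - x)) %% m) => y z /dvdnP[q e] r0 lr lx.
have e1 : y + z = m by case: q e => [|[|q]]; nia.
lia.
Qed.

Lemma gs_pred m : odd m -> gs m.-1 m = odd m./2.
Proof.
move=> om; have mp : 0 < m by case: m om.
rewrite /gs (eq_big_nat _ _ (F2 := fun=> true)) => [|k hk].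
  rewrite big_const_nat subSS subn0.
  by elim: (m./2) => //= n ->.
have : (m.-1 * k) %% m = m - k.
  have -> : m.-1 * k = (k.-1) * m + (m - k) by nia.
  by rewrite modnMDl modn_small //; lia.
by move=> ->; lia.
Qed.

Lemma odd_sum (I : Type) (r : seq I) (F : I -> nat) :
  odd (\sum_(i <- r) F i) = \big[addb/false]_(i <- r) odd (F i).
Proof. exact: (big_morph odd oddD). Qed.

(** For [k <= h] the product [2 k] does not wrap around, so the [k] between [h / 2] and [h] are
    counted. *)
Lemma gs_two m : odd m -> gs 2 m = (m %% 8 \in [:: 3; 5]).
Proof.
move=> om; rewrite /gs; set h := m./2.
have e : \big[addb/false]_(1 <= k < h.+1) (h < (2 * k) %% m) =
         \big[addb/false]_(1 <= k < h.+1) (h./2 < k).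
  by apply: eq_big_nat => k hk; rewrite modn_small; lia.
rewrite e (@big_cat_nat _ _ _ h./2.+1) //=; last lia.
rewrite (eq_big_nat _ _ (F2 := fun=> false)); last by move=> k; lia.
rewrite big1_eq /= (eq_big_nat _ _ (F2 := fun=> true)); last by move=> k; lia.
rewrite big_const_nat subSS.
have -> : iter (h - h./2) (addb true) false = odd (h - h./2).
  by elim: (h - _) => //= n ->.
rewrite !inE /h; lia.
Qed.

(** Eisenstein's step: modulo 2, [k] is the quotient of [a k] by [m] plus the remainder, and the
    remainder is the absolute residue plus the sign bit. Summing over [k], the absolute residues
    cancel against the [k]. *)
Lemma gs_floor a m : odd m -> odd a -> coprime a m ->
  gs a m = odd (\sum_(1 <= k < (m./2).+1) (a * k) %/ m).
Proof.
move=> om oa ca; have mp : 0 < m by case: m om {ca}.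
rewrite odd_sum /gs.
have e : \big[addb/false]_(1 <= k < (m./2).+1) odd k =
  \big[addb/false]_(1 <= k < (m./2).+1)
    (odd ((a * k) %/ m) (+) ((m./2 < (a * k) %% m) (+) odd (absres m (a * k)))).
  apply: eq_big_nat => k hk.
  have : odd (a * k) = odd k by rewrite oddM oa.
  have le := ltn_pmod (a * k) mp.
  rewrite {1}(divn_eq (a * k) m) oddD oddM om andbT => <-; congr addb.
  by rewrite /absres; case: ifP => h; rewrite //= oddB ?om 1?ltnW //=; case: odd.
move: e; rewrite !big_split /=.
rewrite -(big_map (fun k => absres m (a * k)) xpredT odd) (perm_big _ (absres_perm om ca)) /=.
set A := \big[_/_]_(_ <= i < _) odd i; set B := \big[_/_]_(_ <= _ < _) _; set C := \big[_/_]_(_ <= _ < _) _.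
by case: A; case: B; case: C.
Qed.

Lemma divn_count a m k : odd m -> odd a -> coprime a m -> 0 < k < (m./2).+1 ->
  (a * k) %/ m = \sum_(1 <= j < (a./2).+1) (m * j < a * k).
Proof.
move=> om oa ca hk; have mp : 0 < m by case: m om {ca hk}.
set q := (a * k) %/ m; have eq := divn_eq (a * k) m; have lt := ltn_pmod (a * k) mp.
have n0 : (a * k) %% m != 0 by apply: coprime_mulmod_neq0 => //; lia.
rewrite -/q in eq.
have qh : q < (a./2).+1 by nia.
rewrite (@big_cat_nat _ _ _ q.+1) //=.
rewrite (eq_big_nat _ _ (F2 := fun=> 1)); last by move=> j hj; apply/eqP; rewrite eqb1; nia.
rewrite [X in _ + X](eq_big_nat _ _ (F2 := fun=> 0)); last by move=> j hj; apply/eqP; rewrite eqb0; nia.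
by rewrite !sum_nat_const_nat muln0 addn0 muln1 subn1.
Qed.

(** The two floor sums count the lattice points of a rectangle on either side of its diagonal, which
    carries none since [a] and [m] are coprime. *)
Lemma gs_recip a m : odd m -> odd a -> coprime a m ->
  gs a m (+) gs m a = odd m./2 && odd a./2.
Proof.
move=> om oa ca; have cm : coprime m a by rewrite coprime_sym.
rewrite !gs_floor // -oddD -oddM; congr odd.
rewrite (eq_big_nat _ _ (F2 := fun k => \sum_(1 <= j < (a./2).+1) (m * j < a * k))); last first.
  by move=> k hk; apply: divn_count.
rewrite [X in _ + X](eq_big_nat _ _ (F2 := fun j => \sum_(1 <= k < (m./2).+1) (a * k < m * j))); last first.
  by move=> k hk; apply: divn_count.
rewrite [X in _ + X]exchange_big_nat /= -big_split /=.
rewrite (eq_big_nat _ _ (F2 := fun=> a./2)); first by rewrite sum_nat_const_nat subSS subn0.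
move=> k hk; rewrite -big_split /= (eq_big_nat _ _ (F2 := fun=> 1)).
  by rewrite sum_nat_const_nat subSS subn0 muln1.
move=> j hj.
have ne : m * j != a * k.
  apply/eqP => e; have : m %| k by rewrite -(Gauss_dvdr (n := a)) // -e dvdn_mulr.
  by move/dvdn_leq; lia.
case: (ltngtP (m * j) (a * k)) ne => //; lia.
Qed.

Lemma half_odd_mul m n : odd m -> odd n -> odd (m * n)./2 = odd m./2 (+) odd n./2.
Proof.
move=> om on.
have em : m = (m./2).*2.+1 by lia. have en : n = (n./2).*2.+1 by lia.
rewrite {1}em {1}en.
have -> : ((m./2).*2.+1 * (n./2).*2.+1)./2 = (m./2 * n./2).*2 + m./2 + n./2 by nia.
by rewrite !oddD odd_double.
Qed.

(** Comparing the product of the [a k] with that of their absolute residues gives [a ^ h = 1] in the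
    field, [h = (q - 1) / 2]. The [h] squares are already roots of [X^h - 1], so a non-square [a]
    would be one root too many. *)
Lemma gs_square a q : prime q -> odd q -> coprime a q -> gs a q = false ->
  exists x, x * x = a %[mod q].
Proof.
move=> pq oq ca g.
have q1 := prime_gt1 pq.
have eFp : forall x y : nat, (x%:R == y%:R :> 'F_q)%R = (x == y %[mod q]).
  move=> x y; apply/idP/idP => [/eqP e|/eqP e].
    by apply/eqP; have := congr1 val e; rewrite /= !val_Fp_nat.
  by apply/eqP/val_inj; rewrite /= !val_Fp_nat.
set h := q./2.
have nz k : 0 < k < h.+1 -> (k%:R != 0 :> 'F_q)%R.
  move=> hk; apply/negP; rewrite -[0%R]/(0%:R)%R eFp mod0n -/(q %| k) => d.
  by have := dvdn_leq _ d; rewrite /h in hk; lia.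
have pw : (a%:R ^+ h = 1 :> 'F_q)%R.
  have : (\prod_(1 <= k < h.+1) (a * k)%:R = \prod_(1 <= k < h.+1) k%:R :> 'F_q)%R.
    rewrite -[RHS](perm_big _ (absres_perm oq ca)) big_map.
    have -> : (\prod_(1 <= k < h.+1) (a * k)%:R =
               \prod_(1 <= k < h.+1) ((-1) ^+ (h < (a * k) %% q)%N * (absres q (a * k))%:R) :> 'F_q)%R.
      apply: eq_big_nat => k hk; rewrite /absres -/h.
      have e : ((a * k)%:R = ((a * k) %% q)%:R :> 'F_q)%R by apply/eqP; rewrite eFp modn_mod.
      rewrite e; case: ifP => _; last by rewrite mul1r.
      rewrite expr1 mulN1r natrB; last by rewrite ltnW // ltn_pmod // ltnW.
      by rewrite opprB (_ : q%:R = 0)%R ?subr0 //; apply/eqP; rewrite -[0%R]/(0%:R)%R eFp modnn mod0n.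
    rewrite big_split /= -[RHS]mul1r; congr (_ * _)%R.
    have -> : (\prod_(1 <= k < h.+1) (-1) ^+ (h < (a * k) %% q)%N = (-1) ^+ gs a q :> 'F_q)%R.
      rewrite /gs -/h; elim/big_rec2: _ => [|k b y _ ->]; first by rewrite expr0.
      by rewrite signr_addb.
    by rewrite g.
  have n0 : (\prod_(1 <= k < h.+1) k%:R != 0 :> 'F_q)%R.
    rewrite prodf_seq_neq0; apply/allP => k; rewrite mem_index_iota => hk /=; exact: nz.
  rewrite (eq_big_nat _ _ (F2 := fun k => a%:R * k%:R)%R); last by move=> k _; rewrite natrM.
  rewrite big_split /= prodr_const_nat subn1 /= -[RHS]mul1r.
  by move/(mulIf n0).
pose s := [seq (k * k)%:R%R : 'F_q | k <- index_iota 1 h.+1].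
have us : uniq s.
  rewrite map_inj_in_uniq ?iota_uniq // => i j; rewrite !mem_index_iota => hi hj /eqP.
  rewrite !natrM -subr_eq0 -!expr2 subr_sqr mulf_eq0 subr_eq0 => /orP[|].
    rewrite eFp; rewrite !modn_small; [by move/eqP | rewrite /h in hj; lia | rewrite /h in hi; lia].
  rewrite -natrD -[0%R]/(0%:R)%R eFp mod0n modn_small; rewrite /h in hi hj; lia.
case: (boolP ((a%:R)%R \in s)) => [/mapP[k _ /eqP]|nin].
  by rewrite eFp => /eqP e; exists k; rewrite e.
have h0 : (0 < h)%N by rewrite /h; lia.
have : (size ((a%:R)%R :: s) < (h.+1))%N.
  have <- : size ('X^h - 1%:P : {poly 'F_q})%R = h.+1 by rewrite size_XnsubC.
  apply: max_poly_roots.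
  - by rewrite -size_poly_eq0 size_XnsubC.
  - apply/allP => x; rewrite inE rootE !hornerE => /orP[/eqP->|]; first by rewrite pw subrr.
    case/mapP => k; rewrite mem_index_iota => hk ->.
    rewrite natrM -expr2 -exprM mul2n.
    have -> : h.*2 = q.-1 by rewrite /h; lia.
    have -> : (k%:R ^+ q.-1 = 1 :> 'F_q)%R; last by rewrite subrr.
    by apply/eqP; rewrite -natrX -[1%R]/(1%:R)%R eFp -totient_prime // Euler_exp_totient //
       coprime_sym prime_coprime //; apply/negP => /dvdn_leq; rewrite /h in hk; lia.
  - by rewrite /= nin.
by rewrite /= size_map size_iota /=; lia.
Qed.

(* [chi N m] is [true] when the Jacobi symbol of [- N] over [m] is [-1]. *)
Definition chi (N m : nat) : bool := odd m./2 (+) gs N m.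

Lemma odd_half_mod8 m : odd m./2 = (m %% 8 \in [:: 2; 3; 6; 7]).
Proof. rewrite !inE; lia. Qed.

Lemma odd_mod8 m : odd (m %% 8) = odd m.
Proof. lia. Qed.

Lemma coprime_two m : coprime 2 m = odd m.
Proof. by rewrite prime_coprime // dvdn2 negbK. Qed.

Lemma gs_exp2 e m : odd m -> gs (2 ^ e) m = odd e && gs 2 m.
Proof.
move=> om; elim: e => [|e IH].
  rewrite expn0 /= /gs big_nat_cond big1 // => k /andP[hk _].
  by rewrite mul1n modn_small; lia.
rewrite expnS gs_mul ?coprimeXl ?coprime_two // IH /=.
by case: (odd e); case: gs.
Qed.

Lemma chi_modulus N : 0 < N -> exists e r, [/\ odd r, N = 2 ^ e * r &
  forall m, odd m -> coprime N m -> chi N m =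
    odd m./2 (+) ((odd e && gs 2 m) (+) (gs m r (+) (odd m./2 && odd r./2)))].
Proof.
move=> N0; exists (logn 2 N), (N`_2^'); split.
- have := part_pnat 2^' N; case: (boolP (odd N`_2^')) => // e.
  by rewrite p'natE // dvdn2 e.
- by rewrite -p_part partnC.
move=> m om cN; rewrite /chi; congr addb.
have eN : N = 2 ^ logn 2 N * N`_2^' by rewrite -p_part partnC.
have or : odd N`_2^'.
  have := part_pnat 2^' N; case: (boolP (odd N`_2^')) => // e.
  by rewrite p'natE // dvdn2 e.
have cr : coprime N`_2^' m by move: cN; rewrite {1}eN coprimeMl => /andP[].
rewrite {1}eN gs_mul ?coprimeXl ?coprime_two // gs_exp2 //; congr addb.
by rewrite -(gs_recip om or cr); case: (gs _ m); case: (gs m _).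
Qed.

Lemma chi_mul N m n : 0 < N -> odd m -> odd n -> coprime N m -> coprime N n ->
  chi N (m * n) = chi N m (+) chi N n.
Proof.
move=> N0 om on cm cn; have [e [r [or eN H]]] := chi_modulus N0.
have cr k : coprime N k -> coprime k r.
  by rewrite coprime_sym eN coprimeMr => /andP[].
rewrite !H ?oddM ?om ?on ?coprimeMr ?cm ?cn // gs_mul ?cr // half_odd_mul //.
have -> : gs 2 (m * n) = gs 2 m (+) gs 2 n.
  rewrite !gs_two ?oddM ?om ?on // -modnMm.
  have hm : m %% 8 \in [:: 1; 3; 5; 7] by clear -om; rewrite !inE; lia.
  have hn : n %% 8 \in [:: 1; 3; 5; 7] by clear -on; rewrite !inE; lia.
  by move: hm hn; rewrite !inE => /or4P[] /eqP-> /or4P[] /eqP->.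
by case: (odd m./2); case: (odd n./2); case: (odd e); case: (odd _);
   case: (gs 2 m); case: (gs 2 n); case: (gs m r); case: (gs n r).
Qed.

Lemma chi_eqmod N m n : 0 < N -> odd m -> coprime N m -> m = n %[mod 8 * N] ->
  chi N m = chi N n.
Proof.
move=> N0 om cm emn; have [e [r [or eN H]]] := chi_modulus N0.
have e8 : m = n %[mod 8].
  by rewrite -(modn_dvdm m (dvdn_mulr N (dvdnn 8))) emn modn_dvdm // dvdn_mulr.
have eN' : m = n %[mod N].
  by rewrite -(modn_dvdm m (dvdn_mull 8 (dvdnn N))) emn modn_dvdm // dvdn_mull.
have on : odd n by rewrite -odd_mod8 -e8 odd_mod8.
have cn : coprime N n by rewrite -coprime_modr -eN' coprime_modr.
rewrite !H // !gs_two // e8 (gs_eqmod (a := m) (b := n)).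
  by rewrite !odd_half_mod8 e8.
have rN : r %| N by rewrite eN dvdn_mull.
by rewrite -(modn_dvdm m rN) eN' modn_dvdm.
Qed.

(** The character of [- N] is odd: it takes the value [-1] at [-1]. *)
Lemma chi_m1 N m : 0 < N -> m.+1 = 0 %[mod 8 * N] -> chi N m = true.
Proof.
move=> N0 em; have [e [r [or eN H]]] := chi_modulus N0.
have d8 : 8 * N %| m.+1 by rewrite /dvdn em mod0n.
have e8 : 8 %| m.+1 by apply: dvdn_trans d8; rewrite dvdn_mulr.
have dN : N %| m.+1 by apply: dvdn_trans d8; rewrite dvdn_mull.
have m8 : m %% 8 = 7 by clear -e8; lia.
have om : odd m by rewrite -odd_mod8 m8.
have cm : coprime N m.
  by apply: coprime_dvdl dN _; rewrite coprime_sym coprimenS.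
rewrite H // gs_two // (gs_eqmod (a := m) (b := r.-1)).
  by rewrite gs_pred // odd_half_mod8 m8 /= andbF; case: (odd r./2).
have dr : r %| m.+1 by apply: dvdn_trans dN; rewrite eN dvdn_mull.
have r0 : 0 < r by case: r or {eN H dr}.
by apply/eqP; rewrite -(eqn_modDr 1) !addn1 prednK // modnn.
Qed.

Lemma chi_1 N m : 0 < N -> m = 1 %[mod 8 * N] -> chi N m = false.
Proof.
move=> N0 em; have c1 : coprime N 1 by rewrite coprimen1.
by rewrite -(chi_eqmod N0 (m := 1)) // /chi /= /gs big_nil.
Qed.

Lemma chi_square N q : prime q -> odd q -> coprime N q -> chi N q = false ->
  exists x, q %| x * x + N.
Proof.
move=> pq oq cN h; have q0 := prime_gt0 pq.
have c1 : coprime q.-1 q by rewrite -{2}(prednK q0) coprimenS.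
(* [q.-1 * N] represents [- N] modulo [q]. *)
have [||||x ex] := @gs_square (q.-1 * N) q => //.
- by rewrite coprimeMl c1.
- by rewrite gs_mul // gs_pred // -[LHS]/(chi N q).
exists x; rewrite /dvdn -modnDml ex modnDml.
have -> : q.-1 * N + N = q * N by rewrite -{2}(prednK q0) mulSn addnC.
by rewrite modnMr.
Qed.

End Jacobi.

(** * Divisor sums of a real character *)

Section DivisorSums.
Import mathcomp.algebra_tactics.ring mathcomp.algebra_tactics.lra Order.TTheory GRing.Theory Num.Theory.
Local Open Scope ring_scope.

Section PeriodicSums.
Variable F : rcfType.
Implicit Types (h w : nat -> F) (C B : F).

Lemma abel_bound h w C x y : (x <= y)%N ->
  (forall k, (x <= k <= y)%N -> `|\sum_(x <= j < k) h j| <= C) ->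
  (forall k, (x <= k)%N -> w k.+1 <= w k) -> (forall k, (x <= k)%N -> 0 <= w k) ->
  `|\sum_(x <= j < y) h j * w j| <= C * w x.
Proof.
move=> xy hC wd w0.
have C0 : 0 <= C by apply: le_trans (hC x _); rewrite ?normr_ge0 // leqnn.
(* With the boundary term of the partial summation removed, the bound telescopes and can be proved
   by induction on [y]. *)
suff : `|\sum_(x <= j < y) h j * w j - (\sum_(x <= j < y) h j) * w y| <= C * (w x - w y).
  move=> hd; have h2 : `|(\sum_(x <= j < y) h j) * w y| <= C * w y.
    by rewrite normrM (ger0_norm (w0 _ xy)) ler_wpM2r ?w0 // hC // xy leqnn.
  have := ler_normD (\sum_(x <= j < y) h j * w j - (\sum_(x <= j < y) h j) * w y)
                   ((\sum_(x <= j < y) h j) * w y).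
  rewrite subrK => /le_trans; apply; rewrite (_ : C * w x = C * (w x - w y) + C * w y).
    exact: lerD.
  by rewrite mulrBr subrK.
elim: y xy hC => [|y IH] xy hC.
  by move: xy; rewrite leqn0 => /eqP->; rewrite !big_nil mul0r !subrr mulr0 normr0.
move: xy; rewrite leq_eqVlt => /orP[/eqP->|]; first by rewrite !big_geq // mul0r !subrr mulr0 normr0.
rewrite ltnS => xy.
have {}IH : `|\sum_(x <= j < y) h j * w j - (\sum_(x <= j < y) h j) * w y| <= C * (w x - w y).
  by apply: IH => // k /andP[h1 h2]; apply: hC; rewrite h1 leqW.
have -> : \sum_(x <= j < y.+1) h j * w j - (\sum_(x <= j < y.+1) h j) * w y.+1 =
  (\sum_(x <= j < y) h j * w j - (\sum_(x <= j < y) h j) * w y) +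
  (\sum_(x <= j < y.+1) h j) * (w y - w y.+1).
  by rewrite !big_nat_recr //=; ring.
apply: le_trans (ler_normD _ _) _.
rewrite (_ : C * (w x - w y.+1) = C * (w x - w y) + C * (w y - w y.+1)); last by ring.
apply: lerD => //; rewrite normrM (ger0_norm (x := w y - _)) ?subr_ge0 ?wd //.
by rewrite ler_wpM2r ?subr_ge0 ?wd //; apply: hC; rewrite leqnn leqW.
Qed.

Lemma sum_period h M x : (0 < M)%N -> (forall k, h (k + M)%N = h k) ->
  \sum_(x <= j < x + M) h j = \sum_(0 <= j < M) h j.
Proof.
move=> M0 hp; elim: x => [//|x <-].
rewrite addSn big_nat_recr /=; last by rewrite -addn1 leq_add2l.
rewrite [RHS]big_ltn; last by rewrite -[X in (X < _)%N]addn0 ltn_add2l.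
by rewrite hp addrC.
Qed.

Lemma periodic_bound h M B x y : (0 < M)%N -> (x <= y)%N ->
  (forall k, h (k + M)%N = h k) -> \sum_(0 <= j < M) h j = 0 ->
  (forall k, `|h k| <= B) -> `|\sum_(x <= j < y) h j| <= M%:R * B.
Proof.
move=> M0 /subnKC <-; move: (y - x)%N => n hp h0 hB.
have B0 : 0 <= B by apply: le_trans (hB 0%N).
elim/ltn_ind: n x => n IH x; case: (leqP M n) => Mn.
  rewrite (@big_cat_nat _ _ _ (x + M)) ?leq_addr ?leq_add2l //= sum_period // h0 add0r.
  rewrite -(subnKC Mn) addnA; apply: IH; lia.
apply: le_trans (ler_norm_sum _ _ _) _.
apply: le_trans (_ : \sum_(x <= j < x + n) B <= _); first exact: ler_sum.
by rewrite sumr_const_nat addKn -[leLHS]mulr_natl ler_wpM2r // ler_nat ltnW.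
Qed.

Lemma sum_mulmod (V : nmodType) (f : nat -> V) M d : (0 < M)%N -> coprime d M ->
  \sum_(0 <= e < M) f ((d * e) %% M)%N = \sum_(0 <= e < M) f e.
Proof.
move=> M0 cd; rewrite -(big_map (fun e => (d * e) %% M)%N xpredT f); apply: perm_big.
have inj : {in index_iota 0 M &, injective (fun e => (d * e) %% M)%N}.
  move=> i j; rewrite !mem_index_iota => /andP[_ hi] /andP[_ hj] /eqP e.
  wlog ij : i j hi hj e / (i <= j)%N => [hw|].
    case: (leqP i j) => ij; first exact: hw.
    by apply/esym/hw; [| | rewrite eq_sym | apply: ltnW].
  move: e; rewrite eq_sym eqn_mod_dvd ?leq_mul // -mulnBr Gauss_dvdr; last by rewrite coprime_sym.
  case: (posnP (j - i)) => [|p]; first lia.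
  by move/(dvdn_leq p); lia.
have un : uniq [seq ((d * e) %% M)%N | e <- index_iota 0 M] by rewrite map_inj_in_uniq ?iota_uniq.
have sub : {subset [seq ((d * e) %% M)%N | e <- index_iota 0 M] <= index_iota 0 M}.
  by move=> x /mapP[k _ ->]; rewrite mem_index_iota ltn_pmod.
apply: uniq_perm => //; first exact: iota_uniq.
have [|_ e] := uniq_min_size un sub; first by rewrite size_map.
exact: e.
Qed.

Lemma sum_multiples (V : nmodType) (f : nat -> V) d Z : (0 < d)%N ->
  \sum_(1 <= m < Z.+1 | (d %| m)%N) f m = \sum_(1 <= e < (Z %/ d).+1) f (d * e)%N.
Proof.
move=> d0; elim: Z => [|Z IH]; first by rewrite div0n !big_geq.
rewrite big_mkcond big_nat_recr //= -big_mkcond IH divnS //.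
case: ifP => hd; last by rewrite addr0.
rewrite add1n [RHS]big_nat_recr //= addrC [RHS]addrC; congr (f _ + _).
rewrite -{1}(divnK hd) divnS // hd mulnC; lia.
Qed.

End PeriodicSums.

Section ResidueClass.
Variable F : rcfType.

(** The weight [1 / sqrt m] is multiplicative, turns the squares into the harmonic series, and
    decays fast enough for the hyperbola method to give a bound independent of [Y]. *)
Definition rsqrt (k : nat) : F := (Num.sqrt k%:R)^-1.

Lemma rsqrt_ge0 k : 0 <= rsqrt k.
Proof. by rewrite invr_ge0 sqrtr_ge0. Qed.

Lemma rsqrt_le k l : (0 < k)%N -> (k <= l)%N -> rsqrt l <= rsqrt k.
Proof.
move=> k0 kl; rewrite lef_pV2 ?posrE ?sqrtr_gt0 ?ltr0n ?(leq_trans k0) //.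
by rewrite ler_wsqrtr // ler_nat.
Qed.

Lemma rsqrtM k l : rsqrt (k * l) = rsqrt k * rsqrt l.
Proof. by rewrite /rsqrt natrM sqrtrM ?ler0n // invfM. Qed.

Lemma rsqrt_sqr k : rsqrt (k * k) = k%:R^-1.
Proof. by rewrite /rsqrt natrM -expr2 sqrtr_sqr ger0_norm. Qed.

Lemma sum_rsqrt Y : \sum_(1 <= e < Y.+1) rsqrt e <= 2 * Num.sqrt Y%:R.
Proof.
elim: Y => [|Y IH]; first by rewrite big_geq // mulr_ge0 // sqrtr_ge0.
rewrite big_nat_recr //=; apply: le_trans (lerD IH (lexx _)) _.
have s1 : 0 < Num.sqrt (Y.+1%:R : F) by rewrite sqrtr_gt0.
have s2 : Num.sqrt (Y%:R : F) ^+ 2 = Y%:R by rewrite sqr_sqrtr.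
have s3 : Num.sqrt (Y.+1%:R : F) ^+ 2 = Y%:R + 1 by rewrite sqr_sqrtr // -natr1.
have s4 : 0 <= Num.sqrt (Y%:R : F) by rewrite sqrtr_ge0.
rewrite /rsqrt; set s := Num.sqrt _ in s2 s4 *; set t := Num.sqrt _ in s1 s3 *.
rewrite -(ler_pM2r s1) mulrDl mulVf ?gt_eqF //; nra.
Qed.

Lemma abel_rsqrt (h : nat -> F) C x y : (0 < x)%N -> (x <= y)%N ->
  (forall k, (x <= k)%N -> `|\sum_(x <= j < k) h j| <= C) ->
  `|\sum_(x <= j < y) h j * rsqrt j| <= C * rsqrt x.
Proof.
move=> x0 xy hC; apply: abel_bound => // [k /andP[h1 _]|k h1|k _].
- exact: hC.
- by apply: rsqrt_le; rewrite ?(leq_trans x0).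
- exact: rsqrt_ge0.
Qed.

Variables (M a : nat) (X : nat -> F).
Hypothesis M0 : (0 < M)%N.
Hypothesis aM : coprime a M.
Hypothesis X1 : X 1%N = 1.
Hypothesis XM : forall m n, X (m * n)%N = X m * X n.
Hypothesis Xmod : forall m, X (m %% M)%N = X m.
Hypothesis X0 : forall m, ~~ coprime m M -> X m = 0.
Hypothesis Xsqr : forall m, coprime m M -> X m * X m = 1.
Hypothesis Xa : X a = 1.

Definition divsum (m : nat) : F := \sum_(1 <= d < m.+1 | (d %| m)%N) X d.

(** Has mean zero over a period, and so does its product with [X], because [X a = X 1 = 1]. *)
Let u (m : nat) : F := (m == a %[mod M])%:R - (m == 1 %[mod M])%:R.

Let umod m : u (m %% M)%N = u m.
Proof. by rewrite /u modn_mod. Qed.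

Let u_norm m : `|u m| <= 1.
Proof.
rewrite /u; case: eqP; case: eqP => _ _; rewrite ?subrr ?normr0 ?ler01 ?subr0 ?sub0r ?normrN ?normr1 //.
Qed.

Let u_ncop m : ~~ coprime m M -> u m = 0.
Proof.
move=> h; have f b : coprime b M -> (m == b %[mod M]) = false.
  by move=> cb; apply: contraNF h => /eqP e; rewrite -coprime_modl e coprime_modl.
by rewrite /u !f ?subrr // coprime1n.
Qed.

Let X_norm m : `|X m| <= 1.
Proof.
case: (boolP (coprime m M)) => [/Xsqr h|/X0->]; last by rewrite normr0.
by rewrite -(@ler_pXn2r _ 2) ?nnegrE // expr1n -normrX expr2 h normr1.
Qed.

Let sum_eqmod b : \sum_(0 <= e < M) (e == b %[mod M])%:R = 1 :> F.
Proof.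
rewrite (bigD1_seq (b %% M)%N) ?iota_uniq ?mem_index_iota ?ltn_pmod //= modn_mod eqxx.
rewrite big_seq_cond big1 ?addr0 // => e /andP[]; rewrite mem_index_iota => /andP[_ he] ne.
by rewrite modn_small // (negPf ne).
Qed.

Let usum d : coprime d M -> \sum_(0 <= e < M) u (d * e)%N = 0.
Proof.
move=> cd; rewrite (eq_bigr (fun e => u ((d * e) %% M)%N)); last by move=> e _; rewrite umod.
rewrite sum_mulmod // /u sumrB (eq_bigr (fun e => (e == a %[mod M])%:R)) // sum_eqmod.
by rewrite (eq_bigr (fun e => (e == 1 %[mod M])%:R)) // sum_eqmod subrr.
Qed.

(** Multiplying by the unit [X e] and substituting [m = d e] turns the sum into that of [X m * u m],
    which is [X a - X 1 = 0]. *)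
Let Xusum e : \sum_(0 <= d < M) X d * u (d * e)%N = 0.
Proof.
case: (boolP (coprime e M)) => ce; last first.
  by apply: big1 => d _; rewrite u_ncop ?mulr0 // coprimeMl (negPf ce) andbF.
suff : X e * \sum_(0 <= d < M) X d * u (d * e)%N = 0.
  by move/(congr1 (fun z => X e * z)); rewrite mulrA Xsqr // mul1r mulr0.
rewrite mulr_sumr (eq_bigr (fun d => (fun m => X m * u m) ((e * d) %% M)%N)); last first.
  by move=> d _; rewrite mulrA -XM Xmod umod [(d * e)%N]mulnC.
rewrite (sum_mulmod (fun m => X m * u m) M0 ce) (eq_bigr (fun m => X a * (m == a %[mod M])%:R - X 1 * (m == 1 %[mod M])%:R)).
  by rewrite sumrB -!mulr_sumr !sum_eqmod !mulr1 Xa X1 subrr.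
move=> m _; rewrite mulrBr; congr (_ - _).
  by case: eqP => [e1|]; rewrite ?mulr0 // -[X m]Xmod e1 Xmod.
by case: eqP => [e1|]; rewrite ?mulr0 // -[X m]Xmod e1 Xmod.
Qed.

Let Xuper e k : X (k + M)%N * u ((k + M) * e)%N = X k * u (k * e)%N.
Proof.
rewrite -[X (k + M)%N]Xmod modnDr Xmod; congr (_ * _).
by rewrite -umod mulnDl addnC [(M * e)%N]mulnC modnMDl umod.
Qed.

Lemma divsum_weighted Z (v w : nat -> F) :
  \sum_(1 <= m < Z.+1) v m * divsum m * w m =
  \sum_(1 <= d < Z.+1) X d * \sum_(1 <= e < (Z %/ d).+1) v (d * e)%N * w (d * e)%N.
Proof.
transitivity (\sum_(1 <= m < Z.+1) \sum_(1 <= d < Z.+1) if (d %| m)%N then X d * (v m * w m) else 0).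
  apply: eq_big_nat => m /andP[m0 hm]; rewrite -big_mkcond mulrAC /divsum (big_nat_widen _ m.+1 Z.+1) //=.
  rewrite [LHS]mulr_sumr. apply: eq_big => [d|d _]; last by rewrite mulrC.
  by case: (boolP (d %| m)%N) => // /dvdn_leq h; rewrite ltnS h.
rewrite exchange_big_nat; apply: eq_big_nat => d /andP[hd _].
rewrite -big_mkcond /= -(sum_multiples (fun m => v m * w m)) // mulr_sumr.
by apply: eq_bigr.
Qed.

(* The hyperbola method: both divisor sums are split at [Y], and each inner
   sum runs over a periodic function of mean zero. *)
Lemma twisted_divsum_bound Y : (0 < Y)%N ->
  `|\sum_(1 <= m < (Y * Y).+1) u m * divsum m * rsqrt m| <= M%:R * M%:R + 3 * M%:R.
Proof.
move=> Y0; set Z := (Y * Y)%N.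
have Z0 : (0 < Z)%N by rewrite muln_gt0 Y0.
have YZ : (Y <= Z)%N by rewrite leq_pmulr.
have w1 : rsqrt 1 = 1 by rewrite /rsqrt sqrtr1 invr1.
have ub d x y : coprime d M -> (x <= y)%N -> `|\sum_(x <= e < y) u (d * e)%N| <= M%:R.
  move=> cd xy; rewrite -[leRHS]mulr1; apply: periodic_bound => // [k|].
    by rewrite -umod mulnDr addnC modnMDl umod.
  exact: usum.
have Xub e x y : (x <= y)%N -> `|\sum_(x <= d < y) X d * u (d * e)%N| <= M%:R.
  move=> xy; rewrite -[leRHS]mulr1; apply: periodic_bound => // k.
  by rewrite normrM mulr_ile1 ?normr_ge0.
(* For [d <= Y] the sum over [e <= Z / d] is the full sum [K d] minus the tail [T d]. The full sums,
   times [X d], are periodic in [d] with mean zero and give [M * M]; the [Y] tails give [M / Y]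
   each; the part [d > Y], summed over [d] first, gives [2 M]. *)
pose K d := \sum_(1 <= e < Z.+1) u (d * e)%N * rsqrt e.
pose T d := \sum_((Z %/ d).+1 <= e < Z.+1) u (d * e)%N * rsqrt e.
have XKb d : `|X d * K d| <= M%:R.
  case: (boolP (coprime d M)) => [cd|/X0->]; last by rewrite mul0r normr0.
  rewrite normrM -[leRHS]mul1r ler_pM ?normr_ge0 // /K.
  apply: le_trans (_ : M%:R * rsqrt 1 <= _); last by rewrite w1 mulr1.
  by apply: abel_rsqrt => // k h; apply: ub.
have XTb d : (0 < d)%N -> (d <= Y)%N -> `|X d * T d * rsqrt d| <= M%:R / Y%:R.
  move=> d0 dY; case: (boolP (coprime d M)) => [cd|/X0->]; last first.
    by rewrite !mul0r normr0 divr_ge0.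
  rewrite !normrM (ger0_norm (rsqrt_ge0 _)).
  have tb : `|T d| <= M%:R * rsqrt (Z %/ d).+1.
    by apply: abel_rsqrt => // [|k h]; [rewrite ltnS leq_div | apply: ub].
  apply: le_trans (_ : 1 * (M%:R * rsqrt (Z %/ d).+1) * rsqrt d <= _).
    by rewrite ler_wpM2r ?rsqrt_ge0 // ler_pM ?normr_ge0.
  rewrite mul1r -mulrA -rsqrtM ler_wpM2l // -rsqrt_sqr; apply: rsqrt_le => //.
  by rewrite ltnW // -ltn_divLR.
have e1 : \sum_(1 <= m < Z.+1) u m * divsum m * rsqrt m =
  \sum_(1 <= d < Y.+1) (X d * K d) * rsqrt d - \sum_(1 <= d < Y.+1) X d * T d * rsqrt d +
  \sum_(1 <= e < Y.+1) rsqrt e * \sum_(Y.+1 <= d < (Z %/ e).+1) X d * u (d * e)%N * rsqrt d.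
  rewrite divsum_weighted (@big_cat_nat _ _ _ Y.+1) //=; congr (_ + _).
    rewrite -sumrB; apply: eq_big_nat => d /andP[d0 _].
    rewrite -mulrBl -mulrBr -mulrA; congr (_ * _).
    rewrite /K /T (@big_cat_nat _ _ _ (Z %/ d).+1 1 Z.+1) //= ?ltnS ?leq_div // addrK mulr_suml.
    by apply: eq_bigr => e _; rewrite rsqrtM mulrAC mulrA.
  transitivity (\sum_(Y.+1 <= d < Z.+1) \sum_(1 <= e < Y.+1)
     if (d * e <= Z)%N then rsqrt e * (X d * u (d * e)%N * rsqrt d) else 0).
    apply: eq_big_nat => d /andP[hd _]; rewrite mulr_sumr.
    have d0 : (0 < d)%N by apply: leq_trans hd.
    rewrite (big_nat_widen _ _ Y.+1) /=; last first.
      by rewrite ltnS -ltnS ltn_divLR // -/Z /Z; nia.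
    rewrite -big_mkcond; apply: eq_big => e; first by rewrite ltnS leq_divRL // mulnC.
    by move=> _; rewrite rsqrtM; ring.
  rewrite exchange_big_nat; apply: eq_big_nat => e /andP[he he2].
  rewrite mulr_sumr [RHS](big_nat_widen _ _ Z.+1) /=; last by rewrite ltnS leq_div.
  by rewrite -big_mkcond; apply: eq_bigl => d; rewrite ltnS leq_divRL.
rewrite e1; apply: le_trans (ler_normD _ _) _.
rewrite (_ : M%:R * M%:R + 3 * M%:R = (M%:R * M%:R + M%:R) + 2 * M%:R); last by ring.
apply: lerD; last first.
  apply: le_trans (ler_norm_sum _ _ _) _.
  apply: le_trans (_ : \sum_(1 <= e < Y.+1) rsqrt e * (M%:R * (Num.sqrt Y%:R)^-1) <= _).
    rewrite big_nat_cond [leRHS]big_nat_cond; apply: ler_sum => e /andP[/andP[he he2] _].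
    rewrite normrM (ger0_norm (rsqrt_ge0 _)) ler_wpM2l ?rsqrt_ge0 //.
    apply: le_trans (_ : M%:R * rsqrt Y.+1 <= _); last first.
      by rewrite ler_wpM2l // (rsqrt_le Y0 (leqnSn Y)).
    by apply: abel_rsqrt => // [|k h]; [rewrite ltnS leq_divRL // /Z leq_mul | apply: Xub].
  have s0 : 0 < Num.sqrt (Y%:R : F) by rewrite sqrtr_gt0 ltr0n.
  by rewrite -mulr_suml mulrCA [leRHS]mulrC ler_wpM2l // ler_pdivrMr // sum_rsqrt.
apply: le_trans (ler_normB _ _) _; apply: lerD.
  apply: le_trans (_ : M%:R * M%:R * rsqrt 1 <= _); last by rewrite w1 mulr1.
  apply: abel_rsqrt => // k h.
  apply: periodic_bound => // [j|].
    rewrite -[X (j + M)%N]Xmod modnDr Xmod; congr (_ * _).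
    by apply: eq_bigr => e _; rewrite -umod mulnDl addnC [(M * e)%N]mulnC modnMDl umod.
  rewrite (eq_bigr (fun d => \sum_(1 <= e < Z.+1) X d * u (d * e)%N * rsqrt e)); last first.
    by move=> d _; rewrite mulr_sumr; apply: eq_bigr => e _; rewrite mulrA.
  by rewrite exchange_big_nat big1 //= => e _; rewrite -mulr_suml Xusum mul0r.
apply: le_trans (ler_norm_sum _ _ _) _.
apply: le_trans (_ : \sum_(1 <= d < Y.+1) M%:R / Y%:R <= _).
  rewrite big_nat_cond [leRHS]big_nat_cond; apply: ler_sum => d /andP[/andP[hd hd2] _].
  exact: XTb.
by rewrite sumr_const_nat subn1 /= -[leLHS]mulr_natr divfK // pnatr_eq0 -lt0n.
Qed.

End ResidueClass.

Section Divsum.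
Variables (F : rcfType) (M : nat) (X : nat -> F).
Hypothesis X1 : X 1%N = 1.
Hypothesis XM : forall m n, X (m * n)%N = X m * X n.
Hypothesis X0 : forall m, ~~ coprime m M -> X m = 0.
Hypothesis Xsqr : forall m, coprime m M -> X m * X m = 1.

Lemma X_cases m : [\/ X m = 0, X m = 1 | X m = -1].
Proof.
case: (boolP (coprime m M)) => [/Xsqr h|/X0 h]; last by constructor 1.
have : (X m - 1) * (X m + 1) == 0 by rewrite -subr_sqr expr2 h expr1n subrr.
by rewrite mulf_eq0 subr_eq0 addr_eq0 => /orP[/eqP|/eqP] e; [constructor 2|constructor 3].
Qed.

(** The divisors prime to [q] are those of [v]; the others are [q] times a divisor of
    [q ^ e * v]. *)
Lemma divsum_step q e v : prime q -> ~~ (q %| v)%N -> (0 < v)%N ->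
  divsum X (q ^ e.+1 * v) = divsum X v + X q * divsum X (q ^ e * v).
Proof.
move=> pq nq v0; have q0 := prime_gt0 pq.
have n0 : (0 < q ^ e * v)%N by rewrite muln_gt0 expn_gt0 q0.
rewrite expnS -mulnA /divsum (bigID (fun d => (q %| d)%N)) /= addrC; congr (_ + _).
  rewrite [RHS](big_nat_widen _ _ (q * (q ^ e * v)).+1) /=; last first.
    by rewrite ltnS mulnA leq_pmull // muln_gt0 q0 expn_gt0 q0.
  apply: eq_bigl => d; case: (boolP (q %| d)%N) => qd; rewrite ?andbF ?andbT.
    by apply/esym/negP => /andP[h _]; move/negP: nq; apply; apply: dvdn_trans h.
  have c : coprime d (q ^ e.+1) by rewrite coprime_sym coprimeXl // prime_coprime.
  rewrite mulnA -expnS Gauss_dvdr //.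
  by case: (boolP (d %| v)%N) => //= /(dvdn_leq v0); rewrite ltnS => ->.
rewrite (eq_bigl (fun d => (q %| d) && (d %| q * (q ^ e * v)))%N); last by move=> d; rewrite andbC.
rewrite big_mkcondr sum_multiples // mulKn // -big_mkcond mulr_sumr.
by apply: eq_big => [d|d _]; rewrite ?dvdn_pmul2l // XM.
Qed.

Lemma divsum_pow q e v : prime q -> ~~ (q %| v)%N -> (0 < v)%N ->
  divsum X (q ^ e * v) = (\sum_(i < e.+1) X q ^+ i) * divsum X v.
Proof.
move=> pq nq v0; elim: e => [|e IH]; first by rewrite expn0 mul1n big_ord1 expr0 mul1r.
rewrite divsum_step // IH [in RHS]big_ord_recl expr0 mulrDl mul1r; congr (_ + _).
by rewrite mulrA; congr (_ * _); rewrite mulr_sumr; apply: eq_bigr => i _; rewrite exprS.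
Qed.

Lemma geom_m1 e : \sum_(i < e.+1) (-1) ^+ i = (~~ odd e)%:R :> F.
Proof.
elim: e => [|e IH]; first by rewrite big_ord1 expr0.
by rewrite big_ord_recr /= IH -signr_odd /=; case: (odd e); rewrite /= ?expr1 ?expr0 ?addrN ?add0r.
Qed.

Lemma geom_1 e : \sum_(i < e.+1) 1 ^+ i = e.+1%:R :> F.
Proof. by rewrite (eq_bigr (fun=> 1)) ?sumr_const ?card_ord // => i _; rewrite expr1n. Qed.

Lemma geom_0 e : \sum_(i < e.+1) 0 ^+ i = 1 :> F.
Proof. by rewrite big_ord_recl expr0 big1 ?addr0 // => i _; rewrite expr0n. Qed.

Lemma divsum_1 : divsum X 1 = 1.
Proof. by rewrite /divsum big_mkcond big_nat1 dvdn1 eqxx X1. Qed.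

Lemma divsum_ge m : (0 < m)%N -> 0 <= divsum X m /\
  ((forall p, prime p -> ~~ odd (logn p m)) -> 1 <= divsum X m).
Proof.
elim/ltn_ind: m => m IH m0; case: (ltnP 1 m) => m1; last first.
  have -> : m = 1%N by lia.
  by rewrite divsum_1.
have pq := pdiv_prime m1; set q := pdiv m in pq.
have [v cv em] := pfactor_coprime pq m0.
have nv : ~~ (q %| v)%N by rewrite -prime_coprime.
have v0 : (0 < v)%N by case: v em {cv nv} => // e; rewrite mul0n in e; rewrite e in m0.
have e0 : (0 < logn q m)%N by rewrite logn_gt0 mem_primes pq m0 pdiv_dvd.
have vm : (v < m)%N.
  rewrite {1}em -[X in (X < _)%N]muln1 ltn_pmul2l // -(exp1n (logn q m)).
  by rewrite ltn_exp2r // prime_gt1.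
have [h1 h2] := IH _ vm v0.
rewrite {1 3}em mulnC divsum_pow //; split.
  by case: (X_cases q) => ->; rewrite ?geom_0 ?geom_1 ?geom_m1 mulr_ge0.
move=> ev; have {}h2 : 1 <= divsum X v.
  apply: h2 => p pp; case: (eqVneq p q) => [->|ne]; first by rewrite lognE (negPf nv) !andbF.
  have := ev p pp; rewrite {1}em lognM // ?expn_gt0 ?prime_gt0 // lognX.
  by rewrite (logn_prime p pq) (negPf ne) muln0 addn0.
case: (X_cases q) => ->; rewrite ?geom_0 ?geom_1 ?geom_m1 ?mul1r // ?(negPf (negbT _)).
  by rewrite -[leLHS]mulr1 ler_pM // ler1n.
by rewrite ev // mul1r.
Qed.

(* [m] is a square times an integer all of whose prime factors [q] satisfy
   [X q = 1]; the Chinese remainder theorem glues the roots modulo them. *)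
Lemma divsum_gt0_root (N m : nat) : (forall q, prime q -> coprime q M -> X q = 1 ->
    exists x, (q %| x * x + N)%N) ->
  (0 < m)%N -> coprime m M -> 0 < divsum X m ->
  exists k s, m = (k * k * s)%N /\ exists x, (s %| x * x + N)%N.
Proof.
move=> HX; elim/ltn_ind: m => m IH m0 cm rm; case: (ltnP 1 m) => m1; last first.
  by exists 1%N, 1%N; split; [lia | exists 0%N; rewrite dvd1n].
have pq := pdiv_prime m1; set q := pdiv m in pq.
have [v cv em] := pfactor_coprime pq m0.
have nv : ~~ (q %| v)%N by rewrite -prime_coprime.
have v0 : (0 < v)%N by case: v em {cv nv} => // e; rewrite mul0n in e; rewrite e in m0.
have e0 : (0 < logn q m)%N by rewrite logn_gt0 mem_primes pq m0 pdiv_dvd.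
have vm : (v < m)%N.
  rewrite {1}em -[X in (X < _)%N]muln1 ltn_pmul2l // -(exp1n (logn q m)).
  by rewrite ltn_exp2r // prime_gt1.
have cvM : coprime v M by move: cm; rewrite {1}em coprimeMl => /andP[].
have cq : coprime q M by apply: coprime_dvdl (pdiv_dvd m) cm.
move: rm; rewrite em mulnC divsum_pow // => rm.
have even_case : ~~ odd (logn q m) -> 0 < divsum X v ->
    exists k s, (q ^ logn q m * v)%N = (k * k * s)%N /\ exists x, (s %| x * x + N)%N.
  move=> ev /(IH _ vm v0 cvM)[k [s [ek hs]]].
  exists (q ^ (logn q m)./2 * k)%N, s; split=> //.
  rewrite ek -{1}[logn q m](even_halfK ev) -addnn expnD; ring.
have [xq|xq|xq] := X_cases q.
- by have := Xsqr cq; rewrite xq mul0r => /eqP; rewrite eq_sym oner_eq0.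
- have rv : 0 < divsum X v by move: rm; rewrite xq geom_1 pmulr_rgt0 // ltr0n.
  case: (boolP (odd (logn q m))) => od; last exact: even_case.
  have [k [s [ek [x hx]]]] := IH _ vm v0 cvM rv.
  have [y hy] := HX q pq cq xq.
  have cqs : coprime q s by apply: coprime_dvdr cv; rewrite ek dvdn_mull.
  exists (q ^ (logn q m)./2 * k)%N, (q * s)%N; split.
    have el : logn q m = ((logn q m)./2 + (logn q m)./2).+1 by lia.
    by rewrite ek {1}el expnS expnD; ring.
  exists (chinese q s y x); rewrite Gauss_dvd //; apply/andP; split.
    by rewrite /dvdn -modnDml -modnMm chinese_modl // modnMm modnDml.
  by rewrite /dvdn -modnDml -modnMm chinese_modr // modnMm modnDml.
- move: rm; rewrite xq geom_m1; case: (boolP (odd (logn q m))) => od; first by rewrite mul0r ltxx.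
  by rewrite mul1r => rv; apply: even_case.
Qed.

End Divsum.

Lemma sum_squares_le (F : numDomainType) (f : nat -> F) Y : (forall m, 0 <= f m) ->
  \sum_(1 <= k < Y.+1) f (k * k)%N <= \sum_(1 <= m < (Y * Y).+1) f m.
Proof.
move=> f0; elim: Y => [|Y IH]; first by rewrite !big_geq.
rewrite big_nat_recr //= [leRHS](@big_cat_nat _ _ _ (Y * Y).+1) //=; last by nia.
apply: lerD => //; rewrite big_nat_recr /=; last by nia.
by rewrite lerDr sumr_ge0.
Qed.

Lemma harmonic_ge (F : numFieldType) j : j%:R / 2 <= \sum_(1 <= k < (2 ^ j).+1) (k%:R^-1 : F).
Proof.
elim: j => [|j IH]; first by rewrite mul0r sumr_ge0 // => k _; rewrite invr_ge0 ler0n.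
rewrite [leRHS](@big_cat_nat _ _ _ (2 ^ j).+1) //=; last by rewrite ltnS leq_exp2l.
rewrite -natr1 mulrDl; apply: lerD => //.
apply: le_trans (_ : \sum_((2 ^ j).+1 <= k < (2 ^ j.+1).+1) (2 ^ j.+1)%:R^-1 <= _).
  rewrite sumr_const_nat subSS expnS mul2n -addnn addnK -[leRHS]mulr_natl natrD.
  have : (2 ^ j)%:R != 0 :> F by rewrite pnatr_eq0 -lt0n expn_gt0.
  by set x := _%:R => x0; rewrite -mulr2n -[x *+ 2]mulr_natl invfM mulrCA divff // mulr1 mul1r.
apply: ler_sum_nat => k /andP[h1 h2].
by rewrite lef_pV2 ?posrE ?ltr0n ?ler_nat // ?expn_gt0 // (leq_trans _ h1).
Qed.

(** The block of length [M] after [M * I] contributes its first element [M * I + 1], which is at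
    most [M * I.+1]. *)
Lemma harmonic_residue_ge (F : numFieldType) M I : (0 < M)%N ->
  M%:R^-1 * \sum_(1 <= k < I.+1) (k%:R^-1 : F) <=
  \sum_(1 <= k < (M * I).+1) (k == 1 %[mod M])%:R / k%:R.
Proof.
move=> M0; elim: I => [|I IH]; first by rewrite muln0 !big_geq // mulr0.
rewrite big_nat_recr //= mulrDr [leRHS](@big_cat_nat _ _ _ (M * I).+1) //=; last by nia.
apply: lerD => //; rewrite big_ltn; last by nia.
rewrite -[leLHS]addr0; apply: lerD; last by apply: sumr_ge0 => k _; rewrite divr_ge0.
have -> : (M * I).+1 == 1 %[mod M] by rewrite -addn1 mulnC modnMDl.
rewrite mul1r -invfM -natrM lef_pV2 ?posrE ?ltr0n ?muln_gt0 ?M0 // ler_nat; nia.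
Qed.

(** If the class of [a] has no positive divisor sum, the bounded twisted sum is up to sign at least
    the contribution of the class of [1], whose squares already diverge harmonically. *)
Lemma exists_residue_divsum (F : rcfType) (M a : nat) (X : nat -> F) :
  (0 < M)%N -> coprime a M -> X 1%N = 1 ->
  (forall m n, X (m * n)%N = X m * X n) -> (forall m, X (m %% M)%N = X m) ->
  (forall m, ~~ coprime m M -> X m = 0) -> (forall m, coprime m M -> X m * X m = 1) ->
  X a = 1 -> exists m, [/\ (0 < m)%N, m = a %[mod M] & 0 < divsum X m].
Proof.
move=> M0 aM X1 XM Xmod X0 Xsqr Xa.
case: (eqVneq (a %% M)%N (1 %% M)%N) => [e|ne].
  by exists 1%N; split; rewrite ?e // (divsum_1 X1).
(* [C] is the bound of [twisted_divsum_bound]. The exponent in [Y] makes the harmonic sum at least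
   [M C + 1 / 2], more than the [M C] allowed. *)
pose C := (M * M + 3 * M)%N.
pose Y := (M * 2 ^ (2 * M * C).+1)%N.
have Y0 : (0 < Y)%N by rewrite muln_gt0 M0 expn_gt0.
have := twisted_divsum_bound M0 aM X1 XM Xmod X0 Xsqr Xa Y0.
case: (boolP (has (fun m => (m == a %[mod M]) && (0 < divsum X m)) (index_iota 1 (Y * Y).+1))).
  by move=> /hasP[m]; rewrite mem_index_iota => /andP[m0 _] /andP[/eqP e h] _; exists m.
move=> /hasPn no; rewrite -normrN -sumrN => /(le_trans (ler_norm _)) bound.
have r0 m : (0 < m)%N -> 0 <= divsum X m by move=> m0; have [] := divsum_ge X1 XM X0 Xsqr m0.
pose f m : F := if m == 0%N then 0 else (m == 1 %[mod M])%:R * divsum X m * rsqrt F m.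
have f0 m : 0 <= f m.
  by rewrite /f; case: (posnP m) => // m0; rewrite !mulr_ge0 ?r0 ?rsqrt_ge0.
have le1 : \sum_(1 <= m < (Y * Y).+1) f m <= C%:R.
  rewrite natrD !natrM; apply: le_trans bound; apply: ler_sum_nat => m hm.
  have m0 : (0 < m)%N by case/andP: hm.
  rewrite /f eqn0Ngt m0 /= -!mulNr; apply: ler_wpM2r; first exact: rsqrt_ge0.
  rewrite opprB mulrBl lerBrDr -lerBrDl subrr.
  have := no m; rewrite mem_index_iota => /(_ hm); case: (m == a %[mod M]); last by rewrite mul0r.
  by rewrite mul1r -leNgt.
have le2 : \sum_(1 <= k < Y.+1) (k == 1 %[mod M])%:R / k%:R <= C%:R :> F.
  apply: le_trans le1; apply: le_trans (sum_squares_le Y f0).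
  apply: ler_sum_nat => k /andP[k0 _].
  have kk0 : (0 < k * k)%N by rewrite muln_gt0 k0.
  rewrite /f eqn0Ngt kk0 /= rsqrt_sqr; apply: ler_wpM2r; first by rewrite invr_ge0 ler0n.
  case: eqP => [e|_]; last by rewrite mulr_ge0 ?r0.
  rewrite -modnMm e modnMm muln1 eqxx mul1r.
  have [_ h] := divsum_ge X1 XM X0 Xsqr kk0; apply: h => p pp.
  by rewrite lognM // addnn odd_double.
have := le_trans (harmonic_residue_ge _ _ M0) le2.
rewrite ler_pdivrMl ?ltr0n // -natrM => h.
have := le_trans (harmonic_ge F _) h; rewrite ler_pdivrMr ?ltr0n // -natrM ler_nat; lia.
Qed.

End DivisorSums.

(** * Moduli in a given class modulo which -N is a square *)

Section ClassRoots.
Import Order.TTheory GRing.Theory Num.Theory.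

Theorem exists_class_root N L a : 0 < N -> 0 < L -> coprime a (8 * N * L) -> chi N a = false ->
  exists k m x, [/\ k * k * m = a %[mod 8 * N * L], 0 < m & m %| x * x + N].
Proof.
move=> N0 L0 ca ha; set M := 8 * N * L in ca *.
have M0 : 0 < M by rewrite !muln_gt0 N0 L0.
have d8N : 8 * N %| M by rewrite dvdn_mulr.
have cN m : coprime m M -> coprime N m.
  by rewrite coprime_sym; apply: coprime_dvdl; rewrite /M -mulnA mulnCA dvdn_mulr.
have od m : coprime m M -> odd m.
  by rewrite coprime_sym -coprime_two; apply: coprime_dvdl; rewrite /M -mulnA dvdn_mulr.
(* The character of [- N], extended by zero to modulus [M], with values in a real closed field so
   that [1 / sqrt m] exists. *)
pose X m : realalg := (if coprime m M then (-1) ^+ chi N m else 0)%R.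
have X1 : X 1 = 1%R by rewrite /X coprime1n chi_1 ?expr0.
have XM m n : X (m * n) = (X m * X n)%R.
  rewrite /X coprimeMl; case: (boolP (coprime m M)) => cm; last by rewrite mul0r.
  case: (boolP (coprime n M)) => cn /=; last by rewrite mulr0.
  by rewrite chi_mul ?od ?cN // signr_addb.
have X0 m : ~~ coprime m M -> X m = 0%R by move=> /negPf h; rewrite /X h.
have Xsqr m : coprime m M -> (X m * X m = 1)%R by move=> h; rewrite /X h -expr2 sqrr_sign.
have [| |m [m0 em rm]] := exists_residue_divsum M0 ca X1 XM _ X0 Xsqr.
- move=> m; rewrite /X coprime_modl; case: ifP => // cm.
  by rewrite (@chi_eqmod N (m %% M) m) ?od ?cN ?coprime_modl // modn_dvdm.
- by rewrite /X ca ha.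
have cm : coprime m M by rewrite -coprime_modl em coprime_modl.
have [|k [s [ems [x hx]]]] := divsum_gt0_root XM X0 Xsqr (N := N) _ m0 cm rm.
  move=> q pq cq; rewrite /X cq => h; apply: chi_square; rewrite ?od ?cN //.
  by case: (chi N q) h => // /eqP; rewrite expr1 eq_sym -subr_eq0 opprK -(natrD _ 1 1) pnatr_eq0.
exists k, s, x; split=> //; first by rewrite -ems.
by case: s ems {hx} => // e; rewrite e muln0 in m0.
Qed.

End ClassRoots.

(** * The residue classes suited to each genus *)

Section Splitting.

(** [2] is a non-residue modulo 3, 5, 11 and 13; modulo 7 it is a residue and [6 = -1] is taken. *)
Definition nonresidue (P : nat) : nat := if P == 7 then 6 else 2.

Lemma chi_mull N1 N2 m : odd m -> coprime N1 m -> coprime N2 m ->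
  chi (N1 * N2) m = chi N1 m (+) gs N2 m.
Proof. by move=> om c1 c2; rewrite /chi gs_mul // addbA. Qed.

Lemma dvdn_S_eqmod n a b : a = b %[mod n] -> n %| b.+1 -> n %| a.+1.
Proof. by move=> e; rewrite /dvdn -(addn1 a) -(addn1 b) -(modnDml a) e modnDml. Qed.

Lemma dvdn_S_coprime n a : n %| a.+1 -> coprime a n.
Proof. by move=> d; rewrite coprime_sym; apply: coprime_dvdl d _; rewrite coprime_sym coprimenS. Qed.

Lemma eqmod_dvd d n a b : d %| n -> a = b %[mod n] -> a = b %[mod d].
Proof. by move=> dn e; rewrite -(modn_dvdm a dn) e modn_dvdm. Qed.

(** The class [a] is [-1] modulo [8 n] and minus a non-residue modulo [P]. The symbol of [- n] over
    [a] is [-1], and reciprocity makes that of [P] equal to [-1] as well, so [- n P] has symbol [1].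
    The condition modulo [P] makes [- m] a non-residue, which will place the form in the genus. *)
Lemma exists_split_unramified P n : P \in [:: 3; 5; 7; 11; 13] -> 0 < n -> coprime n P ->
  exists k m x, [/\ 0 < m, n %| (k * k * m).+1, m %| x * x + n * P &
    k * k * m = P.-1 * nonresidue P %[mod P]].
Proof.
move=> hP n0 cn.
have [oP c8 g1 cg] : [/\ odd P, coprime 8 P, gs (nonresidue P) P & coprime (nonresidue P) P].
  move: hP; rewrite !inE => /or4P[/eqP->|/eqP->|/eqP->|/orP[] /eqP->]; split=> //; 
    by rewrite /nonresidue /= ?gs_two // (gs_pred (m := 7)).
have P1 : 1 < P by move: hP; rewrite !inE; lia.
have c8n : coprime (8 * n) P by rewrite coprimeMl c8.
pose a := chinese (8 * n) P (8 * n).-1 (P.-1 * nonresidue P).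
have e1 : 8 * n %| a.+1.
  apply: (@dvdn_S_eqmod _ _ (8 * n).-1); first by rewrite /a chinese_modl.
  by rewrite prednK // muln_gt0.
have e2 : a = P.-1 * nonresidue P %[mod P] by rewrite /a chinese_modr.
have cPP : coprime P.-1 P by apply: dvdn_S_coprime; rewrite prednK ?dvdnn // ltnW.
have caP : coprime a P by rewrite -coprime_modl e2 coprime_modl coprimeMl cPP.
have ca8 := dvdn_S_coprime e1.
have a8 : a %% 8 = 7.
  have : 8 %| a.+1 by apply: dvdn_trans e1; rewrite dvdn_mulr.
  clear; lia.
have oa : odd a by rewrite -odd_mod8 a8.
have can : coprime a n by move: ca8; rewrite coprimeMr => /andP[].
have [||||k [m [x [ek m0 hx]]]] := @exists_class_root (n * P) 1 a.
- by rewrite muln_gt0 n0 ltnW.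
- by [].
- by rewrite muln1 mulnA coprimeMr ca8.
- rewrite chi_mull // 1?coprime_sym // chi_m1 //; last by move: e1 => /eqP ->; rewrite mod0n.
  have := gs_recip oa oP (a := P); rewrite coprime_sym => /(_ caP).
  have -> : gs a P = odd P./2 (+) true by rewrite (gs_eqmod e2) gs_mul // gs_pred // g1.
  rewrite (odd_half_mod8 a) a8 /=; by case: (gs P a); case: (odd P./2).
rewrite muln1 in ek.
exists k, m, x; split=> //.
- apply: (dvdn_S_eqmod (b := a)); last by apply: dvdn_trans e1; rewrite dvdn_mull.
  by apply: eqmod_dvd ek; rewrite mulnA dvdn_mulr // dvdn_mull.
- by rewrite -e2; apply: eqmod_dvd ek; rewrite mulnA dvdn_mull.
Qed.

(** Take [a] with [P a = -1] modulo [8 n]. The character of [- n] is [-1] at [P a] and, by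
    hypothesis, at [P]; hence it is [1] at [a]. *)
Lemma exists_split_ramified P n : prime P -> odd P -> 0 < n -> coprime n P -> chi n P ->
  exists k m x, [/\ 0 < m, n %| (P * (k * k * m)).+1 & m %| x * x + n].
Proof.
move=> pP oP n0 cn hchi; have P0 := prime_gt0 pP.
have c8 : coprime P (8 * n).
  by rewrite coprimeMr coprime_sym (coprimeXl 3 (m := 2)) ?coprime_two // coprime_sym.
pose a := ((egcdn P (8 * n)).1 * (8 * n).-1).
have ea : 8 * n %| (P * a).+1.
  have [u v e _] := egcdnP (8 * n) P0; rewrite /a.
  have e1 : (egcdn P (8 * n)).1 * P = (egcdn P (8 * n)).2 * (8 * n) + 1.
    by case: (egcdnP (8 * n) P0) => km kn ->; rewrite (eqP c8).
  rewrite mulnA [P * _]mulnC e1 mulnDl mul1n -addnS prednK ?muln_gt0 //.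
  by rewrite dvdn_addl // -mulnA dvdn_mull // dvdn_mulr.
have cPa := dvdn_S_coprime ea.
have ca : coprime a (8 * n) by move: cPa; rewrite coprimeMl => /andP[].
have oa : odd a.
  by rewrite -coprime_two coprime_sym; apply: coprime_dvdr ca; rewrite (dvdn_mulr n (_ : 2 %| 8)).
have can : coprime n a by move: ca; rewrite coprimeMr coprime_sym => /andP[_]; rewrite coprime_sym.
have [||||k [m [x [ek m0 hx]]]] := @exists_class_root n 1 a; rewrite ?muln1 //.
  have := chi_m1 n0 (m := P * a); rewrite (eqP ea) mod0n => /(_ erefl).
  by rewrite chi_mul // hchi; case: (chi n a).
rewrite muln1 in ek; exists k, m, x; split=> //.
apply: (dvdn_S_eqmod (b := P * a)); last by apply: dvdn_trans ea; rewrite dvdn_mull.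
by rewrite -modnMmr (eqmod_dvd _ ek) ?modnMmr // dvdn_mull.
Qed.

(** With [a = 1] modulo 8, reciprocity turns the symbol of [- n] over [a] into that of [-1] over
    [n], which is [1]. *)
Lemma exists_split_1mod4 n : n %% 4 = 1 ->
  exists k m x, [/\ 0 < m, n %| (k * k * m).+1 & m %| x * x + n].
Proof.
move=> n4; have n0 : 0 < n by case: n n4.
have on : odd n by clear -n4; lia.
have c8 : coprime 8 n by rewrite (coprimeXl 3 (m := 2)) ?coprime_two.
pose a := chinese 8 n 1 n.-1.
have e1 : a %% 8 = 1 by rewrite /a chinese_modl.
have e2 : a = n.-1 %[mod n] by rewrite /a chinese_modr.
have oa : odd a by rewrite -odd_mod8 e1.
have dn : n %| a.+1 by apply: dvdn_S_eqmod e2 _; rewrite prednK.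
have can := dvdn_S_coprime dn.
have [||||k [m [x [ek m0 hx]]]] := @exists_class_root n 1 a; rewrite ?muln1 //.
- by rewrite coprimeMr can andbT -coprime_modl e1.
- have := gs_recip oa on (a := n); rewrite coprime_sym can => /(_ erefl).
  have -> : gs a n = false by rewrite (gs_eqmod e2) gs_pred // ; clear -n4; lia.
  by rewrite /chi (odd_half_mod8 a) e1 /= addbF.
rewrite muln1 in ek; exists k, m, x; split=> //.
by apply: dvdn_S_eqmod dn; apply: eqmod_dvd ek; rewrite dvdn_mull.
Qed.

(** The class [3] modulo 8 is chosen because [-2] has symbol [1] there. *)
Lemma exists_split_2mod4 n : odd n ->
  exists k m x, [/\ 0 < m, 2 * n %| (k * k * m).+1 & m %| x * x + 2 * n].
Proof.
move=> on; have n0 : 0 < n by case: n on.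
have c8 : coprime 8 n by rewrite (coprimeXl 3 (m := 2)) ?coprime_two.
pose a := chinese 8 n 3 n.-1.
have e1 : a %% 8 = 3 by rewrite /a chinese_modl.
have e2 : a = n.-1 %[mod n] by rewrite /a chinese_modr.
have oa : odd a by rewrite -odd_mod8 e1.
have dn : n %| a.+1 by apply: dvdn_S_eqmod e2 _; rewrite prednK.
have can := dvdn_S_coprime dn.
have d2n : 2 * n %| a.+1 by rewrite Gauss_dvd ?coprime_two // dn andbT dvdn2 /= oa.
have [||||k [m [x [ek m0 hx]]]] := @exists_class_root (2 * n) 1 a; rewrite ?muln1 ?muln_gt0 //.
- have ca2 : coprime a 2 by rewrite coprime_sym coprime_two.
  by rewrite !coprimeMr ca2 can -(coprime_modl a 8) e1.
- rewrite mulnC chi_mull ?coprime_two // 1?coprime_sym //.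
  have := gs_recip oa on (a := n); rewrite coprime_sym can => /(_ erefl).
  have -> : gs a n = odd n./2 by rewrite (gs_eqmod e2) gs_pred.
  rewrite /chi (odd_half_mod8 a) gs_two // e1 /=.
  by case: (gs n a); case: (odd _).
rewrite muln1 in ek; exists k, m, x; split=> //.
by apply: dvdn_S_eqmod d2n; apply: eqmod_dvd ek; rewrite dvdn_mull.
Qed.

(** Here an odd [a = -1] modulo [n] gives [- n] the symbol [-1]. Asking instead for [2 a = -1]
    corrects the sign, since [2] has symbol [-1] over [n]; the modulus becomes [2 m]. *)
Lemma exists_split_3mod8 n : n %% 8 = 3 ->
  exists k m x, [/\ 0 < m, n %| (k * k * (2 * m)).+1 & 2 * m %| x * x + n].
Proof.
move=> n8; have n0 : 0 < n by case: n n8.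
have on : odd n by rewrite -odd_mod8 n8.
have c8 : coprime 8 n by rewrite (coprimeXl 3 (m := 2)) ?coprime_two.
pose a := chinese 8 n 1 n./2.
have e1 : a %% 8 = 1 by rewrite /a chinese_modl.
have e2 : a = n./2 %[mod n] by rewrite /a chinese_modr.
have oa : odd a by rewrite -odd_mod8 e1.
have e3 : 2 * a = n.-1 %[mod n].
  by rewrite -modnMmr e2 modnMmr; congr (_ %% _); clear -on; lia.
have dn : n %| (2 * a).+1 by apply: dvdn_S_eqmod e3 _; rewrite prednK.
have can : coprime a n by move: (dvdn_S_coprime dn); rewrite coprimeMl => /andP[].
have [||||k [m [x [ek m0 hx]]]] := @exists_class_root n 1 a; rewrite ?muln1 //.
- by rewrite coprimeMr can andbT -coprime_modl e1.
- have := gs_recip oa on (a := n); rewrite coprime_sym can => /(_ erefl).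
  have : gs (2 * a) n = true by rewrite (gs_eqmod e3) gs_pred // odd_half_mod8 n8.
  rewrite gs_mul ?coprime_two // gs_two // n8 /= => h.
  by rewrite /chi (odd_half_mod8 a) e1 /=; move: h; case: (gs a n); case: (gs n a).
rewrite muln1 in ek.
have om : odd m.
  have : (k * k * m) %% 8 = 1 by rewrite (eqmod_dvd _ ek) // dvdn_mulr.
  by move/(congr1 odd); rewrite odd_mod8 !oddM => /andP[].
(* The odd one of the two roots [x] and [x + m], so that [2] divides [y * y + n] too. *)
pose y := if odd x then x else x + m.
exists k, m, y; split=> //.
  apply: dvdn_S_eqmod dn; rewrite mulnCA -modnMmr (eqmod_dvd _ ek) ?dvdn_mull //.
  by rewrite modnMmr.
have oy : odd y by rewrite /y; case: ifP => // h; rewrite oddD h om.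
rewrite Gauss_dvd ?coprime_two // dvdn2 oddD oddM oy on /= /y; case: ifP => // _.
have -> : (x + m) * (x + m) + n = (2 * x + m) * m + (x * x + n) by nia.
by rewrite dvdn_addr // dvdn_mull.
Qed.

End Splitting.

(** * Numbers represented by the classes *)

Section Representations.
Local Open Scope Z_scope.

Lemma Zdvd_of_dvdn (d m : nat) : (d %| m)%N -> (Z.of_nat d | Z.of_nat m).
Proof. by case/dvdnP => q ->; exists (Z.of_nat q); lia. Qed.

Lemma Zdvd_mul_cancel (n m c w : Z) : (n | c * m + 1) -> (n | m * w) -> (n | w).
Proof.
move=> [p hp] [q hq]; exists (p * w - c * q).
have -> : (p * w - c * q) * n = (p * n) * w - c * (q * n) by ring.
by rewrite -hp -hq; ring.
Qed.

(* A ternary form of determinant [P] with last diagonal coefficient [n]: the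
   hypotheses say that [- m] is a square modulo [n] and [- n P] one modulo [m]. *)
Lemma form_unramified (P n m k t : Z) : 0 < P -> 0 < n -> 0 < m ->
  (n | k * k * m + 1) -> (m | t * t + n * P) ->
  (forall x s, (P | x * x + m * s * s) -> (P | s)) ->
  exists f, good P n f.
Proof.
move=> P0 n0 m0 hk [l hl] han.
(* [u] and [v] satisfy [u^2 = - m], [u v = - t] and [v^2 = - l] modulo [n]. The minors [U n - u^2],
   [W n - u v], [V n - v^2] are then [m], [t], [l], and [l m - t^2 = n P] yields the determinant
   [P]. *)
set u := k * m.
have [U hU] : (n | u * u + m).
  by case: hk => q hq; exists (m * q); transitivity (m * (k * k * m + 1)); [rewrite /u; ring | rewrite hq; ring].
set v := k * t.
have [W hW] : (n | u * v + t).
  by case: hk => q hq; exists (t * q); transitivity (t * (k * k * m + 1)); [rewrite /u /v; ring | rewrite hq; ring].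
have [V hV] : (n | v * v + l).
  apply: (@Zdvd_mul_cancel n m (k * k)); first exact: hk.
  case: hk => q hq; exists (t * t * q + P).
  have -> : m * (v * v + l) = t * t * (k * k * m) + l * m by rewrite /v; ring.
  rewrite -hl; have -> : t * t * (k * k * m) = t * t * (k * k * m + 1) - t * t by ring.
  by rewrite hq; ring.
have hdet : U * (V * n - v * v) - W * (W * n - v * u) + u * (W * v - V * u) = P.
  apply: (Z.mul_reg_l _ _ n); first lia.
  have -> : n * (U * (V * n - v * v) - W * (W * n - v * u) + u * (W * v - V * u)) =
    (U * n) * (V * n - v * v) - (W * n) * (W * n - v * u) + u * ((W * n) * v - (V * n) * u) by ring.
  rewrite -hU -hV -hW; have -> : n * P = l * m - t * t by rewrite -hl; ring.
  by ring.
have U0 : 0 < U by nia.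
exists (TF U V n W u v); split; last by exists 0, 0, 1; rewrite /form_val; cbn [f11 f22 f33 f12 f13 f23]; ring.
split; [exact U0|split; [|split; [exact hdet|]]]; rewrite /tadj; cbn [f11 f22 f33 f12 f13 f23].
- have e : (n * n) * (m * (U * V - W * W)) = (u * t - m * v) * (u * t - m * v) + n * P * (u * u) + m * (n * P).
    have -> : (n * n) * (m * (U * V - W * W)) = m * ((U * n) * (V * n) - (W * n) * (W * n)) by ring.
    rewrite -hU -hV -hW; have -> : n * P = l * m - t * t by rewrite -hl; ring.
    by ring.
  have h1 := Z.square_nonneg (u * t - m * v); have h2 := Z.square_nonneg u.
  have h3 : 0 < n * P by apply: Z.mul_pos_pos.
  have h4 : 0 < m * (n * P) by apply: Z.mul_pos_pos.
  have h5 : 0 <= n * P * (u * u) by apply: Z.mul_nonneg_nonneg; lia.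
  have h6 : 0 < (n * n) * m by do !apply: Z.mul_pos_pos.
  apply: (Z.mul_pos_cancel_l ((n * n) * m) _ h6).1; rewrite -Z.mul_assoc e; lia.
- move=> x y z s [q hq].
  have hm : m = U * n - u * u by rewrite -hU; ring.
  (* [m] is a diagonal entry of the adjoint, so [m] times the adjoint is the square of this linear
     form up to a multiple of the determinant [P]. *)
  apply: (han ((u * v - W * n) * x + m * y + (W * u - U * v) * z)).
  exists (m * q - (n * x * x + U * z * z - 2 * u * x * z)).
  transitivity (m * (q * P) - (n * x * x + U * z * z - 2 * u * x * z) * P); last by ring.
  rewrite -hq -hdet hm; ring.
Qed.

(** Now the last row is [P (u, v, n)], and modulo [P] the adjoint reduces to [(U V - W^2) z^2]. As
    [n^2 (U V - W^2)] is [n] modulo [P], the genus condition becomes the hypothesis that [- n] is a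
    non-residue. *)
Lemma form_ramified (P n m k t : Z) : 0 < P -> 0 < n -> 0 < m ->
  (n | P * (k * k * m) + 1) -> (m | t * t + n) ->
  (forall x s, (P | x * x + n * s * s) -> (P | s)) ->
  exists f, good P (P * n) f.
Proof.
move=> P0 n0 m0 hk [l hl] han.
set u := k * m.
have [U hU] : (n | P * u * u + m).
  by case: hk => q hq; exists (m * q); transitivity (m * (P * (k * k * m) + 1)); [rewrite /u; ring | rewrite hq; ring].
set v := k * t.
have [W hW] : (n | P * u * v + t).
  by case: hk => q hq; exists (t * q); transitivity (t * (P * (k * k * m) + 1)); [rewrite /u /v; ring | rewrite hq; ring].
have [V hV] : (n | P * v * v + l).
  apply: (@Zdvd_mul_cancel n m (P * (k * k))); first by case: hk => q hq; exists q; rewrite -hq; ring.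
  case: hk => q hq; exists (t * t * q + 1).
  have -> : m * (P * v * v + l) = t * t * (P * (k * k * m)) + l * m by rewrite /v; ring.
  rewrite -hl; have -> : t * t * (P * (k * k * m)) = t * t * (P * (k * k * m) + 1) - t * t by ring.
  by rewrite hq; ring.
have hdet : U * (V * (P * n) - (P * v) * (P * v)) - W * (W * (P * n) - (P * v) * (P * u))
   + (P * u) * (W * (P * v) - V * (P * u)) = P.
  apply: (Z.mul_reg_l _ _ n); first lia.
  have -> : n * (U * (V * (P * n) - (P * v) * (P * v)) - W * (W * (P * n) - (P * v) * (P * u))
   + (P * u) * (W * (P * v) - V * (P * u))) =
    P * ((U * n) * ((V * n) - P * v * v) - (W * n) * ((W * n) - P * v * u) + P * u * ((W * n) * v - (V * n) * u)) by ring.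
  rewrite -hU -hV -hW; have -> : n * P = P * (l * m - t * t) by rewrite -hl; ring.
  by ring.
have hn : (n * n) * (U * V - W * W) = n + P * (u * u * l + m * v * v - 2 * u * v * t).
  have -> : (n * n) * (U * V - W * W) = (U * n) * (V * n) - (W * n) * (W * n) by ring.
  rewrite -hU -hV -hW; have -> : n + P * (u * u * l + m * v * v - 2 * u * v * t)
     = (l * m - t * t) + P * (u * u * l + m * v * v - 2 * u * v * t) by rewrite -hl; ring.
  by ring.
have U0 : 0 < U.
  apply: (Z.mul_pos_cancel_r U n n0).1; rewrite -hU -Z.mul_assoc.
  have h : 0 <= P * (u * u) by apply: Z.mul_nonneg_nonneg; [lia | exact: Z.square_nonneg].
  lia.
exists (TF U V (P * n) W (P * u) (P * v)); split; last by exists 0, 0, 1; rewrite /form_val; cbn [f11 f22 f33 f12 f13 f23]; ring.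
split; [exact U0|split; [|split; [exact hdet|]]]; rewrite /tadj; cbn [f11 f22 f33 f12 f13 f23].
- have e : m * ((n * n) * (U * V - W * W)) = m * n + P * ((u * t - m * v) * (u * t - m * v) + n * (u * u)).
    rewrite hn; have -> : n * (u * u) = (l * m - t * t) * (u * u) by rewrite -hl; ring.
    by ring.
  have h1 := Z.square_nonneg (u * t - m * v); have h2 := Z.square_nonneg u.
  have h4 : 0 < m * n by apply: Z.mul_pos_pos.
  have h5 : 0 <= n * (u * u) by apply: Z.mul_nonneg_nonneg; lia.
  have h6 : 0 < m * (n * n) by do !apply: Z.mul_pos_pos.
  apply: (Z.mul_pos_cancel_l (m * (n * n)) _ h6).1; rewrite -Z.mul_assoc e; have h7 : 0 <= P * ((u * t - m * v) * (u * t - m * v) + n * (u * u)) by apply: Z.mul_nonneg_nonneg; lia.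
  lia.
- move=> x y z s [q hq].
  set c := U * V - W * W in hn hq.
  set L := (W * (P * v) - P * u * V) * x + (W * (P * u) - U * (P * v)) * y + c * z.
  set E := u * u * l + m * v * v - 2 * u * v * t in hn.
  set G := V * x * x + U * y * y - 2 * W * x * y.
  apply: (han (n * L)).
  exists (n * n * c * q - n * n * G - E * s * s).
  have key : c * (q * P) = L * L + G * (U * (V * (P * n) - P * v * (P * v)) -
     W * (W * (P * n) - P * v * (P * u)) + P * u * (W * (P * v) - V * (P * u))) + c * (s * s).
    rewrite -hq /L /c /G; ring.
  rewrite hdet in key.
  have -> : (n * n * c * q - n * n * G - E * s * s) * P =
    n * n * (c * (q * P)) - n * n * G * P - E * s * s * P by ring.
  rewrite key; have -> : n * s * s = (n * n * c - P * E) * (s * s) by rewrite hn; ring.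
  ring.
Qed.

Lemma anisotropic_modP P n : 0 < P -> anisotropic_modb P (n mod P) -> anisotropic_mod P n.
Proof.
move=> P0 h x s [k hk].
have hx := Z.mod_pos_bound x P P0; have hs := Z.mod_pos_bound s P P0.
move: h; rewrite /anisotropic_modb.
move/forallb_forall/(_ (x mod P)) => h.
have {}h := h (@in_zrange 0 (Z.to_nat P) (x mod P) ltac:(lia)).
move/forallb_forall/(_ (s mod P)): h => h.
have {}h := h (@in_zrange 0 (Z.to_nat P) (s mod P) ltac:(lia)).
move: h; have -> : (x mod P * (x mod P) + n mod P * (s mod P) * (s mod P)) mod P = 0.
  apply/Z.mod_divide; first lia.
  rewrite !Z.mod_eq; [|lia..].
  set a := x / P; set b := s / P; set c := n / P.
  pose R := (- 2 * x * a + P * a * a) + n * (- 2 * s * b + P * b * b)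
     - c * (s * s + P * (- 2 * s * b + P * b * b)).
  by exists (k + R); rewrite Z.mul_add_distr_r -hk /R; ring.
rewrite Z.eqb_refl => /Z.eqb_eq e; apply/Z.mod_divide; lia.
Qed.

Lemma odd_ramified_nat P : In P odd_ramified ->
  exists p, P = Z.of_nat p /\ (p \in [:: 3; 5; 7; 11; 13]%N).
Proof.
by case=> [<-|[<-|[<-|[<-|[<-|[]]]]]]; [exists 3%N | exists 5%N | exists 7%N | exists 11%N | exists 13%N].
Qed.

Lemma nonresidue_anisotropic P : In P odd_ramified ->
  anisotropic_mod P (- Z.of_nat (nonresidue (Z.to_nat P))).
Proof.
move=> hP; apply: anisotropic_modP; first by move: hP; cbn; lia.
by case: hP => [<-|[<-|[<-|[<-|[<-|[]]]]]]; vm_compute.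
Qed.

Theorem represents_unramified P n : In P odd_ramified -> 0 < n -> ~ (P | n) ->
  exists f, In f (classes P) /\ represents f n.
Proof.
move=> hP n0 ndiv; have [p [eP hp]] := odd_ramified_nat hP.
have pp : prime p by move: hp; rewrite !inE => /or4P[|||/orP[]] /eqP->.
set q := Z.to_nat n; have en : n = Z.of_nat q by rewrite /q Z2Nat.id; lia.
have q0 : (0 < q)%N by lia.
have cn : coprime q p.
  rewrite coprime_sym prime_coprime //; apply/negP => /Zdvd_of_dvdn.
  by rewrite -eP -en.
have [k [m [x [m0 hk hx hkm]]]] := exists_split_unramified hp q0 cn.
have P0 : 0 < P by move: hP; cbn; lia.
have [f hf] : exists f, good P n f.
  apply: (@form_unramified P n (Z.of_nat m) (Z.of_nat k) (Z.of_nat x)) => //; first lia.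
  - rewrite en; have := Zdvd_of_dvdn hk; congr Z.divide; lia.
  - have := Zdvd_of_dvdn hx; congr Z.divide; rewrite en eP; lia.
  move=> y s [c hc].
  (* After multiplication by [k^2], the coefficient [k^2 m] is minus the chosen non-residue modulo
     [P]. *)
  apply: (nonresidue_anisotropic hP (x := Z.of_nat k * y)).
  have [d hd] : (P | Z.of_nat k * Z.of_nat k * Z.of_nat m + Z.of_nat (nonresidue (Z.to_nat P))).
    have -> : Z.to_nat P = p by rewrite eP Nat2Z.id.
    rewrite eP; have : (p %| k * k * m + nonresidue p)%N.
      rewrite /dvdn -modnDml hkm modnDml -mulSnr prednK ?prime_gt0 //.
      by rewrite modnMr.
    by move/Zdvd_of_dvdn; congr Z.divide; lia.
  exists (Z.of_nat k * Z.of_nat k * c - d * s * s).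
  rewrite Z.mul_sub_distr_r.
  have -> : d * s * s * P = (d * P) * s * s by ring.
  have -> : Z.of_nat k * Z.of_nat k * c * P = Z.of_nat k * Z.of_nat k * (c * P) by ring.
  by rewrite -hc -hd; ring.
apply: genus_classes hf; move: hP; rewrite /odd_ramified /ramified; cbn; tauto.
Qed.

Theorem represents_ramified P n : In P odd_ramified -> 0 < n -> anisotropic_mod P n ->
  exists f, In f (classes P) /\ represents f (P * n).
Proof.
move=> hP n0 han; have [p [eP hp]] := odd_ramified_nat hP.
have [pp op] : prime p /\ odd p by move: hp; rewrite !inE => /or4P[|||/orP[]] /eqP->.
have P1 : 1 < P by move: hP; cbn; lia.
set q := Z.to_nat n; have en : n = Z.of_nat q by rewrite /q Z2Nat.id; lia.
have q0 : (0 < q)%N by lia.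
have ndiv1 : ~ (P | 1) by move/Z.divide_pos_le; lia.
have cn : coprime q p.
  rewrite coprime_sym prime_coprime //; apply/negP => /Zdvd_of_dvdn; rewrite -eP -en => -[c hc].
  by apply: ndiv1; apply: (han 0 1); exists c; rewrite -hc; ring.
(* Otherwise [- n] would be a square modulo [P], against anisotropy with [s = 1]. *)
have hchi : chi q p.
  case: (boolP (chi q p)) => // /negbTE /(chi_square pp op cn) [x /Zdvd_of_dvdn [c hc]].
  case: ndiv1; apply: (han (Z.of_nat x)); exists c; rewrite eP -hc en; lia.
have [k [m [x [m0 hk hx]]]] := exists_split_ramified pp op q0 cn hchi.
have [f hf] : exists f, good P (P * n) f.
  apply: (@form_ramified P n (Z.of_nat m) (Z.of_nat k) (Z.of_nat x)) => //; try lia.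
  - rewrite en; have := Zdvd_of_dvdn hk; congr Z.divide; lia.
  - have := Zdvd_of_dvdn hx; congr Z.divide; lia.
apply: genus_classes hf; move: hP; rewrite /odd_ramified /ramified; cbn; tauto.
Qed.

Lemma modn_Zmod (q d : nat) : Z.of_nat (q %% d)%N = Z.of_nat q mod Z.of_nat d.
Proof.
case: d => [|d]; first by rewrite modn0 Zmod_0_r.
apply: (Z.mod_unique _ _ (Z.of_nat (q %/ d.+1)%N)).
  by left; have := ltn_pmod q (ltn0Sn d); lia.
by have := divn_eq q d.+1; lia.
Qed.

Theorem represents_three_squares n : 0 < n ->
  [\/ n mod 4 = 1, n mod 4 = 2 | n mod 8 = 3] -> represents (TF 1 1 1 0 0 0) n.
Proof.
move=> n0 hn; set q := Z.to_nat n; have en : n = Z.of_nat q by rewrite /q Z2Nat.id; lia.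
have [f hf] : exists f, good 1 n f.
  suff [k [m [x [m0 hk hx]]]] : exists k m x, [/\ (0 < m)%N, (q %| (k * k * m).+1)%N & (m %| x * x + q)%N].
    apply: (@form_unramified 1 n (Z.of_nat m) (Z.of_nat k) (Z.of_nat x)) => //; try lia.
    - rewrite en; have := Zdvd_of_dvdn hk; congr Z.divide; lia.
    - have := Zdvd_of_dvdn hx; congr Z.divide; lia.
    - by move=> y s _; exists s; ring.
  case: hn; rewrite en; clearbody q => hn.
  - by apply: exists_split_1mod4; apply: Nat2Z.inj; rewrite modn_Zmod.
  - have {hn} q4 : (q %% 4 = 2)%N by apply: Nat2Z.inj; rewrite modn_Zmod.
    have [|k [m [x]]] := @exists_split_2mod4 (q %/ 2)%N; first by clear -q4; lia.
    by rewrite (_ : (2 * (q %/ 2) = q)%N); [exists k, m, x | clear -q4; lia].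
  - have {hn} q8 : (q %% 8 = 3)%N by apply: Nat2Z.inj; rewrite modn_Zmod.
    have [k [m [x [m0 hk hx]]]] := exists_split_3mod8 q8.
    by exists k, (2 * m)%N, x; split=> //; lia.
by have [|f0 [[<-|[]] h]] := genus_classes _ hf; first by left.
Qed.

End Representations.

(* The algebra library binds this key to its own integers. *)
Delimit Scope Z_scope with Z.

(** * Small numbers *)

Fixpoint is_sum (l : seq nat) (n : nat) : Prop :=
  if l is c :: l' then exists x m, n = c * P5 x + m /\ is_sum l' m else n = 0.

Lemma P5S x : P5 x.+1 = P5 x + (3 * x + 1).
Proof.
have hx : x <= x * x by case: x => // x; exact: leq_pmull.
rewrite /P5 -!mulnn (_ : 3 * (x.+1 * x.+1) - x.+1 = 3 * (x * x) - x + (3 * x + 1) * 2) ?divnMDl //.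
  by rewrite divnDMl.
by rewrite mulSn mulnS; lia.
Qed.

Lemma represented_is_sum a N : represented a N <-> is_sum a N.
Proof.
elim: a N => [|c a IH] N; rewrite /represented /P5a /=.
  by split=> [[x <-]|->]; [rewrite big_ord0 | exists id; rewrite big_ord0].
split=> [[x <-]|[x [m [-> /IH [y <-]]]]].
  exists (x 0), (P5a a (x \o succn)); rewrite big_ord_recl; split=> //.
  by apply/IH; exists (x \o succn).
by exists (fun i => if i is i'.+1 then y i' else x); rewrite big_ord_recl.
Qed.

Lemma is_sum_swap c d l n : is_sum [:: c, d & l] n -> is_sum [:: d, c & l] n.
Proof.
by move=> [x [_ [-> [y [m [-> h]]]]]]; exists y, (c * P5 x + m); split; [lia | exists x, m].
Qed.

(** Lets the coefficient singled out in the finite check be any of the four. *)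
Lemma is_sum_insert c l1 l2 n : is_sum (c :: l1 ++ l2) n -> is_sum (l1 ++ c :: l2) n.
Proof.
elim: l1 n => // d l1 IH n /is_sum_swap [x [m [-> h]]].
by exists x, m; split=> //; apply: IH.
Qed.

(** A linked bit string read from [0] upwards: removing a prefix returns a shared suffix without
    copying, which suits sliding windows. *)
Inductive bits := Empty | Zero of bits | One of bits.

Fixpoint has_bit (s : bits) (n : nat) : bool :=
  match s, n with
  | Empty, _ => false
  | Zero _, 0 => false
  | One _, 0 => true
  | Zero s', n'.+1 => has_bit s' n'
  | One s', n'.+1 => has_bit s' n'
  end.

(** Cutting at [w] bounds the work. Elements may be lost but never invented, so a check can fail
    wrongly but not succeed wrongly. *)
Fixpoint union (w : nat) (s t : bits) : bits :=
  match w with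
  | 0 => Empty
  | w'.+1 =>
    match s, t with
    | Empty, Empty => Empty
    | Empty, Zero t' => Zero (union w' Empty t')
    | Empty, One t' => One (union w' Empty t')
    | Zero s', Empty => Zero (union w' s' Empty)
    | One s', Empty => One (union w' s' Empty)
    | Zero s', Zero t' => Zero (union w' s' t')
    | Zero s', One t' => One (union w' s' t')
    | One s', Zero t' => One (union w' s' t')
    | One s', One t' => One (union w' s' t')
    end
  end.

Fixpoint raise (d : nat) (s : bits) : bits := if d is d'.+1 then Zero (raise d' s) else s.

Fixpoint drop_bits (d : nat) (s : bits) : bits :=
  match d, s with
  | 0, _ => s
  | _, Empty => Empty
  | d'.+1, Zero s' => drop_bits d' s'
  | d'.+1, One s' => drop_bits d' s'
  end.

Fixpoint full (w : nat) (s : bits) : bool :=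
  match w, s with
  | 0, _ => true
  | w'.+1, One s' => full w' s'
  | _, _ => false
  end.

Lemma has_union w s t n : has_bit (union w s t) n -> has_bit s n || has_bit t n.
Proof. by elim: w s t n => // w IH [|s|s] [|t|t] [|n] //= /IH; rewrite ?orbF. Qed.

Lemma has_raise d s n : has_bit (raise d s) n -> exists2 m, n = d + m & has_bit s m.
Proof.
elim: d n => [|d IH] n; first by exists n.
by case: n => //= n /IH [m -> h]; exists m.
Qed.

Lemma has_drop_bits d s n : has_bit (drop_bits d s) n = has_bit s (d + n).
Proof. by elim: d s => // d IH [|s|s] /=; rewrite ?IH. Qed.

Lemma full_has_bit w s n : full w s -> n < w -> has_bit s n.
Proof. by elim: w s n => // w IH [|s|s] [|n] //= h1 h2; apply: IH. Qed.

(* The translates of [s] by [c * (P5 y - P5 x)] for [y >= x], cut at [w]. *)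
Fixpoint translates (c w : nat) (s : bits) (i x : nat) : bits :=
  match w, i with
  | 0, _ => Empty
  | _, 0 => Empty
  | _, i'.+1 =>
      let d := c * (3 * x + 1) in
      union w s (raise d (translates c (w - d) s i' x.+1))
  end.

Lemma has_translates c s i : forall w x n, has_bit (translates c w s i x) n ->
  exists y m, c * P5 x + n = c * P5 y + m /\ has_bit s m.
Proof.
elim: i => [|i IH] [|w] x n //; cbn [translates].
case/has_union/orP => [h|]; first by exists x, n.
case/has_raise => m -> /IH [y [m' [e h]]]; exists y, m'; split=> //.
by rewrite -e P5S; lia.
Qed.

Fixpoint sums (w i : nat) (l : seq nat) : bits :=
  if l is c :: l' then translates c w (sums w i l') i 0 else One Empty.

Lemma has_sums w i l n : has_bit (sums w i l) n -> is_sum l n.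
Proof.
elim: l n => [[|n] //|c l IH] n /= /has_translates [y [m [e h]]].
by exists y, m; split; [rewrite -e muln0 | apply: IH].
Qed.

(* Tests whether the block of length [w] starting at [c * P5 x] is covered by
   [acc] and by the sums [c * P5 y' + m], [y' <= y], where [s] is the set of the
   [m] seen from [c * P5 x - c * P5 y]. *)
Fixpoint block (c w : nat) (acc s : bits) (i y : nat) : bool :=
  let acc' := union w acc s in
  if full w acc' then true else
  match i, y with
  | i'.+1, y'.+1 => block c w acc' (drop_bits (c * (3 * y' + 1)) s) i' y'
  | _, _ => false
  end.

Lemma block_sound c w (Q : nat -> Prop) lo s0 :
    (forall y m, has_bit s0 m -> Q (c * P5 y + m)) ->
  forall i acc s y, c * P5 y <= lo ->
    (forall n, has_bit acc n -> Q (lo + n)) ->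
    (forall n, has_bit s n -> has_bit s0 (lo - c * P5 y + n)) ->
  block c w acc s i y -> forall n, n < w -> Q (lo + n).
Proof.
move=> hQ; elim=> [|i IH] acc s y hy hacc hs /=.
all: have hacc' n : has_bit (union w acc s) n -> Q (lo + n)
  by case/has_union/orP => [/hacc //|/hs/(hQ y)]; rewrite addnA subnKC.
all: case: ifP => [h _ n hn|_]; first by apply/hacc'/(full_has_bit h).
  by [].
case: y hy hs => // y hy hs.
have hy' : c * P5 y + c * (3 * y + 1) <= lo by rewrite -mulnDr -P5S.
apply: IH => //; first by lia.
by move=> n; rewrite has_drop_bits => /hs; rewrite P5S; congr has_bit; lia.
Qed.

(** Blocks are cut at the values [c * P5 x], so that the first translate tried in a block is [s]
    itself and [e] holds the exceptions seen from its start. *)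
Fixpoint blocks (c : nat) (e s : bits) (i k x : nat) : bool :=
  if k is k'.+1 then
    let w := c * (3 * x + 1) in
    if block c w e s i x then blocks c (drop_bits w e) s i k' x.+1 else false
  else true.

Lemma blocks_sound c (Q : nat -> Prop) s :
    (forall y m, has_bit s m -> Q (c * P5 y + m)) ->
  forall i k e x, (forall n, has_bit e n -> Q (c * P5 x + n)) -> blocks c e s i k x ->
  forall n, c * P5 x <= n -> n < c * P5 (x + k) -> Q n.
Proof.
move=> hs i; elim=> [|k IH] e x he /=; first by rewrite addn0 => _ n h1 h2; lia.
case: ifP => // hb hk n h1 h2.
have [h3|h3] := ltnP n (c * P5 x.+1).
  rewrite -(subnKC h1); apply: (block_sound hs (leqnn _) he _ hb).
  - by move=> m; rewrite subnn.
  - by rewrite P5S in h3; lia.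
apply: (IH _ x.+1 _ hk) => //; last by rewrite addSnnS.
by move=> m; rewrite has_drop_bits => /he; rewrite P5S; congr Q; lia.
Qed.

Definition set_of (w : nat) (l : seq nat) : bits :=
  foldr (fun e s => union w (raise e (One Empty)) s) Empty l.

Lemma has_set_of w l n : has_bit (set_of w l) n -> n \in l.
Proof.
elim: l => // e l IH; rewrite inE => /has_union/orP[/has_raise [[|m] -> //=]|/IH ->]; last by rewrite orbT.
by rewrite addn0 eqxx.
Qed.

(** The coefficient at [j] moves, while the sums of the other three are tabulated below [w]. The
    width 200 exceeds all exceptions. *)
Definition finite_check (a E : seq nat) (j w i k : nat) : bool :=
  blocks (nth 0 a j) (set_of 200 E) (sums w i (take j a ++ drop j.+1 a)) i k 0.

Lemma finite_check_sound a E j w i k n : j < size a -> finite_check a E j w i k ->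
  n < nth 0 a j * P5 k -> is_sum a n \/ n \in E.
Proof.
move=> hj h hn.
have hs y m : has_bit (sums w i (take j a ++ drop j.+1 a)) m ->
    is_sum a (nth 0 a j * P5 y + m) \/ nth 0 a j * P5 y + m \in E.
  move=> /has_sums hm; left; rewrite -{1}(cat_take_drop j a) (drop_nth 0 hj).
  by apply: is_sum_insert; exists y, m.
have he m : has_bit (set_of 200 E) m ->
    is_sum a (nth 0 a j * P5 0 + m) \/ nth 0 a j * P5 0 + m \in E.
  by move=> /has_set_of; rewrite muln0; right.
by apply: (@blocks_sound _ (fun n => is_sum a n \/ n \in E) _ hs _ _ _ _ he h); rewrite ?muln0 ?add0n.
Qed.

(** The values below [P5 10 = 145]; every exception is smaller than that, which is the origin of the
    bound 145. *)
Definition pentagonals : seq nat := [:: 0; 1; 5; 12; 22; 35; 51; 70; 92; 117].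

Lemma small_pentagonals x : P5 x < 145 -> P5 x \in pentagonals.
Proof.
do 10 (case: x => [|x] //); move=> h; suff : 145 <= P5 x.+4.+4.+2 by lia.
by elim: x {h} => // x; rewrite [P5 x.+1.+4.+4.+2]P5S; lia.
Qed.

Fixpoint is_sumb (l : seq nat) (n : nat) : bool :=
  if l is c :: l' then has (fun p => (c * p <= n) && is_sumb l' (n - c * p)) pentagonals else n == 0.

Lemma is_sumbP l n : all (leq 1) l -> n < 145 -> is_sum l n -> is_sumb l n.
Proof.
elim: l n => [|c l IH] n; first by move=> _ _ ->.
move=> /andP[c0 hl] hn [x [m [e h]]].
have hx : P5 x <= c * P5 x by apply: leq_pmull.
suff : has (fun p => (c * p <= n) && is_sumb l (n - c * p)) pentagonals by [].
apply/hasP; exists (P5 x); first by apply: small_pentagonals; lia.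
by rewrite e leq_addr addKn IH //; lia.
Qed.

(** * The certificates *)

Section Data.
Import ListNotations.
Local Open Scope Z_scope.
Local Open Scope list_scope.

(** This is Cauchy's lemma: with [3 m = 2 N + b], the number [n = 4 m - b^2] is a sum of three
    squares [x^2 + y^2 + z^2], and the [4 x_i] are [b] plus signed sums of [x], [y], [z]. *)
Definition cert_1_1_1_1 : cert :=
Cert (Coeffs 1 1 1) 6 31 498 1 [0] [(Plan 1 4 1 Squares
[[orbit_part 2 2 4 8 4 4 1 [(3,1); (7,1); (4,2); (7,2); (0,0); (7,0)]]] [signed [(-1,-1,1,1,-1,-1,-1,1,-1)]]
1 3 24 8 3 12 1 [0])].

Definition cert_1_1_1_2 : cert :=
Cert (Coeffs 1 1 2) 6 40 612 1 [0] [(Plan 1 2 5 (Ramified [2; 3]) [[orbit_part 5 1 5 1 5 5 25 [(0,1)]]]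
[signed [(1,-1,-1,-1,-1,-1,0,1,0)]] 5 6 30 25 3 30 1 [0])].

Definition cert_1_1_1_3 : cert :=
Cert (Coeffs 1 1 3) 9 82 2028 3 [0; 1; 2] [(Plan 1 6 3 Coprime [[orbit_part 2 1 2 4 2 2 1 [(1,1); (0,0)];
orbit_part 3 1 3 9 3 3 1 [(2,1); (5,1); (6,1); (8,1); (0,0); (3,0); (6,0)]]] [signed [(1,1,-3,1,-2,0,-1,0,0);
(1,2,0,1,-1,-3,-1,0,0); (1,1,-3,-2,1,0,0,-1,0); (1,-1,3,-2,-1,0,0,1,0)]]
1 3 108 36 9 18 3 [1; 2]); (Plan 1 6 3 (Ramified [1]) [[orbit_part 2 1 2 4 2 2 1 [(1,1); (0,0)];
orbit_part 3 1 3 9 3 3 1 [(2,1); (5,1); (6,1); (8,1); (0,0); (3,0); (6,0)]]] [signed [(1,1,-3,1,-2,0,-1,0,0);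
(1,2,0,1,-1,-3,-1,0,0); (1,1,-3,-2,1,0,0,-1,0); (1,-1,3,-2,-1,0,0,1,0)]] 1 3 108 36 9 18 3 [0])].

Definition cert_1_1_1_4 : cert :=
Cert (Coeffs 1 1 4) 9 98 2403 1 [0] [(Plan 2 28 1 Squares [[orbit_part 2 1 2 4 1 1 1 [(0,0); (2,0)];
orbit_part 7 1 7 1 1 7 49 [(0,1); (0,0)]]] [unsigned [(2,2,4,-2,-4,2,-1,1,-1); (-2,2,4,2,4,-2,-1,-1,-1);
(-2,-2,-4,2,-4,2,-1,1,1); (4,2,2,2,-2,-4,-1,-1,1); (-2,4,2,-4,-2,-2,1,-1,1); (-2,-4,-2,-4,2,2,1,1,-1);
(-4,2,-2,-2,-2,4,1,-1,-1); (2,-4,-2,-2,2,-4,1,1,1)]] 1 3 24 8 12 24 1 [0])].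

Definition cert_1_1_2_2 : cert :=
Cert (Coeffs 1 2 2) 6 50 757 1 [0] [(Plan 1 6 1 Squares [[orbit_part 2 1 2 4 2 2 1 [(1,1); (0,0)];
orbit_part 3 1 3 3 3 3 1 [(2,1); (0,0)]]] [unsigned [(0,2,-1,0,-1,-1,-1,0,1); (1,2,0,1,-1,0,-1,0,-1);
(0,-1,2,-1,1,0,0,-1,-1); (2,-1,0,-1,-1,0,0,1,1); (2,0,-1,-1,0,-1,0,1,1); (-2,0,-1,1,0,-1,0,-1,1);
(0,1,2,1,-1,0,0,1,-1); (-1,2,0,-1,-1,0,1,0,1); (1,0,2,-1,1,0,1,0,-1); (1,-2,0,-1,0,1,1,1,0);
  (-2,0,1,0,1,-1,1,0,1);
(0,-1,-2,0,-1,1,1,1,0)]] 1 3 72 24 6 12 1 [0])].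

Definition cert_1_1_2_3 : cert :=
Cert (Coeffs 1 2 3) 6 60 902 1 [0] [(Plan 3 6 7 (Ramified [1; 2; 4]) [[orbit_part 3 1 3 3 1 1 1 [(0,0)];
orbit_part 7 1 7 1 7 7 49 [(0,1)]]] [signed [(0,0,6,1,1,-1,-1,0,-1); (0,0,-6,-1,1,1,0,-1,1);
  (0,0,6,-1,-1,-1,0,1,-1);
(2,1,-1,-1,1,-1,0,-1,-1)]; signed [(0,3,3,-1,0,-2,0,-1,1); (2,0,2,-1,0,2,0,-1,-2); (2,-1,1,-1,-1,1,0,0,-2);
(2,1,2,-1,1,2,0,0,-2)]] 7 2 42 147 3 42 1 [0])].

Definition cert_1_1_2_4 : cert :=
Cert (Coeffs 1 2 4) 6 70 1047 1 [0] [(Plan 2 16 1 Squares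
[[orbit_part 2 4 16 32 8 8 1 [(7,1); (14,1); (15,1); (28,1); (7,2); (24,2); (28,2); (7,4); (28,4); (0,0);
  (7,0); (28,0)]]]
[signed [(-1,3,2,1,1,-2,-1,-1,0); (-1,3,-2,1,1,2,-1,-1,0); (-1,-3,2,1,-1,-2,-1,1,0); (3,2,-1,1,-2,1,-1,0,-1);
(3,2,1,1,-2,-1,-1,0,1); (3,-2,-1,1,2,1,-1,0,-1); (3,-2,1,1,2,-1,-1,0,1); (3,1,-2,1,-1,2,-1,1,0);
(2,3,-1,-2,1,1,0,-1,-1); (2,3,1,-2,1,-1,0,-1,1); (2,-3,-1,-2,-1,1,0,1,-1); (2,1,-3,-2,-1,-1,0,1,1)]]
2 3 48 32 3 24 1 [0])].

Definition cert_1_1_2_5 : cert :=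
Cert (Coeffs 1 2 5) 27 426 33976 30 [0; 1; 2; 3; 4; 5; 6; 7; 8; 9; 10; 11; 12; 13; 14; 15; 16; 17; 18; 19; 20;
  21; 22; 23; 24; 25; 26; 27; 28; 29]
[(Plan 3 162 5 Coprime [[orbit_part 3 3 27 27 9 9 1 [(9,3); (18,3); (0,0); (18,0)]]]
[signed [(-3,5,-15,6,-7,-6,-3,-1,3); (6,6,18,6,-3,-9,-3,-3,0); (6,-6,12,6,3,-6,-3,-3,-3);
  (6,14,2,6,-7,-1,-3,-1,-4);
(6,-14,-12,6,7,6,-3,1,-3); (6,-6,-18,6,3,9,-3,3,0); (11,1,8,-4,7,11,-1,-5,-4); (11,1,-7,-4,7,-4,-1,-5,-1);
(11,-1,7,-4,-7,4,-1,5,1); (11,-1,-8,-4,-7,-11,-1,5,4); (3,15,15,-6,-3,6,0,0,-6); (3,-15,0,-6,3,9,0,0,-6);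
(-9,11,3,0,-1,12,0,-4,-6); (-9,9,-3,0,-9,-12,0,0,6); (-9,1,13,0,-11,-8,0,4,-2)]]
1 6 810 135 45 270 3 [0]); (Plan 2 72 5 Coprime [[orbit_part 2 1 2 4 1 1 1 [(0,0); (3,0)];
orbit_part 3 2 9 9 9 9 1 [(4,1); (0,0)]]] [unsigned [(4,-4,8,0,-6,-8,-2,2,2); (6,-6,2,0,6,8,-2,-2,-2);
(-2,-10,0,4,-2,-6,-2,2,0); (-2,-10,-10,4,-2,4,-2,2,2); (4,-4,-12,4,2,6,-2,-2,0); (-1,1,13,-1,7,1,-1,-3,-3);
(8,0,0,-1,3,9,-1,-3,-3); (8,0,0,-1,3,-6,-1,-3,0); (2,10,0,-4,-2,-6,0,0,4); (6,6,8,-4,2,6,0,0,-4);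
(6,-6,-8,0,6,-2,0,0,4); (-8,0,0,1,3,9,1,1,-3); (1,1,-12,1,7,6,1,-3,0); (1,-11,-8,1,3,-6,1,1,4);
(-4,4,-8,-4,-2,4,2,-2,-2); (-4,4,12,-4,-2,-6,2,-2,0); (-4,-4,-12,-4,2,6,2,2,0); (-4,-4,8,-4,2,-4,2,2,2);
(2,-10,-10,-4,-2,4,2,2,2); (-6,-6,-8,0,6,-2,2,-2,0); (-4,-4,-12,0,-6,2,2,2,0)]]
1 6 1080 180 60 360 30 [1; 2; 4; 5; 7; 8; 10; 11; 13; 14; 16; 17; 19; 20; 22; 23; 25; 26; 28; 29])].

Definition cert_1_1_2_6 : cert :=
Cert (Coeffs 1 2 6) 18 312 16174 1 [0] [(Plan 2 24 5 (Ramified [2; 3])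
[[orbit_part 2 2 4 8 2 2 1 [(3,1); (7,1); (0,0); (4,0)]; orbit_part 5 1 5 1 5 5 25 [(0,1)]]]
[signed [(3,1,-5,0,4,4,-1,-1,-1); (0,6,6,3,-1,0,-1,-1,0); (0,-6,-6,3,1,0,-1,1,0); (0,-2,-8,3,1,1,-1,1,1);
(0,6,6,-2,-2,2,0,0,-2); (0,6,0,-2,-2,-4,0,0,2)]] 5 9 360 200 18 180 1 [0])].

Definition cert_1_1_2_7 : cert :=
Cert (Coeffs 1 2 7) 81 1637 401640 1 [0] [(Plan 1 198 7 Coprime [[orbit_part 11 1 11 1 1 11 121 [(0,1);
  (0,0)]]]
[unsigned [(2,-8,28,5,7,7,-3,0,-3); (6,-12,0,7,5,7,-3,0,3); (-2,-13,7,9,0,0,-2,2,4);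
  (8,-2,-28,-7,-5,-7,0,3,3);
(2,1,35,5,7,-7,0,-3,-3); (-8,2,-28,7,5,-7,0,-3,3); (-8,-2,28,7,-5,7,0,3,-3); (-6,9,-21,-7,-2,14,2,-2,-4);
(6,-9,-21,-7,2,-14,2,2,4); (-9,6,21,2,-7,14,2,2,-4); (-6,-12,0,-7,5,-7,3,0,-3); (-6,12,0,-3,-3,-21,3,0,3)];
unsigned [(-6,-6,18,7,-8,-4,-2,1,-4); (6,6,24,7,-6,-10,-2,3,-1); (-2,10,-16,9,0,0,-2,1,5);
  (6,6,-18,-7,-6,-10,0,3,6);
(12,3,-9,-3,12,6,0,-3,3); (6,-6,18,3,12,6,0,-3,-6); (-12,-3,9,5,-7,7,0,0,-6); (2,-17,-19,5,7,-7,0,0,6);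
(-6,6,24,7,-6,4,0,3,-3); (2,18,16,-9,0,0,2,-3,1); (-6,15,-3,-7,-8,-4,2,1,5); (6,-15,-18,-7,-6,4,2,3,4)]]
1 54 378 7 189 378 1 [0])].

Definition cert_1_1_2_8 : cert :=
Cert (Coeffs 1 2 8) 36 784 83641 1 [0] [(Plan 3 432 1 Squares
[[orbit_part 2 2 4 8 4 4 1 [(7,1); (5,2); (7,2); (0,0); (4,0); (7,0)];
orbit_part 3 2 9 9 3 3 1 [(2,1); (0,0); (3,0); (6,0)]]; [orbit_part 2 2 4 8 4 4 1 [(2,0); (6,0)];
orbit_part 3 2 9 9 3 3 1 [(0,0)]]; [orbit_part 2 2 4 8 4 4 1 [(3,2)]; orbit_part 3 2 9 9 3 3 1 [(2,1);
  (0,0)]]]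
[signed [(2,14,14,10,-8,4,-4,-1,-1); (2,-14,-14,10,8,-4,-4,1,1); (10,-14,-10,10,4,8,-4,-1,1);
(10,14,10,10,-4,-8,-4,1,-1); (6,18,6,0,-6,12,-3,0,-3); (6,18,-6,0,-6,-12,-3,0,3); (-6,18,6,12,0,6,-3,-3,0);
(-6,-6,18,12,-6,0,-3,0,-3); (-6,-18,6,12,0,6,-3,3,0); (6,6,18,12,0,-6,-3,-3,0); (6,18,-6,12,-6,0,-3,0,3);
(6,-6,18,12,0,-6,-3,3,0); (10,10,-14,-8,10,4,-1,-4,-1); (10,14,-10,-8,-4,-10,-1,1,4);
  (-10,-10,-14,0,12,-6,-1,-1,4);
(-10,10,14,0,-12,6,-1,1,-4); (-14,10,-10,4,10,8,-1,-4,1); (-14,-10,-10,4,-10,8,-1,4,1);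
  (14,14,2,4,-8,10,-1,-1,-4);
(-6,-6,18,12,-6,0,-1,4,-1); (-6,18,6,-6,0,-12,0,-3,3); (-6,-6,18,-6,12,0,0,-3,-3); (-6,-6,-18,-6,12,0,0,-3,3);
(18,6,6,-6,0,12,0,-3,-3)]] 1 12 864 72 36 144 1 [0])].

Definition cert_1_1_2_9 : cert :=
Cert (Coeffs 1 2 9) 54 1295 209306 1 [0] [(Plan 1 18 13 (Ramified [2; 5; 6; 7; 8; 11])
[[orbit_part 13 1 13 1 13 13 169 [(0,1)]]] [signed [(3,3,6,-2,1,5,0,0,-2)]; signed [(0,-6,0,3,1,-3,-1,0,0)]]
13 54 702 169 27 702 1 [0])].

Definition cert_1_1_3_3 : cert :=
Cert (Coeffs 1 3 3) 18 244 12742 1 [0] [(Plan 3 24 3 (Ramified [1]) [[orbit_part 2 3 8 16 8 8 1 [(5,1);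
  (4,2)];
orbit_part 3 1 3 9 1 1 1 [(0,0); (3,0); (6,0)]]] [signed [(0,-3,-6,2,1,0,-2,1,0); (3,0,-6,-1,2,0,-1,-2,0);
(3,0,6,1,1,-3,-1,-2,0); (3,3,-3,1,-1,3,-1,-1,-3); (3,-3,3,1,2,0,-1,-1,-3); (3,-3,3,1,1,-3,-1,1,3);
(0,3,6,2,-1,0,-1,1,-3); (0,3,-6,2,-1,0,-1,1,3)]] 1 1 144 144 9 72 1 [0])].

Definition cert_1_1_3_4 : cert :=
Cert (Coeffs 1 3 4) 9 129 3106 3 [0; 1; 2] [(Plan 1 36 3 Coprime
[[orbit_part 3 2 9 27 9 9 1 [(2,1); (6,1); (11,1); (15,1); (20,1); (24,1); (6,3); (9,3); (18,3); (0,0); (6,0);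
  (18,0)]]]
[signed [(1,2,-9,1,2,3,-2,-1,0); (-4,2,-6,2,-1,-3,-1,-1,3); (-4,-2,6,2,1,3,-1,1,-3); (-4,-2,-6,2,1,-3,-1,1,3);
(-4,-4,0,2,-1,-3,-1,2,0); (2,5,-3,2,-1,3,-1,-1,-3)]] 1 12 324 27 18 108 3 [1; 2]); (Plan 4 324 3 Coprime
[[orbit_part 2 2 4 8 1 1 1 [(0,0)];
orbit_part 3 2 9 27 9 9 1 [(6,1); (15,1); (24,1); (1,3); (2,3); (4,3); (6,3); (8,3); (11,3); (13,3); (23,3);
  (25,3); (0,0); (2,0); (3,0); (6,0); (8,0); (9,0); (18,0)]]]
[signed [(3,-6,27,3,-6,-9,-6,3,0); (6,-12,-18,-3,6,-9,-3,-3,9); (6,12,18,-3,-6,9,-3,3,-9);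
  (6,12,-18,-3,-6,-9,-3,3,9);
(-12,-6,18,6,3,9,-3,3,-9); (6,3,27,6,3,-9,-3,-6,0); (6,15,-9,6,-3,9,-3,-3,-9); (6,15,9,6,-3,-9,-3,-3,9);
(6,-12,18,6,6,0,-3,-3,-9); (6,12,-18,6,-6,0,-3,3,9)]] 4 27 1458 216 81 486 3 [0])].

Definition cert_1_1_3_5 : cert :=
Cert (Coeffs 1 3 5) 18 312 16174 1 [0] [(Plan 1 30 5 Coprime [[orbit_part 2 1 2 4 2 2 1 [(3,1); (0,0)];
orbit_part 5 1 5 25 5 5 1 [(3,1); (5,1); (8,1); (13,1); (18,1); (20,1); (23,1); (0,0); (5,0); (10,0)]]]
[signed [(0,3,-6,0,3,4,-1,-2,-1); (5,2,1,0,-3,1,-1,2,1); (-3,6,3,2,1,3,-1,-2,-1); (2,1,8,2,1,-2,-1,-2,-1);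
(2,-1,-8,2,-1,2,-1,2,1); (3,6,3,-2,1,3,0,-1,-3)]] 1 9 900 100 45 450 1 [0])].

Definition cert_1_1_3_6 : cert :=
Cert (Coeffs 1 3 6) 18 346 17890 1 [0] [(Plan 3 18 11 (Ramified [1; 3; 4; 5; 9]) [[orbit_part 3 1 3 3 1 1 1
  [(1,0)];
orbit_part 11 1 11 1 11 11 121 [(0,1)]]] [signed [(0,-3,9,2,0,-2,-1,0,-2); (0,3,-9,2,0,2,-1,0,2);
(-3,0,9,0,-2,-2,0,1,-2)]; signed [(0,6,6,2,-1,0,-1,-1,0); (0,-6,-6,2,1,0,-1,1,0); (-3,3,-3,0,2,4,0,-2,-1)]]
11 6 198 363 9 198 1 [0])].

Definition cert_1_1_3_7 : cert :=
Cert (Coeffs 1 3 7) 36 784 83641 3 [0; 1; 2] [(Plan 1 36 7 Coprime [[orbit_part 2 2 4 8 4 4 1 [(1,1)];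
orbit_part 3 1 3 3 3 3 1 [(0,0); (2,0)]]] [signed [(2,-1,14,0,3,0,-1,-1,-1); (2,-1,-14,0,3,0,-1,-1,1);
(2,1,-14,0,-3,0,-1,1,1); (5,1,-7,0,-3,0,-1,1,-1); (-1,-5,-7,1,-1,7,-1,1,-1); (5,-1,-7,1,1,7,-1,-1,-1);
(5,-1,7,1,1,-7,-1,-1,1); (5,1,7,1,-1,-7,-1,1,1); (-1,5,-7,3,0,0,-1,-1,-1); (-1,5,7,3,0,0,-1,-1,1);
(-1,-5,-7,3,0,0,-1,1,-1); (-1,-2,-14,3,0,0,-1,1,1)]; signed [(-1,-1,10,1,4,2,-1,-1,-2);
  (-1,6,10,1,-3,2,-1,0,-2);
(-1,6,-4,1,-3,-5,-1,0,2); (-1,-6,4,1,3,5,-1,0,-2); (-1,1,-10,1,-4,-2,-1,1,2); (5,-3,2,1,3,-2,-1,0,2);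
(5,4,2,1,-4,-2,-1,1,-1); (-1,-1,-11,3,0,0,-1,-1,1); (-1,8,4,3,0,0,-1,-1,-2); (-1,6,10,3,0,0,-1,0,-2);
(-1,6,-4,3,0,0,-1,0,2); (-1,-8,-4,3,0,0,-1,1,-1)]] 1 9 1512 168 63 252 3 [0]); (Plan 6 144 7 Coprime
[[orbit_part 2 3 8 16 4 4 1 [(4,2); (0,0)]; orbit_part 3 2 9 9 3 3 1 [(6,1)]]] [signed
  [(4,-2,28,0,6,0,-2,-2,-2);
(4,2,28,0,-6,0,-2,2,-2); (4,2,-28,0,-6,0,-2,2,2); (10,-2,14,0,6,0,-2,-2,2); (-2,11,-7,2,-2,-14,-2,-1,5);
(-2,-11,7,2,2,14,-2,1,-5); (10,-2,14,2,2,-14,-2,1,5); (-2,10,-14,6,0,0,-2,-2,-2); (-2,10,14,6,0,0,-2,-2,2);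
(-2,11,7,6,0,0,-2,-1,-5); (-2,-4,28,6,0,0,-2,2,-2); (-2,-4,-28,6,0,0,-2,2,2); (2,10,-14,-2,2,14,-1,-2,-5);
(11,2,-7,-2,-2,-14,-1,2,5); (-4,-2,-28,0,6,0,-1,-2,5); (11,2,7,0,-6,0,-1,2,-5)]; signed
  [(-2,-2,-22,2,8,4,-2,-2,2);
(-2,12,20,2,-6,4,-2,0,-4); (-2,2,22,2,-8,-4,-2,2,-2); (-2,2,-20,2,-8,-4,-2,2,4); (-2,-9,-22,2,-6,4,-2,3,2);
(10,-6,-10,2,6,10,-2,-3,-1); (10,1,-10,2,-1,10,-2,-2,-4); (10,-8,-4,2,8,4,-2,-2,-4);
  (10,6,10,2,-6,-10,-2,0,4);
(10,-6,-10,2,6,10,-2,0,-4); (10,-6,4,2,6,-4,-2,0,4); (-2,12,-8,6,0,0,-2,-3,-2); (-2,-2,-22,6,0,0,-2,-2,2);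
(-2,2,22,6,0,0,-2,2,-2); (-2,2,-20,6,0,0,-2,2,4); (-2,-9,13,6,0,0,-2,3,1)]] 1 1 1008 1008 42 168 3 [1; 2])].

Definition cert_1_2_2_2 : cert :=
Cert (Coeffs 2 2 2) 15 173 7484 1 [0] [(Plan 1 14 1 Squares [[orbit_part 7 1 7 1 1 7 49 [(0,1); (0,0)]]]
[unsigned [(1,-2,0,0,1,2,-2,0,-1); (0,-2,-1,2,1,0,-1,0,2); (2,-1,0,-1,0,-2,0,2,1); (-2,1,0,1,0,-2,0,-2,1);
(-2,0,1,1,2,0,0,-1,-2); (-1,-2,0,2,0,1,0,1,-2); (0,2,-1,-2,-1,0,1,0,2); (0,-1,2,-1,2,0,2,0,-1)]]
1 6 48 8 24 48 1 [0])].

Definition cert_1_2_2_3 : cert :=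
Cert (Coeffs 2 2 3) 6 70 1047 1 [0] [(Plan 3 24 1 Squares
[[orbit_part 2 3 8 16 8 8 1 [(5,1); (7,1); (15,1); (4,2); (7,2); (7,4); (7,0)]; orbit_part 3 1 3 3 1 1 1
  [(0,0)]]]
[signed [(2,-2,-1,0,0,3,-2,0,-1); (2,1,-2,0,-3,0,-2,1,0); (2,1,2,0,-3,0,-2,1,0); (0,3,0,2,-1,-2,-2,-1,0);
(0,3,0,2,-1,2,-2,-1,0); (0,0,-3,2,-2,1,-2,0,1); (0,0,3,2,2,-1,-2,0,-1); (0,0,-3,2,2,1,-2,0,1);
(3,0,0,-1,-2,2,-1,0,-2); (3,0,0,-1,-2,-2,-1,0,2); (3,0,0,-1,2,-2,-1,0,2); (3,0,0,-1,-2,2,-1,2,0);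
(-1,2,-2,3,0,0,-1,-2,0); (-1,2,2,3,0,0,-1,-2,0); (-1,2,2,3,0,0,-1,0,-2); (-1,-2,-2,3,0,0,-1,2,0);
(0,3,0,-2,-1,2,0,-1,-2); (0,3,0,-2,-1,-2,0,-1,2); (0,-3,0,-2,1,-2,0,1,2); (0,0,-3,-2,-2,1,0,2,1);
(-2,2,-1,0,0,3,0,-2,-1); (-2,2,1,0,0,-3,0,-2,1); (-2,1,2,0,-3,0,0,1,-2); (-2,-2,-1,0,0,3,0,2,-1)]]
1 1 48 48 3 24 1 [0])].

Definition cert_1_2_2_4 : cert :=
Cert (Coeffs 2 2 4) 99 1614 488237 1 [0] [(Plan 1 36 1 Squares [[orbit_part 3 2 9 9 9 9 1 [(2,1); (0,0)]]]
[unsigned [(1,2,-3,1,2,3,-2,-1,0); (1,-3,2,1,3,2,-2,0,-1); (1,-2,3,1,-2,-3,-2,1,0); (1,3,2,3,-1,-2,-2,0,-1);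
(1,-2,3,3,2,-1,-2,1,0); (2,-1,-3,-2,-3,1,-1,2,0); (-2,1,3,2,-3,1,-1,0,-2); (1,-3,2,-3,-1,-2,0,2,1);
(-3,-2,1,3,-2,1,0,1,-2); (-3,-2,-1,3,-2,-1,0,1,2); (2,3,1,-2,1,-3,1,-2,0); (2,-3,-1,-2,-1,3,1,2,0);
(-2,3,1,2,-1,3,1,0,-2); (-2,-3,1,2,1,3,1,0,-2); (-2,-3,-1,2,1,-3,1,0,2); (-1,2,3,-3,-2,-1,2,-1,0);
(-1,-2,3,-3,2,-1,2,1,0); (-1,3,2,-1,-3,2,2,0,-1)]] 1 12 864 72 48 288 1 [0])].

Definition cert_1_2_2_5 : cert :=
Cert (Coeffs 2 2 5) 24 423 29753 1 [0] [(Plan 1 40 5 Coprime [[orbit_part 2 1 2 4 2 2 1 [(0,0); (3,0)];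
orbit_part 5 1 5 25 5 5 1 [(1,1); (5,1); (6,1); (11,1); (16,1); (20,1); (21,1); (0,0); (5,0); (10,0)]];
  [orbit_part 2 1 2 4 2 2 1 [(1,0); (2,0)];
orbit_part 5 1 5 25 5 5 1 [(5,1); (20,1); (0,0); (5,0); (10,0)]]] [signed [(2,-2,-6,2,-2,4,-2,0,0);
(2,2,-4,2,2,6,-2,0,0); (4,0,0,-1,5,5,-1,-1,-3); (-1,5,0,4,0,0,-1,-1,2)]] 1 12 1200 100 60 600 1 [0])].

Definition cert_1_2_2_6 : cert :=
Cert (Coeffs 2 2 6) 27 530 42031 1 [0] [(Plan 3 54 11 (Ramified [1; 3; 4; 5; 9])
[[orbit_part 3 1 3 3 1 1 1 [(0,0); (1,0)]; orbit_part 11 1 11 1 11 11 121 [(0,1)]]] [signed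
  [(3,0,12,2,-3,-10,-2,0,1);
(2,3,10,3,0,-12,-2,0,-1); (-3,2,10,0,3,-12,0,-2,-1); (-3,2,-10,0,3,12,0,-2,1)]; signed
  [(-3,-6,0,0,0,-9,0,3,3)]]
11 18 594 363 27 594 1 [0])].

Definition cert_1_2_3_3 : cert :=
Cert (Coeffs 2 3 3) 21 328 20133 9 [0; 1; 2; 3; 4; 5; 6; 7; 8] [(Plan 1 24 3 (Ramified [1])
[[orbit_part 3 2 9 27 9 9 1 [(3,1); (6,1); (15,1); (24,1); (6,3); (6,0)]]] [signed [(2,-2,-2,0,0,4,-2,0,-2);
(0,3,1,2,-1,1,-2,-1,1); (0,2,-4,2,0,2,-2,0,2); (-2,2,-2,2,0,-2,-1,-2,1); (0,-2,-4,2,0,2,-1,2,-1);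
(2,0,-4,-2,1,-1,0,-2,2); (2,2,-2,-2,0,-2,0,0,4); (2,0,4,-2,-1,1,0,2,-2); (-2,-2,-2,0,0,4,0,2,-2)]]
1 8 216 27 12 72 3 [1; 2]); (Plan 1 54 3 (Ramified [1])
[[orbit_part 3 2 9 27 9 9 1 [(6,1); (15,1); (24,1); (3,3); (6,3); (0,0); (6,0); (9,0); (18,0)]]]
[signed [(-3,3,-3,0,0,6,0,-3,-3)]] 1 18 486 27 27 162 9 [3; 6]); (Plan 1 486 3 Coprime
[[orbit_part 3 2 9 27 9 9 1 [(6,1); (15,1); (24,1); (6,3); (0,0); (1,0); (2,0); (3,0); (4,0); (6,0); (8,0);
  (9,0); (18,0)]]]
[unsigned [(9,9,-9,0,0,18,0,-9,-9)]] 1 162 4374 27 243 1458 9 [0])].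

Definition cert_1_2_3_4 : cert :=
Cert (Coeffs 2 3 4) 18 312 16174 1 [0] [(Plan 2 60 1 Squares [[orbit_part 2 2 4 8 2 2 1 [(6,1); (7,1); (0,0);
  (7,0)];
orbit_part 5 1 5 1 1 5 25 [(0,1); (0,0)]]] [unsigned [(2,2,4,2,1,-3,-3,0,0); (2,-4,2,2,3,1,-3,0,0);
(4,-2,2,-1,-2,-3,-2,1,2); (4,2,-2,-1,-3,-2,-2,2,1); (4,-2,2,1,3,-2,-2,-2,-1); (4,2,2,1,-2,-3,-2,-1,2);
(-2,4,-2,3,1,2,-2,-2,1); (-2,2,4,3,2,-1,-2,-1,-2); (-2,2,-4,3,2,1,-2,-1,2); (-2,-4,-2,3,-1,2,-2,2,1);
(2,2,-4,-2,-3,-1,-1,2,2); (2,-4,-2,-2,-1,3,-1,2,-2); (2,4,2,2,-1,-3,-1,-2,2); (2,-2,4,2,3,-1,-1,-2,-2);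
(2,2,-4,2,-3,1,-1,2,2); (2,-4,-2,2,1,3,-1,2,-2); (2,-2,-4,-3,-2,1,0,3,0); (4,-2,-2,-3,-1,-2,0,0,3);
(-2,2,-4,-1,2,3,0,-3,0); (4,2,2,-1,2,-3,0,-3,0); (4,2,2,-1,-3,2,0,0,-3); (-4,2,2,1,-3,2,0,0,-3);
(-2,4,-2,3,-1,-2,0,0,3); (-2,-2,-4,3,-2,1,0,3,0); (-2,-2,-4,-2,3,1,1,-2,2); (-2,-4,2,-2,1,-3,1,2,2);
(2,4,2,-3,-1,2,2,-2,-1); (2,-2,4,-3,2,1,2,1,-2); (2,-2,-4,-3,2,-1,2,1,2); (2,-4,2,-3,1,2,2,2,-1);
(-4,-2,2,-1,3,-2,2,-2,-1); (-4,2,-2,-1,-2,3,2,-1,-2); (-4,-2,-2,1,-2,3,2,1,-2); (-4,2,-2,1,-3,-2,2,2,1);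
(-2,-4,-2,-2,1,3,3,0,0); (-2,-4,-2,-2,3,-1,3,0,0)]] 2 9 36 8 9 18 1 [0])].

Definition cert_1_2_3_5 : cert :=
Cert (Coeffs 2 3 5) 72 1452 315957 1 [0] [(Plan 5 120 11 (Ramified [1; 3; 4; 5; 9])
[[orbit_part 5 1 5 5 1 1 1 [(0,0)]; orbit_part 11 1 11 1 11 11 121 [(0,1)]]] [signed
  [(0,6,-12,5,-2,-1,-3,-2,-1);
(0,-6,-12,0,4,-12,-2,0,10); (2,6,10,-4,-2,10,0,0,-12); (6,0,12,-4,0,12,0,-2,-10); (6,2,10,-2,-4,10,0,0,-12);
(6,0,-12,-2,-5,-1,0,2,10)]; signed [(6,6,0,1,-9,-5,-3,3,-1); (0,9,-6,0,-8,-8,-2,1,6);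
  (0,-12,-6,0,4,-8,-2,2,6);
(6,-6,0,-4,-6,0,0,6,4); (-2,8,12,-2,3,-8,0,-6,0); (6,4,-4,-2,7,8,0,-6,0)]] 55 72 792 605 36 792 1 [0])].

Definition cert_1_2_3_6 : cert :=
Cert (Coeffs 2 3 6) 36 784 83641 6 [0; 1; 2; 3; 4; 5] [(Plan 1 48 1 Squares
[[orbit_part 2 2 4 8 4 4 1 [(7,1); (3,2); (7,2); (0,0); (4,0); (7,0)]; orbit_part 3 1 3 3 3 3 1 [(2,1)]]]
[signed [(2,0,-4,2,-2,2,-2,0,0); (0,2,4,-2,2,-2,0,-2,0); (0,-4,2,-2,2,2,0,0,-2); (4,2,0,-2,2,2,0,-2,0);
(4,0,2,-2,2,2,0,0,-2); (4,-2,0,-2,-2,2,0,2,0)]] 1 12 288 24 12 48 6 [1; 5]); (Plan 1 108 1 Squares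
[[orbit_part 2 2 4 8 4 4 1 [(3,1); (7,1); (4,2); (7,2); (0,0); (7,0)];
orbit_part 3 1 3 3 3 3 1 [(0,0); (1,0); (2,0)]]] [signed [(3,0,-6,3,-3,3,-3,0,0); (0,-6,3,-3,3,3,0,0,-3);
(6,3,0,-3,3,-3,0,-3,0); (6,0,-3,-3,-3,-3,0,0,3)]] 1 27 648 24 27 108 3 [0]); (Plan 1 192 1 Squares
[[orbit_part 2 2 4 8 4 4 1 [(7,1); (7,2); (0,0); (1,0); (2,0); (3,0); (4,0); (5,0); (6,0); (7,0)];
orbit_part 3 1 3 3 3 3 1 [(2,1)]]] [signed [(4,0,-8,4,-4,4,-4,0,0); (0,4,8,-4,4,-4,0,-4,0);
  (0,-8,4,-4,4,4,0,0,-4);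
(8,4,0,-4,4,4,0,-4,0); (8,0,4,-4,4,4,0,0,-4); (8,-4,0,-4,-4,4,0,4,0)]] 1 48 1152 24 48 192 6 [2; 4])].

Definition cert_1_2_3_7 : cert :=
Cert (Coeffs 2 3 7) 27 634 50088 1 [0] [(Plan 1 78 7 Coprime [[orbit_part 13 1 13 1 1 13 169 [(0,1); (0,0)]]]
[unsigned [(1,5,-7,4,-2,0,-2,-1,-1); (1,-5,7,4,2,0,-2,1,1); (5,1,7,-2,4,0,-1,-2,1); (5,-1,-7,-2,-4,0,-1,2,-1);
(5,1,-7,-2,-3,-7,0,0,6); (5,-1,7,-2,3,7,0,0,-6); (-2,1,-14,-3,2,7,1,-2,1); (-2,-1,14,-3,-2,-7,1,2,-1);
(-5,1,-7,2,4,0,1,-2,-1); (-5,-1,7,2,-4,0,1,2,1); (-1,5,7,-4,-2,0,2,-1,1); (-1,-5,-7,-4,2,0,2,1,-1);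
(-1,2,14,-2,3,-7,2,-1,-1); (-1,-2,-14,-2,-3,7,2,1,1)]; unsigned [(1,8,4,2,-2,-8,-2,-1,1);
  (1,6,-4,2,-5,-6,-2,0,2);
(1,-6,4,2,5,6,-2,0,-2); (1,-8,-4,2,2,8,-2,1,-1); (1,1,-10,4,1,4,-2,1,2); (-1,-6,4,-2,-2,-8,0,3,3);
(5,4,2,-2,2,8,0,-3,-3); (5,-3,2,-2,-5,-6,0,3,0); (1,6,10,2,2,-6,0,-3,0); (-1,-1,-11,-4,-1,3,2,-1,1);
(-1,-6,-10,-4,1,4,2,0,2); (-1,8,4,-2,-2,6,2,-1,-2); (-1,6,10,-2,-5,1,2,0,-2); (-1,-8,-4,-2,2,-6,2,1,2)]]
1 18 126 7 63 126 1 [0])].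

Definition cert_1_2_3_8 : cert :=
Cert (Coeffs 2 3 8) 54 1401 226102 1 [0] [(Plan 4 96 7 (Ramified [1; 2; 4])
[[orbit_part 2 3 8 16 2 2 1 [(5,1); (4,0); (8,0)]; orbit_part 7 1 7 1 7 7 49 [(0,1)]]]
[signed [(0,6,6,4,0,-8,-2,-1,-1); (0,-6,-6,4,0,8,-2,1,1); (0,-6,6,4,2,6,-2,1,-1); (6,0,-6,0,4,8,-1,-2,1);
(6,0,6,0,-4,-8,-1,2,-1); (-4,4,8,0,-4,8,0,0,-6)]; signed [(0,6,12,4,-4,0,-2,-1,-2); (0,0,-12,4,-4,0,-2,0,2);
(0,0,-12,4,4,4,-2,0,2); (0,-6,6,4,4,4,-2,1,-1); (4,-6,-8,-4,-4,0,0,3,0); (4,-6,2,-4,-4,-4,0,3,3)]]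
7 9 1008 784 36 504 1 [0])].

Definition cert_1_2_3_9 : cert :=
Cert (Coeffs 2 3 9) 69 1934 400202 3 [0; 1; 2] [(Plan 1 270 3 Coprime
[[orbit_part 3 1 3 9 3 3 1 [(6,1); (0,0); (1,0); (2,0); (3,0); (4,0); (6,0); (8,0)];
orbit_part 5 1 5 1 1 5 25 [(0,1); (0,0)]]] [unsigned [(9,3,-9,3,-6,9,-3,0,-3); (9,3,9,-6,3,9,0,0,-6);
(-9,3,-9,3,-6,-9,0,0,6); (-9,-6,0,6,-6,0,0,3,-3); (-9,-3,-9,6,-3,-9,0,3,3); (-3,9,-9,-3,-6,-9,3,0,3)]]
1 54 486 9 81 162 3 [0]); (Plan 2 480 3 Coprime [[orbit_part 2 1 2 4 1 1 1 [(0,0); (1,0)];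
orbit_part 3 1 3 9 3 3 1 [(1,1); (4,1); (6,1); (7,1); (0,0); (6,0)];
orbit_part 5 1 5 1 1 5 25 [(0,1); (0,0)]]; [orbit_part 2 1 2 4 1 1 1 [(2,0); (3,0)];
orbit_part 3 1 3 9 3 3 1 [(6,1); (0,0); (6,0)]; orbit_part 5 1 5 1 1 5 25 [(0,1); (0,0)]]]
[signed [(12,4,12,2,4,-18,-4,0,4); (12,-4,12,4,8,-12,-4,0,4); (12,8,0,4,-10,6,-4,2,2);
  (0,14,-6,8,-4,-12,-4,-2,2);
(0,10,18,8,4,-12,-4,-2,-2); (0,4,24,8,-8,0,-4,0,-4); (0,-14,-6,8,4,-12,-4,2,2); (8,6,18,8,-4,-12,-4,-2,2);
(8,-12,0,8,8,0,-4,0,-4); (8,6,-18,8,-4,12,-4,2,2); (8,-6,-18,8,4,12,-4,2,-2); (0,-4,24,10,-4,-6,-4,0,-4);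
(4,12,-12,10,-4,6,-4,0,4); (-5,6,-21,10,-4,-6,-3,-2,5); (-5,-6,21,10,4,6,-3,2,-5); (3,14,-3,10,-4,6,-3,-2,-5);
(3,-14,-3,10,4,6,-3,2,-5); (6,8,18,-4,8,-12,-2,-4,2); (6,-5,21,-4,10,6,-2,-3,-5); (6,13,-3,-4,-2,-18,-2,-1,7);
(6,-13,-3,-4,2,-18,-2,1,7); (6,5,21,-4,-10,6,-2,3,-5); (6,-8,18,-4,-8,-12,-2,4,2); (14,0,6,-4,8,12,-2,-4,-2);
(14,3,3,-4,10,-6,-2,-3,5); (14,-3,3,-4,-2,18,-2,-1,-7); (14,3,-3,-4,2,-18,-2,1,7);
  (14,-3,-3,-4,-10,6,-2,3,-5);
(14,0,-6,-4,-8,-12,-2,4,2); (-6,8,18,4,8,-12,-2,-4,-2); (10,0,-18,4,-8,12,-2,4,2);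
  (-8,-12,0,10,-4,-6,-2,4,-2);
(-3,14,-3,-2,-4,-18,-1,-2,7); (-3,-14,-3,-2,4,-18,-1,2,7); (13,6,3,-2,-4,18,-1,-2,-7);
  (13,-6,-3,-2,4,-18,-1,2,7);
(4,0,-24,-8,8,0,0,-4,4); (4,-12,-12,-8,4,-12,0,0,8); (4,0,24,-8,-8,0,0,4,-4); (4,-12,12,-8,-4,-12,0,4,4);
(12,4,-12,-8,4,-12,0,0,8); (12,-8,0,-8,-8,0,0,4,4); (-4,-12,-12,-4,8,-12,0,0,8); (12,-4,-12,-4,8,-12,0,0,8)]]
1 24 864 36 144 288 3 [1; 2])].

Definition cert_1_2_4_4 : cert :=
Cert (Coeffs 2 4 4) 63 1268 240922 1 [0] [(Plan 4 32 11 (Ramified [1; 3; 4; 5; 9]) [[orbit_part 2 2 4 8 1 1 1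
  [(5,0)];
orbit_part 11 1 11 1 11 11 121 [(0,1)]]] [signed [(0,2,-10,2,-1,1,-2,-1,1); (0,-2,-10,2,1,1,-2,1,1);
(2,0,10,-1,-2,-1,-1,2,-1)]; signed [(0,-4,4,2,0,-2,-2,0,-2); (0,-6,-4,2,1,2,-2,1,2);
  (-2,-2,-6,1,-3,1,-1,3,3)]]
11 6 528 968 24 528 1 [0])].

Definition cert_1_2_4_6 : cert :=
Cert (Coeffs 2 4 6) 99 2397 717604 1 [0] [(Plan 1 156 1 Squares [[orbit_part 13 1 13 1 1 13 169 [(0,1);
  (0,0)]]]
[unsigned [(-1,7,-4,3,-3,-3,-3,-1,2); (7,-4,-1,-3,-3,3,-1,2,-3); (7,1,-4,-3,-3,-3,-1,3,2);
  (-1,-1,-8,-1,5,1,-1,-3,2);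
(1,-1,8,1,5,-1,1,-3,-2); (-5,5,4,3,3,-3,1,-3,2); (-5,-4,5,3,3,3,1,-2,-3); (-5,-5,-4,3,-3,3,1,3,-2);
(-4,-1,7,-3,3,-3,2,-3,-1); (-8,-1,1,1,5,1,2,-3,1); (1,8,-1,-5,-1,-1,3,-2,-1); (1,1,8,-5,1,-1,3,1,-2);
(-5,-4,-5,-3,3,3,3,-2,1); (-7,-1,4,-1,-1,-5,3,-1,2)]] 1 36 288 8 144 288 1 [0])].

Definition cert_1_2_4_7 : cert :=
Cert (Coeffs 2 4 7) 108 2832 924650 2 [0; 1] [(Plan 7 784 1 Squares [[orbit_part 2 1 2 4 2 2 1 [(1,0); (2,0);
  (3,0)];
orbit_part 7 2 49 49 7 7 1 [(42,1)]]] [signed [(16,-8,-4,2,6,10,-6,-4,-2); (16,-4,-8,2,10,6,-6,-2,-4);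
(16,4,-8,2,-10,6,-6,2,-4); (16,4,8,2,-10,-6,-6,2,4); (16,8,4,2,-6,-10,-6,4,2); (-4,8,16,10,-6,2,-6,-2,-4);
(-4,8,-16,10,-6,-2,-6,-2,4); (-4,-8,16,10,6,2,-6,2,-4); (-4,-8,-16,10,6,-2,-6,2,4);
  (-4,-16,8,10,-2,-6,-6,4,-2);
(16,-4,8,2,10,-6,-4,-6,-2); (16,8,-4,2,-6,10,-4,-2,-6); (16,-8,4,2,6,-10,-4,2,6); (-8,16,-4,6,2,10,-4,-6,-2);
(-8,-4,16,6,10,2,-4,-2,-6); (-8,-4,-16,6,10,-2,-4,-2,6); (-8,4,-16,6,-10,-2,-4,2,6);
  (-8,-16,-4,6,-2,10,-4,6,-2);
(-8,-16,4,6,-2,-10,-4,6,2); (8,-4,-16,-6,10,-2,-2,-6,4); (8,-16,-4,-6,-2,10,-2,4,-6);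
  (-4,16,-8,10,2,6,-2,-6,-4);
(-4,16,8,10,2,-6,-2,-6,4); (-4,-16,-8,10,-2,6,-2,6,-4)]] 7 24 1344 392 48 672 2 [0]); (Plan 126 63504 1
  Squares
[[orbit_part 2 2 4 8 2 2 1 [(2,0); (6,0)]; orbit_part 3 2 9 9 1 1 1 [(0,0)]; orbit_part 7 2 49 49 7 7 1
  [(21,1)]]]
[signed [(-24,156,48,18,-54,90,30,-6,-60); (-24,48,156,18,90,-54,30,-60,-6); (-24,48,-156,18,90,54,30,-60,6);
(-24,-48,156,18,-90,-54,30,60,-6); (-24,-156,48,18,54,90,30,6,-60); (4,-40,160,46,-82,-50,6,66,-12);
(4,160,-40,46,-50,-82,6,-12,66); (32,-124,-104,-10,86,-62,30,-6,60); (32,-104,124,-10,-62,-86,30,60,6);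
(60,-96,120,18,-54,-90,6,66,12); (60,120,-96,18,-90,-54,6,12,66); (60,120,96,18,-90,54,6,12,-66);
(60,96,120,18,54,-90,6,-66,12); (-60,-96,120,38,86,50,26,-34,-52); (-64,152,4,6,-30,102,44,-10,-50);
(-64,152,-4,6,-30,-102,44,-10,50); (-64,4,152,6,102,-30,44,-50,-10); (-64,-4,-152,6,-102,30,44,50,10);
(-64,-152,4,6,30,102,44,10,-50); (-64,-152,-4,6,30,-102,44,10,50); (104,-80,100,6,102,30,-4,-26,-62);
(104,80,-100,6,-102,-30,-4,26,62); (-72,144,36,54,18,-90,18,-36,54); (-72,144,-36,54,18,90,18,-36,-54);
(-72,36,144,54,-90,18,18,54,-36); (-72,36,-144,54,-90,-18,18,54,36); (-72,-36,144,54,90,18,18,-54,-36);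
(-72,-36,-144,54,90,-18,18,-54,36); (-72,-144,36,54,-18,-90,18,36,54); (-72,-144,-36,54,-18,90,18,36,-54);
(72,-36,-144,-54,90,-18,36,-18,54); (72,-36,144,-54,90,18,36,-18,-54); (72,-144,-36,-54,-18,90,36,54,-18);
(72,-144,36,-54,-18,-90,36,54,18); (72,144,-36,-54,18,90,36,-54,-18); (72,144,36,-54,18,-90,36,-54,18);
(72,36,-144,-54,-90,-18,36,18,54); (72,36,144,-54,-90,18,36,18,-54); (-36,72,-144,90,-54,-18,-18,36,54);
(-36,72,144,90,-54,18,-18,36,-54); (-36,-144,72,90,-18,-54,-18,54,36); (-36,-144,-72,90,-18,54,-18,54,-36);
(-36,144,72,90,18,-54,-18,-54,36); (-36,144,-72,90,18,54,-18,-54,-36); (-36,-72,-144,90,54,-18,-18,-36,54);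
(-36,-72,144,90,54,18,-18,-36,-54); (136,64,-68,-18,-90,-54,-6,12,66); (4,128,-104,-66,30,78,58,-34,4);
(4,128,104,-66,30,-78,58,-34,-4); (4,-128,-104,-66,-30,78,58,34,4); (88,64,-124,-66,78,30,34,-44,38);
(88,64,124,-66,78,-30,34,-44,-38); (88,-64,-124,-66,-78,30,34,44,38); (88,-64,124,-66,-78,-30,34,44,-38);
(88,124,-64,-66,-30,-78,34,-38,44); (-64,136,-68,90,-18,-54,-12,-6,66); (-124,64,88,30,78,-66,38,-44,34);
(-124,64,-88,30,78,66,38,-44,-34); (128,4,-104,30,-66,78,-34,58,4); (128,4,104,30,-66,-78,-34,58,-4);
(128,104,4,30,-78,-66,-34,-4,58); (128,104,-4,30,-78,66,-34,-4,-58); (128,-4,-104,30,66,78,-34,-58,4);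
(128,-4,104,30,66,-78,-34,-58,-4); (-104,4,128,78,-66,30,4,58,-34); (-104,128,-4,78,30,66,4,-34,-58);
(-104,-4,-128,78,66,-30,4,-58,34); (64,88,124,78,-66,-30,-44,34,-38); (64,-124,88,78,30,-66,-44,38,34);
(64,124,88,78,-30,-66,-44,-38,34); (64,124,-88,78,-30,66,-44,-38,-34); (64,-88,-124,78,66,30,-44,-34,38);
(-100,104,80,-30,6,-102,62,-4,26); (-100,-80,-104,-30,102,-6,62,-26,4); (-100,80,104,-30,-102,6,62,26,-4);
(-100,80,-104,-30,-102,-6,62,26,4); (152,-64,4,-30,6,102,-10,44,-50); (152,4,-64,-30,102,6,-10,-50,44);
(152,64,4,-30,-6,102,-10,-44,-50); (152,64,-4,-30,-6,-102,-10,-44,50); (-68,64,136,-54,-90,-18,66,12,-6);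
(-68,-136,-64,-54,18,90,66,6,-12); (144,-72,36,18,54,-90,-36,18,54); (144,-72,-36,18,54,90,-36,18,-54);
(144,36,-72,18,-90,54,-36,54,18); (144,36,72,18,-90,-54,-36,54,-18); (144,-36,-72,18,90,54,-36,-54,18);
(144,-36,72,18,90,-54,-36,-54,-18); (144,72,36,18,-54,-90,-36,-18,54); (144,72,-36,18,-54,90,-36,-18,-54);
(36,-72,144,-90,54,18,54,18,-36); (36,-72,-144,-90,54,-18,54,18,36); (36,144,-72,-90,18,54,54,-36,18);
(36,144,72,-90,18,-54,54,-36,-18); (36,-144,-72,-90,-18,54,54,36,18); (36,-144,72,-90,-18,-54,54,36,-18);
(36,72,144,-90,-54,18,54,-18,-36); (36,72,-144,-90,-54,-18,54,-18,36); (96,60,-120,-86,-38,-50,34,-26,52);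
(120,60,-96,50,-38,86,-52,-26,-34); (-80,104,-100,102,6,-30,-26,-4,62); (-80,-100,-104,102,-30,-6,-26,62,4);
(-80,100,-104,102,30,-6,-26,-62,4); (-80,-104,100,102,-6,30,-26,4,-62); (4,-64,-152,102,6,30,-50,44,10);
(4,152,-64,102,-30,6,-50,-10,44); (4,-152,-64,102,30,6,-50,10,44); (4,64,152,102,-6,-30,-50,-44,-10);
(-124,104,-32,86,62,10,-6,-60,-30); (-96,60,120,-54,18,-90,66,6,12); (-96,-120,60,-54,90,18,66,-12,6);
(-96,-120,-60,-54,90,-18,66,-12,-6); (-96,-60,-120,-54,-18,90,66,-6,-12); (-40,-160,4,-82,50,46,66,12,6);
(156,-24,48,-54,18,90,-6,30,-60); (156,-24,-48,-54,18,-90,-6,30,60); (156,48,-24,-54,90,18,-6,-60,30);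
(156,-48,-24,-54,-90,18,-6,60,30); (156,-48,24,-54,-90,-18,-6,60,-30); (156,24,48,-54,-18,90,-6,-30,-60);
(156,24,-48,-54,-18,-90,-6,-30,60); (164,16,-8,-18,-54,90,-30,-6,-60); (-120,60,-96,90,18,-54,-12,6,66);
(-120,60,96,90,18,54,-12,6,-66); (-120,-96,60,90,-54,18,-12,66,6); (-120,-96,-60,90,-54,-18,-12,66,-6);
(-120,96,-60,90,54,-18,-12,-66,-6); (48,156,-24,90,-54,18,-60,-6,30); (48,-156,-24,90,54,18,-60,6,30);
(48,-156,24,90,54,-18,-60,6,-30); (48,24,156,90,-18,-54,-60,-30,-6); (48,24,-156,90,-18,54,-60,-30,6);
(104,32,-124,62,-10,86,-60,30,-6); (160,40,4,-50,82,46,-12,-66,6); (-48,24,156,106,10,2,-44,22,-46);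
(-48,-156,-24,106,-2,-10,-44,46,-22); (-144,72,-36,-18,-54,90,54,36,-18); (-144,72,36,-18,-54,-90,54,36,18);
(-144,-36,72,-18,90,-54,54,-18,36); (-144,-36,-72,-18,90,54,54,-18,-36); (-144,36,72,-18,-90,-54,54,18,36);
(-144,36,-72,-18,-90,54,54,18,-36); (-144,-72,-36,-18,54,90,54,-36,-18); (-144,-72,36,-18,54,-90,54,-36,18)]]
7 6 3024 3528 108 1512 2 [1])].

Definition cert_1_2_4_8 : cert :=
Cert (Coeffs 2 4 8) 93 2618 733603 1 [0] [(Plan 2 240 1 Squares [[orbit_part 2 1 2 4 1 1 1 [(0,0); (3,0)];
orbit_part 3 1 3 3 3 3 1 [(2,1); (0,0)]; orbit_part 5 1 5 1 1 5 25 [(0,1); (0,0)]]]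
[unsigned [(2,-6,-8,2,6,-2,-3,-1,2); (-2,6,8,6,2,-2,-3,-1,-2); (-2,-8,6,6,2,2,-3,2,-1);
  (2,6,8,6,-2,-2,-3,1,-2);
(8,-2,6,-2,6,2,-2,-3,-1); (8,2,6,2,2,-6,-2,-3,1); (-6,-2,-8,2,-6,2,-1,3,2); (6,8,-2,2,-2,6,-1,-2,-3);
(6,2,8,2,-6,-2,-1,3,-2); (-6,-8,2,6,-2,2,-1,2,-3); (6,2,-8,-6,2,-2,1,-3,2); (6,8,2,-6,2,2,1,-2,-3);
(6,-2,8,-6,-2,2,1,3,-2); (-6,-2,8,-2,6,-2,1,-3,-2); (-6,8,2,-2,-2,-6,1,-2,3); (-6,2,-8,-2,-6,2,1,3,2);
(6,-8,-2,-2,2,-6,1,2,3); (-8,2,-6,2,6,2,2,-3,-1); (-8,6,-2,2,2,6,2,-1,-3); (-8,-6,2,2,-2,-6,2,1,3);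
(-2,8,6,-6,-2,-2,3,-2,1); (-2,6,-8,-2,-6,-2,3,1,2); (-2,-10,0,-2,2,6,3,1,-2); (-2,-8,-6,-2,-2,6,3,2,-1)]]
1 12 288 24 48 96 1 [0])].

Definition cert_1_2_4_12 : cert :=
Cert (Coeffs 2 4 12) 135 4886 1987790 1 [0] [(Plan 2 456 1 Squares [[orbit_part 2 1 2 4 1 1 1 [(0,0); (3,0)];
orbit_part 19 1 19 1 1 19 361 [(0,1); (0,0)]]] [unsigned [(-2,10,10,7,4,-5,-3,-2,-1);
  (-2,10,-10,7,-5,-4,-3,-1,2);
(-2,14,-2,9,0,3,-3,-2,1); (10,-2,10,-5,7,4,-1,-3,-2); (2,14,-2,-3,0,9,-1,-2,-3); (2,-14,2,-3,0,-9,-1,2,3);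
(2,2,14,-3,-9,0,-1,3,-2); (14,2,-2,-3,9,0,-1,-3,2); (10,2,10,-5,8,1,1,-2,-3); (-14,-2,2,3,0,9,1,2,-3);
(-2,-2,14,3,9,0,1,-3,-2); (-2,14,2,3,0,-9,1,-2,3); (-10,-10,2,5,-4,-7,1,2,3); (-10,2,-10,-4,-7,5,2,3,1);
(-14,-2,-2,0,9,3,2,-3,1); (-2,-14,2,-9,3,0,3,1,-2); (-2,-2,-14,-9,0,3,3,2,1); (2,14,2,-9,0,-3,3,-2,-1);
(2,-10,10,-7,-4,-5,3,2,-1); (-10,2,10,-1,8,-5,3,-2,1)]] 1 18 144 8 72 144 1 [0])].

(** The plans serve [N = 3] modulo 4, [N = 0] modulo 3 and [N = 0] modulo 4; their union is the list
    of eight residues modulo 12. *)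
Definition cert_1_2_4_5 : cert :=
Cert (Coeffs 2 4 5) 60 1324 238743 12 [0; 3; 4; 6; 7; 8; 9; 11] [(Plan 5 480 1 Squares
[[orbit_part 2 2 4 8 4 4 1 [(7,1); (7,2); (0,0); (3,0); (4,0); (7,0)]; orbit_part 3 1 3 3 3 3 1 [(2,1);
  (0,0)];
orbit_part 5 1 5 5 1 1 1 [(0,0)]]] [unsigned [(10,6,-8,0,4,8,-6,-2,-4); (10,10,0,0,-4,8,-6,2,-4);
(10,0,10,4,0,-8,-6,4,2); (2,14,0,8,-4,0,-6,-2,-4); (2,0,14,8,0,-4,-6,4,-2); (0,10,10,0,4,-8,-4,-6,2);
(0,2,14,0,8,-4,-4,-6,-2); (0,-10,10,0,8,4,-4,-2,-6); (-10,10,0,4,0,8,-2,-6,-4); (-10,0,-10,4,8,0,-2,-4,6);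
(6,8,10,4,-8,0,-2,4,-6); (-10,10,0,8,4,0,-2,-6,4); (-10,0,10,8,0,4,-2,4,-6); (10,0,10,-8,0,4,2,-4,-6);
(-6,8,10,-4,-8,0,2,4,-6); (10,10,0,-4,0,-8,2,-6,4); (10,0,-10,-4,8,0,2,-4,6); (10,-10,0,-4,0,8,2,6,-4);
(0,10,-10,-8,-4,0,4,2,6); (8,10,-6,-8,0,-4,4,-6,2); (8,6,10,-8,4,0,4,-2,-6); (-10,10,0,0,-4,-8,6,2,4);
(-10,0,-10,0,-8,4,6,4,-2); (-10,8,-6,0,-8,-4,6,4,2)]] 5 24 576 120 24 96 4 [3]); (Plan 5 1080 1 Squares
[[orbit_part 2 2 4 8 4 4 1 [(7,1); (2,2); (6,2); (7,2); (0,0); (4,0); (7,0)];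
orbit_part 3 1 3 3 3 3 1 [(0,0); (1,0); (2,0)]; orbit_part 5 1 5 5 1 1 1 [(0,0)]]]
[unsigned [(15,9,-12,0,6,12,-9,-3,-6); (15,15,0,0,-6,12,-9,3,-6); (15,0,-15,6,0,12,-9,-6,-3);
(15,15,0,6,-12,0,-9,3,6); (15,0,15,6,0,-12,-9,6,3); (0,-3,-21,0,-12,6,-6,9,3); (-12,-9,-15,12,-6,0,-6,3,9);
(-12,-15,9,12,0,6,-6,9,-3); (0,15,-15,12,0,6,-6,-9,-3); (0,15,15,12,0,-6,-6,-9,3); (21,-3,0,-6,-12,0,-3,9,-6);
(-15,0,-15,6,12,0,-3,-6,9); (9,15,-12,6,0,12,-3,-9,-6); (9,-12,15,6,12,0,-3,-6,-9); (-15,0,15,12,0,6,-3,6,-9);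
(15,0,15,-12,0,6,3,-6,-9); (15,-15,0,-12,-6,0,3,9,6); (-9,15,-12,-6,0,12,3,-9,-6);
  (-9,-12,15,-6,12,0,3,-6,-9);
(-9,-12,-15,-6,12,0,3,-6,9); (-9,-15,-12,-6,0,12,3,9,-6); (15,15,0,-6,0,-12,3,-9,6);
  (0,15,-15,-12,-6,0,6,3,9);
(12,15,9,-12,0,6,6,-9,-3); (12,9,-15,-12,6,0,6,-3,9); (12,-9,15,-12,-6,0,6,3,-9); (0,15,15,0,-12,6,6,3,-9);
(0,15,-15,0,-12,-6,6,3,9); (0,-15,-15,0,-6,12,6,9,-3); (-15,15,0,-6,-12,0,9,3,-6); (-15,-12,9,0,12,6,9,-6,-3);
(-15,0,15,0,12,-6,9,-6,3); (-15,9,-12,0,6,12,9,-3,-6); (-15,-9,-12,0,-6,12,9,3,-6);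
  (-15,0,-15,0,-12,6,9,6,-3);
(-15,12,-9,0,-12,-6,9,6,3)]] 5 54 1296 120 54 216 3 [0]); (Plan 5 1920 1 Squares
[[orbit_part 2 2 4 8 4 4 1 [(7,1); (7,2); (0,0); (1,0); (2,0); (3,0); (4,0); (5,0); (6,0); (7,0)];
orbit_part 3 1 3 3 3 3 1 [(2,1); (0,0)]; orbit_part 5 1 5 5 1 1 1 [(0,0)]]] [unsigned
  [(20,12,-16,0,8,16,-12,-4,-8);
(20,20,0,0,-8,16,-12,4,-8); (20,0,20,8,0,-16,-12,8,4); (4,28,0,16,-8,0,-12,-4,-8); (4,0,28,16,0,-8,-12,8,-4);
(0,20,20,0,8,-16,-8,-12,4); (0,4,28,0,16,-8,-8,-12,-4); (0,-20,20,0,16,8,-8,-4,-12);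
  (-20,20,0,8,0,16,-4,-12,-8);
(-20,0,-20,8,16,0,-4,-8,12); (12,16,20,8,-16,0,-4,8,-12); (-20,20,0,16,8,0,-4,-12,8);
  (-20,0,20,16,0,8,-4,8,-12);
(20,0,20,-16,0,8,4,-8,-12); (-12,16,20,-8,-16,0,4,8,-12); (20,20,0,-8,0,-16,4,-12,8);
  (20,0,-20,-8,16,0,4,-8,12);
(20,-20,0,-8,0,16,4,12,-8); (0,20,-20,-16,-8,0,8,4,12); (16,20,-12,-16,0,-8,8,-12,4);
  (16,12,20,-16,8,0,8,-4,-12);
(-20,20,0,0,-8,-16,12,4,8); (-20,0,-20,0,-16,8,12,8,-4); (-20,16,-12,0,-16,-8,12,8,4)]] 5 96 2304 120 96 384 4
  [0])].

End Data.

(** * Verification of the table *)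

Record row := Row { coefs : seq nat; exceptions : seq nat; large : cert; moving : nat; width : nat; blockn : nat }.

Definition rows : seq row :=
  [:: Row [:: 1; 1; 1; 1] [:: 9; 21; 31; 43; 55; 89] cert_1_1_1_1 0 300 19;
      Row [:: 1; 1; 1; 2] [::] cert_1_1_1_2 0 200 21;
      Row [:: 1; 1; 1; 3] [:: 19] cert_1_1_1_3 0 400 37;
      Row [:: 1; 1; 1; 4] [:: 8] cert_1_1_1_4 0 400 41;
      Row [:: 1; 1; 2; 2] [::] cert_1_1_2_2 0 300 23;
      Row [:: 1; 1; 2; 3] [::] cert_1_1_2_3 0 300 25;
      Row [:: 1; 1; 2; 4] [::] cert_1_1_2_4 0 300 27;
      Row [:: 1; 1; 2; 5] [::] cert_1_1_2_5 0 2000 151;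
      Row [:: 1; 1; 2; 6] [::] cert_1_1_2_6 0 1000 105;
      Row [:: 1; 1; 2; 7] [:: 28] cert_1_1_2_7 3 8000 196;
      Row [:: 1; 1; 2; 8] [:: 39] cert_1_1_2_8 0 2500 237;
      Row [:: 1; 1; 2; 9] [:: 18] cert_1_1_2_9 0 4000 374;
      Row [:: 1; 1; 3; 3] [:: 14] cert_1_1_3_3 0 1400 93;
      Row [:: 1; 1; 3; 4] [:: 11; 18; 81] cert_1_1_3_4 0 500 46;
      Row [:: 1; 1; 3; 5] [:: 19] cert_1_1_3_5 0 1400 105;
      Row [:: 1; 1; 3; 6] [::] cert_1_1_3_6 0 1400 110;
      Row [:: 1; 1; 3; 7] [:: 14; 18] cert_1_1_3_7 0 2500 237;
      Row [:: 1; 2; 2; 2] [:: 8; 43; 67; 135] cert_1_2_2_2 1 1000 51;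
      Row [:: 1; 2; 2; 3] [:: 33] cert_1_2_2_3 1 300 19;
      Row [:: 1; 2; 2; 4] [::] cert_1_2_2_4 1 6000 404;
      Row [:: 1; 2; 2; 5] [:: 23; 33] cert_1_2_2_5 1 2000 100;
      Row [:: 1; 2; 2; 6] [::] cert_1_2_2_6 1 2000 119;
      Row [:: 1; 2; 3; 3] [:: 34; 99] cert_1_2_3_3 2 2000 68;
      Row [:: 1; 2; 3; 4] [::] cert_1_2_3_4 3 1400 53;
      Row [:: 1; 2; 3; 5] [::] cert_1_2_3_5 0 5000 460;
      Row [:: 1; 2; 3; 6] [:: 63] cert_1_2_3_6 0 3000 237;
      Row [:: 1; 2; 3; 7] [::] cert_1_2_3_7 1 3000 130;
      Row [:: 1; 2; 3; 8] [:: 31; 63] cert_1_2_3_8 2 6000 225;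
      Row [:: 1; 2; 3; 9] [:: 42] cert_1_2_3_9 1 6000 366;
      Row [:: 1; 2; 4; 4] [:: 17] cert_1_2_4_4 2 5000 201;
      Row [:: 1; 2; 4; 6] [::] cert_1_2_4_6 3 10000 283;
      Row [:: 1; 2; 4; 7] [::] cert_1_2_4_7 3 12000 297;
      Row [:: 1; 2; 4; 8] [::] cert_1_2_4_8 2 10000 350;
      Row [:: 1; 2; 4; 12] [:: 8; 138] cert_1_2_4_12 3 20000 333].

(** The inequality on [start] says that the blocks reach the range of the certificate. It is doubled
    and stated in [Z] to avoid evaluating [P5] on unary numbers. *)
Definition row_ok (r : row) : bool :=
  let c := large r in
  [&& cert_ok c, coefs r == [:: 1; Z.to_nat (co1 (co c)); Z.to_nat (co2 (co c)); Z.to_nat (co3 (co c))],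
      all (zmem ^~ (creq c)) (zrange 0 (Z.to_nat (cmod c))),
      all (leq 1) (coefs r), all (gtn 145) (exceptions r), all (fun e => ~~ is_sumb (coefs r) e) (exceptions r),
      moving r < size (coefs r),
      (2 * start c <=? Z.of_nat (nth 0%N (coefs r) (moving r)) *
         (3 * (Z.of_nat (blockn r) * Z.of_nat (blockn r)) - Z.of_nat (blockn r)))%Z
    & finite_check (coefs r) (exceptions r) (moving r) (width r) 400 (blockn r)].

Lemma rows_ok : all row_ok rows.
Proof. by vm_compute. Qed.

Lemma cert_1_2_4_5_ok : cert_ok cert_1_2_4_5.
Proof. by vm_compute. Qed.

Lemma double_P5 x : (2 * Z.of_nat (P5 x) = 3 * (Z.of_nat x * Z.of_nat x) - Z.of_nat x)%Z.
Proof. by elim: x => // x IH; rewrite P5S; lia. Qed.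

Lemma cert_is_sum c N : cert_ok c -> (start c <= Z.of_nat N)%Z -> zmem (Z.of_nat N mod cmod c) (creq c) ->
  is_sum [:: 1; Z.to_nat (co1 (co c)); Z.to_nat (co2 (co c)); Z.to_nat (co3 (co c))] N.
Proof.
move=> hc hN hr.
have hsq n : (0 < n)%Z -> (n mod 4 = 1 \/ n mod 4 = 2 \/ n mod 8 = 3)%Z -> represents (TF 1 1 1 0 0 0) n.
  by move=> n0 h; apply: represents_three_squares => //; case: h => [|[]] h; [constructor 1|constructor 2|constructor 3].
have hram P n : In P odd_ramified -> (0 < n)%Z -> anisotropic_modb P (n mod P)%Z ->
    exists f, In f (classes P) /\ represents f (P * n)%Z.
  move=> hP n0 ha; apply: represents_ramified => //; apply: anisotropic_modP => //.
  by case: hP => [<-|[<-|[<-|[<-|[<-|[]]]]]].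
have [w [x [y [z [w0 [x0 [y0 [z0 e]]]]]]]] := cert_sound hsq represents_unramified hram hc hN hr.
have [c10 [c20 c30]] : (0 < co1 (co c) /\ 0 < co2 (co c) /\ 0 < co3 (co c))%Z.
  by move: hc; rewrite /cert_ok => /andP[/andP[/andP[/andP[/andP[/andP[/andP[/andP[]]]]]]]]; lia.
exists (Z.to_nat w), (Z.to_nat (co1 (co c)) * P5 (Z.to_nat x) + (Z.to_nat (co2 (co c)) * P5 (Z.to_nat y)
  + Z.to_nat (co3 (co c)) * P5 (Z.to_nat z))); split; last first.
  exists (Z.to_nat x), (Z.to_nat (co2 (co c)) * P5 (Z.to_nat y) + Z.to_nat (co3 (co c)) * P5 (Z.to_nat z)); split=> //.
  exists (Z.to_nat y), (Z.to_nat (co3 (co c)) * P5 (Z.to_nat z)); split=> //.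
  by exists (Z.to_nat z), 0; rewrite addn0.
have h t : (0 <= t -> 2 * Z.of_nat (P5 (Z.to_nat t)) = 3 * (t * t) - t)%Z.
  by move=> t0; rewrite double_P5 Z2Nat.id.
move: e; rewrite /weighted -!h //; clear -c10 c20 c30 => e.
apply: Nat2Z.inj; rewrite !Nat2Z.inj_add !Nat2Z.inj_mul !Z2Nat.id; lia.
Qed.

Lemma row_represents r N : row_ok r ->
  (represented (coefs r) N \/ N \in exceptions r) /\ (N \in exceptions r -> ~ represented (coefs r) N).
Proof.
case/and5P=> hc /eqP hco hreq hpos /and5P[hlt hnot hj hstart hfin].
split; last first.
  move=> hN /represented_is_sum /(is_sumbP hpos (allP hlt _ hN)).
  exact/negP/(allP hnot).
have [h|h] := Z_le_gt_dec (start (large r)) (Z.of_nat N).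
  left; apply/represented_is_sum; rewrite hco; apply: cert_is_sum => //.
  have m0 : (0 < cmod (large r))%Z.
    by move: hc; rewrite /cert_ok => /andP[/andP[/andP[/andP[]]]]; lia.
  have hm := Z.mod_pos_bound (Z.of_nat N) _ m0.
  move/forallb_forall: hreq; apply; apply: in_zrange; lia.
rewrite represented_is_sum; apply: (finite_check_sound hj hfin).
by move/Z.leb_le: hstart; have := double_P5 (blockn r); lia.
Qed.

(** The bounds [N_a] are projected away, so conversion does not expand their large numerals. *)
Lemma table_rows : [seq (r.1.1, r.2) | r <- table] = [seq (coefs r, exceptions r) | r <- rows].
Proof. by []. Qed.

(** * Comparison of large decimal literals *)

Fixpoint decimal_value (d : Decimal.uint) (acc : Z) : Z :=
  match d with
  | Decimal.Nil => acc
  | Decimal.D0 d => decimal_value d (10 * acc)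
  | Decimal.D1 d => decimal_value d (10 * acc + 1)
  | Decimal.D2 d => decimal_value d (10 * acc + 2)
  | Decimal.D3 d => decimal_value d (10 * acc + 3)
  | Decimal.D4 d => decimal_value d (10 * acc + 4)
  | Decimal.D5 d => decimal_value d (10 * acc + 5)
  | Decimal.D6 d => decimal_value d (10 * acc + 6)
  | Decimal.D7 d => decimal_value d (10 * acc + 7)
  | Decimal.D8 d => decimal_value d (10 * acc + 8)
  | Decimal.D9 d => decimal_value d (10 * acc + 9)
  end%Z.

(* Large numerals of type [nat] are kept unevaluated. *)
Lemma of_num_uint_value d : Z.of_nat (Nat.of_num_uint (Number.UIntDecimal d)) = decimal_value d 0.
Proof.
rewrite /Nat.of_num_uint /Nat.of_uint -[0%Z]/(Z.of_nat 0).
by elim: d 0 => // d IH n; cbn [decimal_value Nat.of_uint_acc]; rewrite IH Nat.tail_mul_spec; congr decimal_value; lia.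
Qed.

Lemma numeral_bound d m : (Z.of_nat m <= decimal_value d 0)%Z -> m <= Nat.of_num_uint (Number.UIntDecimal d).
Proof. by rewrite -of_num_uint_value; lia. Qed.

Lemma numeral_le d N c : Nat.of_num_uint (Number.UIntDecimal d) <= N ->
  (c <= decimal_value d 0)%Z -> (c <= Z.of_nat N)%Z.
Proof. by rewrite -of_num_uint_value; lia. Qed.

Lemma table_bounds : List.Forall (leq 145) [seq r.1.2 | r <- table].
Proof.
rewrite /table; cbn [map fst snd].
(* Large literals are parsed as [Nat.of_num_uint] of their digits and are compared in [Z]; small
   ones are plain constructors and compute. *)
repeat match goal with
| |- List.Forall _ (Nat.of_num_uint _ :: _) => apply List.Forall_cons; [apply numeral_bound; by vm_compute|]
| |- List.Forall _ (_ :: _) => apply List.Forall_cons; [exact isT|]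
end.
exact: List.Forall_nil.
Qed.

Lemma Forall_mem (T : eqType) (P : T -> Prop) (s : seq T) x : List.Forall P s -> x \in s -> P x.
Proof. by elim=> // y {}s hy _ IH; rewrite inE => /orP[/eqP ->|]. Qed.

Lemma map_all_exists (T : Type) (U : eqType) (f : T -> U) (p : pred T) (s : seq T) (u : U) :
  all p s -> u \in map f s -> exists2 x, p x & u = f x.
Proof.
elim: s => //= x s IH /andP[hx hs]; rewrite inE => /orP[/eqP ->|]; first by exists x.
exact: IH.
Qed.

Theorem theorem1p2 :
  (forall (a : seq nat) (Na : nat) (Ea : seq nat),
      (a, Na, Ea) \in table ->
      (forall N : nat, Na <= N -> represented a N) /\
      (forall N : nat, ~ represented a N <-> N \in Ea)) /\
  (forall N : nat, 355873 <= N ->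
      N %% 12 \in [:: 0; 3; 4; 6; 7; 8; 9; 11] ->
      represented [:: 1; 2; 4; 5] N).
Proof.
split=> [a Na Ea h|N hN hmod].
  have := map_f (fun r => (r.1.1, r.2)) h; rewrite table_rows => /(map_all_exists rows_ok) [r hr [-> ->]].
  have hE e : e \in exceptions r -> e < 145.
    by case/and5P: hr => _ _ _ _ /andP[/allP hlt _] /hlt.
  split=> N.
    (* An exception is below 145, while each [N_a] is at least 145; hence [N >= N_a] is never
       exceptional. *)
    move=> hN; have [[//|/hE lt145] _] := row_represents N hr.
    by move: lt145; rewrite ltnNge (leq_trans (Forall_mem table_bounds (map_f (fun r => r.1.2) h)) hN).
  by have [[hrep|//] hnot] := row_represents N hr; split=> // /(_ hrep).
apply/represented_is_sum/(cert_is_sum cert_1_2_4_5_ok).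
  by apply: (numeral_le hN); vm_compute.
rewrite -(modn_Zmod N 12); move: hmod; rewrite !inE.
by do ?case/orP; move/eqP ->.
Qed.
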